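(* Let $m\ge1$ and $u\in H^1(\mathbb{R},\mathbb{R}^m)$. Then for any vector field $X$ on $\mathbb{R}$ whose flow consists of affine functions from the real line to itself there holds $$u\,\frac{d}{dx}\left[(-\Delta)^{\frac12}u\,X\right]=u\,(-\Delta)^{\frac12}(u'X)$$ in the sense of distributions.
   Context: Vector fields on $\mathbb{R}$ are identified with functions; those with affine flow are $X(x)=\alpha x+\beta$ (e.g. $X\equiv1$ for translations, $X(x)=x$ for dilations). $(-\Delta)^{\frac12}$ is the Fourier multiplier $|\xi|$. The products (scalar products in $\mathbb{R}^m$) with $u\in H^1$ are the distributions $\varphi\mapsto-\int_{\mathbb{R}}X\,(-\Delta)^{\frac12}u\cdot(u\varphi)'\,dx$ and $\varphi\mapsto\int_{\mathbb{R}}X\,u'\cdot(-\Delta)^{\frac12}(u\varphi)\,dx$, $\varphi\in C_c^\infty(\mathbb{R})$, respectively. *)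

(* Defs.v *)
From mathcomp Require Import all_boot all_order all_algebra.
From mathcomp Require Import all_classical all_reals all_analysis.
Import Order.TTheory GRing.Theory Num.Theory.
Import numFieldNormedType.Exports.

Set Implicit Arguments.
Unset Strict Implicit.
Unset Printing Implicit Defensive.

Local Open Scope classical_set_scope.
Local Open Scope ring_scope.

(* Elements of L^2, weak derivatives, Fourier transforms, etc. are only
   determined almost everywhere. The notions below are therefore relations
   between functions: "g is a representative of the weak derivative of f", and
   so on. *)

Section scalar_functions.
Variable R : realType.
Local Notation mu := (@lebesgue_measure R).
Implicit Types (f g phi s A B : R -> R).

(* phi in C_c^oo(R) *)
Definition test_function phi : Prop :=
  (forall (n : nat) (x : R), derivable (phi^`(n)%classic) x 1) /\
  compact (closure [set x | phi x != 0]).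

Definition L2 f : Prop := f \in Lfun mu 2%:E.

Definition weak_derivative f g : Prop :=
  [/\ locally_integrable [set: R] f, locally_integrable [set: R] g &
    forall phi, test_function phi ->
      \int[mu]_x (f x * phi^`()%classic x) = - \int[mu]_x (g x * phi x)].

(* Real and imaginary parts of the Fourier transform
   xi |-> \int f(x) e^{-i x xi} dx  of the truncation of f to [-n, n]. *)
Definition truncated_fourier_re (n : nat) f : R -> R := fun xi =>
  \int[mu]_(x in `[- n%:R, n%:R]) (f x * cos (x * xi)).
Definition truncated_fourier_im (n : nat) f : R -> R := fun xi =>
  - \int[mu]_(x in `[- n%:R, n%:R]) (f x * sin (x * xi)).

(* A + i B is the Fourier-Plancherel transform of f in L^2(R). *)
Definition fourier_L2 f A B : Prop :=
  [/\ L2 f, L2 A, L2 B,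
    'N[mu]_2%:E[EFin \o (truncated_fourier_re n f \- A)%R]%E
      @[n --> \oo] --> 0%E &
    'N[mu]_2%:E[EFin \o (truncated_fourier_im n f \- B)%R]%E
      @[n --> \oo] --> 0%E].

(* g is the image of f under the Fourier multiplier with real symbol s *)
Definition fourier_multiplier s f g : Prop :=
  exists A B A' B', [/\ fourier_L2 f A B, fourier_L2 g A' B' &
    {ae mu, forall xi, A' xi = s xi * A xi /\ B' xi = s xi * B xi}].

(* g = (-Delta)^{1/2} f *)
Definition half_laplacian f g : Prop :=
  fourier_multiplier (fun xi => `|xi|) f g.

(* Phi t x is the position at time t of the integral curve of X which is at x
   at time 0. *)
Definition flow (X : R -> R) (Phi : R -> R -> R) : Prop :=
  (forall x, Phi 0 x = x) /\
  (forall t x : R, is_derive t 1 (Phi^~ x) (X (Phi t x))).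

Definition affine_map (h : R -> R) : Prop :=
  exists a b : R, forall x, h x = a * x + b.

End scalar_functions.

Section vector_functions.
Variables (R : realType) (m : nat).
Implicit Types u v w : R -> 'rV[R]_m.

Definition component u (i : 'I_m) : R -> R := fun x => u x ord0 i.

Definition vL2 u : Prop := forall i, L2 (component u i).

Definition vweak_derivative u v : Prop :=
  forall i, weak_derivative (component u i) (component v i).

Definition vhalf_laplacian u w : Prop :=
  forall i, half_laplacian (component u i) (component w i).

(* u in H^1(R, R^m) *)
Definition H1 u : Prop := vL2 u /\ exists2 v, vweak_derivative u v & vL2 v.

Definition dot (a b : 'rV[R]_m) : R := \sum_(i < m) a ord0 i * b ord0 i.

End vector_functions.

(* Main.v *)
(* Let P_e be the Poisson kernel of the half-plane at height e and Q_e = - dP_e/de.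
   If L is the half-Laplacian then Q_e * f = P_e * L f for f in its domain. In the
   products of (X w') with Q_e * u and of (X u') with Q_e * w, where w = phi u,
   integrate by parts so that both derivatives fall on the kernel: for
   X = al x + be, their sum retains only the dilation term
   al (2 Q_e(z) + z Q_e'(z)) = - al e P_e''(z), z = x - y. Integrating by parts
   twice more shows that the sum is O(e), by Schur's test. As e -> 0,
   P_e * Lu -> Lu and P_e * Lw -> Lw weakly in L^2, and the identity follows.
   The field X is unbounded, but w has compact support, so that Lw(x) = O(x^-2)
   at infinity and X Lw is square integrable away from the support.
   Since the integral curves of X depend on the initial point through an affine
   map, X itself is affine. *)
Require Import Defs.
From mathcomp Require Import all_boot all_order all_algebra.
From mathcomp Require Import all_classical all_reals all_analysis.
From mathcomp Require Import ring lra measurable_realfun.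
Import Order.TTheory GRing.Theory Num.Theory.
Import numFieldNormedType.Exports.
Local Open Scope classical_set_scope.
Local Open Scope ring_scope.

(** The half-Laplacian is given only as an almost everywhere relation between Plancherel transforms,
    themselves L^2 limits of truncated integrals; neither a pointwise formula nor self-adjointness
    is available at the start. Damping the symbols 1 and |xi| by e^(-e|xi|) makes every frequency
    integral absolutely convergent, so that passing to the kernels P_e and Q_e takes only Fubini on
    truncations and Hölder, with no Fourier inversion and no Parseval identity. The field enters the
    cancellation only through X(x) - X(y), which for affine X is exactly al (x - y). This meets the
    homogeneity of Q_e and leaves no remainder besides the term carrying the factor e. Weak
    convergence is enough, because each Poisson integral is paired with a fixed function. Both
    pairings are not alike, though: X w' is square integrable since w' has bounded support, whereas
    X u' in general is not, so the pairing of X u' with Lw has to be split at a finite distance from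
    the support of w. The factor 1/pi of the Poisson kernel is dropped throughout, hence the factors
    pi in the limits. *)

Section real_integration.
Set Implicit Arguments.
Unset Strict Implicit.
Context {R : realType}.
Local Notation mu := (@lebesgue_measure R).
Local Notation intg f := (mu.-integrable [set: R] (EFin \o f)).
Implicit Types f g h : R -> R.

Lemma intg_measurable f : intg f -> measurable_fun [set: R] f.
Proof. by move=> /integrableP[/measurable_EFinP]. Qed.

Lemma intg_le f g : measurable_fun [set: R] f ->
  (forall x, `|f x| <= g x) -> intg g -> intg f.
Proof.
move=> mf fg; apply: le_integrable => //; first exact/measurable_EFinP.
by move=> x _ /=; rewrite lee_fin (le_trans (fg x))// ler_norm.
Qed.

Lemma intgD f g : intg f -> intg g -> intg (fun x => f x + g x).
Proof. by move=> fi gi; have := integrableD measurableT fi gi. Qed.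

Lemma intgB f g : intg f -> intg g -> intg (fun x => f x - g x).
Proof. by move=> fi gi; have := integrableB measurableT fi gi. Qed.

Lemma intgZ c f : intg f -> intg (fun x => c * f x).
Proof. by move=> fi; have := integrableZl measurableT c fi. Qed.

Lemma intg_norm f : intg f -> intg (fun x => `|f x|).
Proof. exact: integrable_norm. Qed.

Lemma intg_bounded f g (M : R) : intg f -> measurable_fun [set: R] g ->
  (forall x, `|g x| <= M) -> intg (fun x => g x * f x).
Proof.
move=> fi mg gM; apply: (@intg_le _ (fun x => M * `|f x|)).
- by apply: measurable_funM => //; exact: intg_measurable.
- by move=> x; rewrite normrM ler_wpM2r.
- exact/intgZ/intg_norm.
Qed.

Lemma ae_imp (P Q : R -> Prop) : {ae mu, forall x, P x} ->
  (forall x, P x -> Q x) -> {ae mu, forall x, Q x}.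
Proof.
move=> [A [mA A0 PA]] PQ; exists A; split => // x /= nQ; apply: PA => Px.
exact/nQ/PQ.
Qed.

Lemma ae_eq_Rint f g : measurable_fun [set: R] f -> measurable_fun [set: R] g ->
  {ae mu, forall x, f x = g x} -> \int[mu]_x f x = \int[mu]_x g x.
Proof.
move=> mf mg fg; congr fine; apply: ae_eq_integral => //.
- exact/measurable_EFinP.
- exact/measurable_EFinP.
- by apply: (ae_imp fg) => x /= ->.
Qed.

Lemma ae_eq_intg f g : measurable_fun [set: R] g ->
  {ae mu, forall x, f x = g x} -> intg f -> intg g.
Proof.
move=> mg fg /integrableP[mf fi]; apply/integrableP; split.
  exact/measurable_EFinP.
rewrite -(_ : (\int[mu]_x `|(EFin \o f) x| = \int[mu]_x `|(EFin \o g) x|)%E)//.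
apply: ae_eq_integral => //; first exact: measurableT_comp.
  by apply: measurableT_comp => //; exact/measurable_EFinP.
by apply: (ae_imp fg) => x /= ->.
Qed.

Lemma Rint_le f g : intg f -> intg g -> (forall x, f x <= g x) ->
  \int[mu]_x f x <= \int[mu]_x g x.
Proof. by move=> fi gi fg; apply: le_Rintegral. Qed.

Lemma RintD f g : intg f -> intg g ->
  \int[mu]_x (f x + g x) = \int[mu]_x f x + \int[mu]_x g x.
Proof. exact: RintegralD. Qed.

Lemma RintB f g : intg f -> intg g ->
  \int[mu]_x (f x - g x) = \int[mu]_x f x - \int[mu]_x g x.
Proof. exact: RintegralB. Qed.

Lemma RintZ c f : intg f -> \int[mu]_x (c * f x) = c * \int[mu]_x f x.
Proof. exact: RintegralZl. Qed.

Lemma RintN f : intg f -> \int[mu]_x (- f x) = - \int[mu]_x f x.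
Proof.
move=> fi; rewrite -mulN1r -RintZ//.
by apply: eq_Rintegral => x _; rewrite mulN1r.
Qed.

Lemma Rint_ext f g : f =1 g -> \int[mu]_x f x = \int[mu]_x g x.
Proof. by move=> fg; apply: eq_Rintegral => x _; exact: fg. Qed.

Lemma Rint0 : \int[mu]_x (0 : R) = 0.
Proof. by rewrite /Rintegral integral0. Qed.

Lemma EFin_Rint f : intg f -> (\int[mu]_x f x)%:E = (\int[mu]_x (f x)%:E)%E.
Proof. by move=> fi; rewrite /Rintegral fineK// integrable_fin_num. Qed.

Lemma Rint_abs_le f g : intg f -> intg g -> (forall x, `|f x| <= g x) ->
  `|\int[mu]_x f x| <= \int[mu]_x g x.
Proof.
move=> fi gi fg; rewrite (le_trans (le_normr_Rintegral measurableT fi))//.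
exact: Rint_le (intg_norm fi) gi fg.
Qed.

Lemma Rint_dominated (f_ : nat -> R -> R) f g :
  (forall n, measurable_fun [set: R] (f_ n)) -> measurable_fun [set: R] f ->
  {ae mu, forall x, f_ ^~ x @ \oo --> f x} ->
  intg g -> (forall n x, `|f_ n x| <= g x) ->
  intg f /\ (fun n => \int[mu]_x f_ n x) @ \oo --> \int[mu]_x f x.
Proof.
move=> mf_ mf ff gi fg.
have [fi _ fc] : [/\ intg f,
    [sequence \int[mu]_x `|(f_ n x)%:E - (f x)%:E|]_n @ \oo --> 0%E &
    [sequence \int[mu]_x (f_ n x)%:E]_n @ \oo --> (\int[mu]_x (f x)%:E)]%E.
  apply: (@dominated_convergence _ _ _ mu _ measurableT
    (fun n => EFin \o f_ n) (EFin \o f) (EFin \o g)) => //.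
  - by move=> n; apply/measurable_EFinP; exact: mf_.
  - exact/measurable_EFinP.
  - by apply: (ae_imp ff) => x fx _ /=; apply: cvg_EFin => //; exact: nearW.
  - by apply: aeW => x n _ /=; rewrite lee_fin.
split => //.
by move: fc; rewrite -EFin_Rint// => /fine_cvg.
Qed.

(** Tonelli's theorem gives measurability for the positive and the negative part separately, and
    [fine] preserves it, so sections of [k] with no finite integral do no harm. *)
Lemma measurable_int_param (k : R * R -> R) : measurable_fun [set: R * R] k ->
  measurable_fun [set: R] (fun x => \int[mu]_y k (x, y)).
Proof.
move=> mk; rewrite /Rintegral.
apply: measurableT_comp => //.
pose K := EFin \o k.
have mK : measurable_fun [set: R * R] K by exact/measurable_EFinP.
rewrite (_ : (fun x => _) =
    (fun x => \int[mu]_y (K^\+ (x, y)) - \int[mu]_y (K^\- (x, y)))%E).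
  apply: emeasurable_funB.
  - apply: measurable_fun_fubini_tonelli_F => //; exact: measurable_funepos.
  - apply: measurable_fun_fubini_tonelli_F => //; exact: measurable_funeneg.
apply/funext => x; rewrite [LHS]integralE.
by congr (_ - _)%E; apply: eq_integral => y _; rewrite !unlock.
Qed.

Lemma integrable_prod (k : R * R -> R) (a b : R -> R) :
  measurable_fun [set: R * R] k -> intg a -> intg b ->
  (forall x y, `|k (x, y)| <= a x * b y) ->
  (mu \x mu)%E.-integrable [set: R * R] (EFin \o k).
Proof.
move=> mk ai bi kab.
have mk1 x : measurable_fun [set: R] (fun y => k (x, y)).
  by apply: measurableT_comp => //; exact: measurable_pair1.
apply/integrable12ltyP; first exact/measurable_EFinP.
apply: (@le_lt_trans _ _ (\int[mu]_x (`|a x| * \int[mu]_y `|b y|)%:E)%E).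
  apply: ge0_le_integral => //.
  - by move=> x _; apply: integral_ge0.
  - have mK : measurable_fun [set: R * R] (abse \o (EFin \o k)).
      by apply: measurableT_comp => //; exact/measurable_EFinP.
    by apply: (measurable_fun_fubini_tonelli_F (m2 := mu) _ mK) => z /=.
  - apply/measurable_EFinP; apply: measurable_funM => //.
    exact: intg_measurable (intg_norm ai).
  - move=> x _; rewrite EFinM (EFin_Rint (intg_norm bi)) -integralZl//; last first.
      exact: (intg_norm bi).
    apply: ge0_le_integral => //.
    + by apply: measurableT_comp => //; apply/measurable_EFinP; exact: mk1.
    + apply/measurable_EFinP; apply: measurable_funM => //.
      exact: intg_measurable (intg_norm bi).
    + move=> y _; rewrite -EFinM lee_fin (le_trans (kab _ _))//.
      by rewrite -normrM ler_norm.
have := integrable_lty measurableT (intgZ (\int[mu]_y `|b y|) (intg_norm ai)).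
apply: le_lt_trans; rewrite le_eqVlt; apply/orP; left; apply/eqP.
by apply: eq_integral => x _ /=; rewrite mulrC.
Qed.

(** On a null set of sections the inner extended integral may fail to be finite, and there [fine]
    returns the default 0. Hence the real and the extended inner integrals are compared only almost
    everywhere, in [E1] and [E2]. *)
Lemma Rint_fubini (k : R * R -> R) :
  (mu \x mu)%E.-integrable [set: R * R] (EFin \o k) ->
  \int[mu]_x (\int[mu]_y k (x, y)) = \int[mu]_y (\int[mu]_x k (x, y)).
Proof.
move=> ki.
have mk : measurable_fun [set: R * R] k.
  by have /measurable_int/measurable_EFinP := ki.
have mk' : measurable_fun [set: R * R] (k \o (fun z : R * R => (z.2, z.1))).
  by apply: measurableT_comp => //; exact: measurable_swap.
have E1 : (\int[mu]_x (\int[mu]_y k (x, y))%:E =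
           \int[mu]_x \int[mu]_y (k (x, y))%:E)%E.
  apply: ae_eq_integral => //.
  - by apply/measurable_EFinP; exact: measurable_int_param.
  - exact: measurable_fubini_F ki.
  - apply: (ae_imp (ae_integrable1 ki)) => x h _; exact: EFin_Rint.
have E2 : (\int[mu]_y (\int[mu]_x k (x, y))%:E =
           \int[mu]_y \int[mu]_x (k (x, y))%:E)%E.
  apply: ae_eq_integral => //.
  - by apply/measurable_EFinP; exact: (measurable_int_param mk').
  - exact: measurable_fubini_G ki.
  - apply: (ae_imp (ae_integrable2 ki)) => x h _; exact: EFin_Rint.
by congr fine; rewrite E1 E2; exact: (@Fubini _ _ _ _ _ mu mu (EFin \o k) ki).
Qed.

Lemma intg_fubini (k : R * R -> R) :
  (mu \x mu)%E.-integrable [set: R * R] (EFin \o k) ->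
  intg (fun x => \int[mu]_y k (x, y)).
Proof.
move=> ki.
have mk : measurable_fun [set: R * R] k.
  by have /measurable_int/measurable_EFinP := ki.
have /integrableP[mF Foo] := integrable_fubini_F ki.
apply/integrableP; split.
  by apply/measurable_EFinP; exact: measurable_int_param.
apply: le_lt_trans Foo; rewrite le_eqVlt; apply/orP; left; apply/eqP.
apply: ae_eq_integral => //.
- apply: measurableT_comp => //.
  by apply/measurable_EFinP; exact: measurable_int_param.
- exact: measurableT_comp.
- apply: (ae_imp (ae_integrable1 ki)) => x h _ /=.
  by rewrite -[LHS]/(`| (\int[mu]_y k (x, y))%:E |%E) (EFin_Rint h).
Qed.

End real_integration.

(** * Square integrable functions and pairings *)

Section square_integrable_functions.
Set Implicit Arguments.
Unset Strict Implicit.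
Context {R : realType}.
Local Notation mu := (@lebesgue_measure R).
Local Notation intg f := (mu.-integrable [set: R] (EFin \o f)).
Implicit Types f g h : R -> R.

(** Working form of [L2]: it speaks of the function and its square directly, so that membership
    follows from pointwise bounds. *)
Definition square_integrable f :=
  measurable_fun [set: R] f /\ intg (fun x => f x ^+ 2).

Lemma L2_square_integrable f : L2 f -> square_integrable f.
Proof.
move=> f2; split; last exact: Lfun2_integrable_sqr.
by have /andP[/[!inE]] := f2.
Qed.

Lemma square_integrable_lty f : square_integrable f ->
  ('N[mu]_2%:E[EFin \o f] < +oo)%E.
Proof.
move=> [mf /integrableP[_ fi]]; rewrite unlock; apply: poweR_lty.
apply: le_lt_trans fi; rewrite le_eqVlt; apply/orP; left; apply/eqP.
apply: eq_integral => x _ /=.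
by rewrite powR_mulrn ?normr_ge0// -normrX.
Qed.

Lemma square_integrable_le f g : measurable_fun [set: R] f ->
  (forall x, `|f x| <= `|g x|) -> square_integrable g -> square_integrable f.
Proof.
move=> mf fg [mg gi]; split => //.
apply: intg_le gi; first exact: measurable_funX.
by move=> x; rewrite normrX -[leRHS]real_normK ?num_real// lerXn2r ?nnegrE.
Qed.

Lemma square_integrable_mul f g : square_integrable f -> square_integrable g ->
  intg (fun x => f x * g x).
Proof.
move=> [mf fi] [mg gi].
apply: (@intg_le _ _ (fun x => f x ^+ 2 + g x ^+ 2)) (intgD fi gi).
  exact: measurable_funM.
by move=> x; rewrite ler_norml; apply/andP; split; nra.
Qed.

Lemma square_integrableD f g : square_integrable f -> square_integrable g ->
  square_integrable (fun x => f x + g x).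
Proof.
move=> [mf fi] [mg gi]; split; first exact: measurable_funD.
apply: (@intg_le _ _ (fun x => 2 * (f x ^+ 2 + g x ^+ 2))).
- by apply: measurable_funX; exact: measurable_funD.
- by move=> x; rewrite ger0_norm ?sqr_ge0//; have := sqr_ge0 (f x - g x); nra.
- exact/intgZ/intgD.
Qed.

Lemma square_integrableB f g : square_integrable f -> square_integrable g ->
  square_integrable (fun x => f x - g x).
Proof.
move=> [mf fi] [mg gi]; split; first exact: measurable_funB.
apply: (@intg_le _ _ (fun x => 2 * (f x ^+ 2 + g x ^+ 2))).
- by apply: measurable_funX; exact: measurable_funB.
- by move=> x; rewrite ger0_norm ?sqr_ge0//; have := sqr_ge0 (f x + g x); nra.
- exact/intgZ/intgD.
Qed.

Lemma square_integrable_bounded f g (M : R) : square_integrable f ->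
  measurable_fun [set: R] g -> (forall x, `|g x| <= M) ->
  square_integrable (fun x => g x * f x).
Proof.
move=> [mf fi] mg gM.
have M0 : 0 <= M by rewrite (le_trans _ (gM 0)).
split; first exact: measurable_funM.
apply: (@intg_le _ _ (fun x => M ^+ 2 * (f x ^+ 2))) => [||]; last exact: intgZ.
- by apply: measurable_funX; exact: measurable_funM.
- move=> x; rewrite ger0_norm ?sqr_ge0// exprMn ler_wpM2r ?sqr_ge0//.
  by rewrite -[leLHS]real_normK ?num_real// lerXn2r ?nnegrE.
Qed.

Lemma ae_eq_square_integrable f g : measurable_fun [set: R] g ->
  {ae mu, forall x, f x = g x} -> square_integrable f -> square_integrable g.
Proof.
move=> mg fg [mf fi]; split => //.
apply: ae_eq_intg fi; first exact: measurable_funX.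
by apply: (ae_imp fg) => x ->.
Qed.

Lemma intg_oneDsqrV : intg (fun x : R => (1 + x ^+ 2)^-1).
Proof.
have e0 x : 0 <= (1 + x ^+ 2 : R)^-1 by rewrite invr_ge0 addr_ge0// sqr_ge0.
apply/integrableP; split.
  apply/measurable_EFinP; apply: continuous_measurable_fun.
  exact: continuous_oneDsqrV.
under eq_integral do rewrite /= ger0_norm//.
rewrite ge0_symfun_integralT//; last 2 first.
  exact: continuous_oneDsqrV.
  by move=> x /=; rewrite sqrrN.
have := @integral0y_oneDsqr R; rewrite set_itvcy => ->.
by rewrite -EFinM ltry.
Qed.

Lemma square_integrable_decay f (C : R) : measurable_fun [set: R] f ->
  (forall x, f x ^+ 2 <= C * (1 + x ^+ 2)^-1) -> square_integrable f.
Proof.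
move=> mf fC; split => //.
apply: (@intg_le _ _ (fun x => C * (1 + x ^+ 2)^-1)).
- exact: measurable_funX.
- by move=> x; rewrite ger0_norm ?sqr_ge0.
- exact/intgZ/intg_oneDsqrV.
Qed.

(** Hölder's inequality with exponents 2 and 2. This is how the L^2 convergence inside [fourier_L2]
    is turned into convergence of numbers. *)
Lemma Lnorm2_cvg0_pairing (f_ : nat -> R -> R) g :
  (forall n, measurable_fun [set: R] (f_ n)) -> square_integrable g ->
  (forall n, intg (fun x => f_ n x * g x)) ->
  'N[mu]_2%:E[EFin \o f_ n]%E @[n --> \oo] --> 0%E ->
  \int[mu]_x (f_ n x * g x) @[n --> \oo] --> 0.
Proof.
move=> mf gi fgi f0.
have gfin : 'N[mu]_2%:E[EFin \o g]%E \is a fin_num.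
  by rewrite ge0_fin_numE ?Lnorm_ge0// square_integrable_lty.
have h0 : ('N[mu]_2%:E[EFin \o f_ n] * 'N[mu]_2%:E[EFin \o g])%E
    @[n --> \oo] --> 0%E.
  rewrite -(mul0e ('N[mu]_2%:E[EFin \o g])%E); apply: cvgeMr => //.
have i0 : (\int[mu]_x `|f_ n x * g x|)%:E @[n --> \oo] --> 0%E.
  apply: (squeeze_cvge _ (cvg_cst 0%E) h0).
  apply: nearW => n; rewrite lee_fin Rintegral_ge0//=.
  have [_ mg] := gi; rewrite (EFin_Rint (intg_norm (fgi n))).
  apply: le_trans (@hoelder _ _ _ mu (f_ n) g 2 2 (mf n) gi.1 _ _ _) => //.
    by rewrite Lnorm1.
  by rewrite [RHS]splitr !div1r.
apply/cvgr0Pnorm_le => e e0.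
have /fine_cvg/cvgr0Pnorm_le/(_ e e0) := i0.
apply: filterS => n /=; apply: le_trans.
rewrite (le_trans (le_normr_Rintegral measurableT (fgi n)))//.
exact: ler_norm.
Qed.

End square_integrable_functions.

(** * Calculus of smooth functions and the flat function e^(-1/x) *)

Section smooth_functions.
Set Implicit Arguments.
Unset Strict Implicit.
Context {R : realType}.
Implicit Types f g df dg : R -> R.

Lemma isdM f g (x df dg : R) : is_derive x 1 f df -> is_derive x 1 g dg ->
  is_derive x 1 (fun y => f y * g y) (df * g x + f x * dg).
Proof.
move=> hf hg; apply: is_derive_eq (is_deriveM hf hg) _.
by rewrite addrC [df * _]mulrC.
Qed.

Lemma isdD f g (x df dg : R) : is_derive x 1 f df -> is_derive x 1 g dg ->
  is_derive x 1 (fun y => f y + g y) (df + dg).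
Proof. by move=> hf hg; exact: (is_deriveD hf hg). Qed.

Lemma isd_affine (a b x : R) : is_derive x 1 (fun y => a * y + b) a.
Proof.
have h : is_derive x 1 (fun y : R => a * y) (a * 1).
  exact: (is_deriveZ a (is_derive_id x 1)).
apply: is_derive_eq (isdD h (is_derive_cst b x 1)) _.
by rewrite mulr1 addr0.
Qed.

Lemma isd_comp_affine f (a b x df : R) : is_derive (a * x + b) 1 f df ->
  is_derive x 1 (fun y => f (a * y + b)) (df * a).
Proof. by move=> hf; exact: (@is_derive1_comp _ f (fun y => a * y + b) _ _ _ hf (isd_affine a b x)). Qed.

Lemma isd_inv f (x df : R) : f x != 0 -> is_derive x 1 f df ->
  is_derive x 1 (fun y => (f y)^-1) (- df * (f x)^-1 * (f x)^-1).
Proof.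
move=> fx0 hf; apply: is_derive_eq (is_deriveV fx0 hf) _.
by rewrite -[_ *: _]/(_ * _) expr2 invfM; ring.
Qed.

Lemma isd_derive1 f df : (forall x : R, is_derive x 1 f (df x)) -> (derive1 f) = df.
Proof. by move=> h; apply/funext => x; rewrite derive1E; case: (h x). Qed.

Lemma derivable_isd f (x : R) : derivable f x 1 -> is_derive x 1 f ((derive1 f) x).
Proof. by move=> h; rewrite derive1E; exact: derivableP. Qed.

Lemma derivable_continuous f : (forall x : R, derivable f x 1) -> continuous f.
Proof. by move=> h x; apply/differentiable_continuous/derivable1_diffP/h. Qed.

(** [derive1n] unfolds from the last derivative, this recursion from the first one. The derivative
    of a product or an inverse is again built from products and inverses, so the closure properties
    follow by induction on [n]. *)
Fixpoint smooth_upto n f := (forall x : R, derivable f x 1) /\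
  if n is m.+1 then smooth_upto m (derive1 f) else True.

Definition smooth f := forall n (x : R), derivable (derive1n n f) x 1.

Lemma smoothP f : smooth f <-> forall n, smooth_upto n f.
Proof.
split=> [sf n|sf n x].
  elim: n f sf => [|n IH] f sf; first exact: conj (sf 0%N) I.
  by split; [exact: (sf 0%N)|apply: IH => k x; rewrite -derive1Sn; exact: sf].
elim: n f sf => [|n IH] f sf; first by have [] := sf 0%N.
by rewrite derive1Sn; apply: IH => k; have [] := sf k.+1.
Qed.

Lemma smooth_upto_isd n f df : (forall x : R, is_derive x 1 f (df x)) ->
  smooth_upto n df -> smooth_upto n.+1 f.
Proof. by move=> h s; split; [move=> x; exact: ex_derive|rewrite (isd_derive1 h)]. Qed.

Lemma smooth_uptoW n f : smooth_upto n.+1 f -> smooth_upto n f.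
Proof.
elim: n f => [|n IH] f [df sf]; first exact: conj df I.
exact: conj df (IH _ sf).
Qed.

Lemma smooth_upto_cst n c : smooth_upto n (fun _ => c).
Proof.
have hc (c' : R) (x : R) : is_derive x 1 (fun=> c') (0 : R) by exact: is_derive_cst.
elim: n c => [|n IH] c; last exact: (@smooth_upto_isd n _ (fun=> 0) (hc c) (IH 0)).
by split=> // x; have := hc c x => ?; exact: ex_derive.
Qed.

Lemma smooth_uptoD n f g : smooth_upto n f -> smooth_upto n g ->
  smooth_upto n (fun x => f x + g x).
Proof.
elim: n f g => [|n IH] f g [df sf] [dg sg].
  by split; [move=> x; exact: derivableD|].
have h (x : R) : is_derive x 1 (fun y => f y + g y) (derive1 f x + derive1 g x).
  exact: isdD (derivable_isd (df x)) (derivable_isd (dg x)).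
exact: smooth_upto_isd h (IH _ _ sf sg).
Qed.

Lemma smooth_uptoM n f g : smooth_upto n f -> smooth_upto n g ->
  smooth_upto n (fun x => f x * g x).
Proof.
elim: n f g => [|n IH] f g sf sg; have [[df sf'] [dg sg']] := (sf, sg).
  by split; [move=> x; exact: derivableM|].
have h (x : R) : is_derive x 1 (fun y => f y * g y)
    (derive1 f x * g x + f x * derive1 g x).
  exact: isdM (derivable_isd (df x)) (derivable_isd (dg x)).
exact: smooth_upto_isd h (smooth_uptoD (IH _ _ sf' (smooth_uptoW sg))
  (IH _ _ (smooth_uptoW sf) sg')).
Qed.

(** The derivative -f' (1/f) (1/f) involves 1/f itself, but only to order [n], which the induction
    hypothesis provides. *)
Lemma smooth_uptoV n f : (forall x, f x != 0) -> smooth_upto n f ->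
  smooth_upto n (fun x => (f x)^-1).
Proof.
move=> f0; elim: n => [|n IH] sf; have [df sf'] := sf.
  by split; [move=> x; exact: derivableV|].
have sV := IH (smooth_uptoW sf).
have h (x : R) : is_derive x 1 (fun y => (f y)^-1)
    (-1 * derive1 f x * (f x)^-1 * (f x)^-1).
  by rewrite mulN1r; exact: isd_inv (f0 x) (derivable_isd (df x)).
have s1 := smooth_uptoM (smooth_upto_cst n (-1)) sf'.
exact: smooth_upto_isd h (smooth_uptoM (smooth_uptoM s1 sV) sV).
Qed.

Lemma smooth_upto_comp_affine n f (a b : R) : smooth_upto n f ->
  smooth_upto n (fun x => f (a * x + b)).
Proof.
elim: n f => [|n IH] f [df sf].
  split=> [x|]; last exact: I.
  by have := isd_comp_affine (derivable_isd (df (a * x + b))) => ?; exact: ex_derive.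
have h (x : R) : is_derive x 1 (fun y => f (a * y + b)) (derive1 f (a * x + b) * a).
  exact: isd_comp_affine (derivable_isd (df _)).
exact: smooth_upto_isd h (smooth_uptoM (IH _ sf) (smooth_upto_cst n a)).
Qed.

Lemma smooth_cst c : smooth (fun _ => c).
Proof. by apply/smoothP => n; exact: smooth_upto_cst. Qed.

Lemma smoothD f g : smooth f -> smooth g -> smooth (fun x => f x + g x).
Proof.
by move=> /smoothP sf /smoothP sg; apply/smoothP => n; exact: smooth_uptoD.
Qed.

Lemma smoothM f g : smooth f -> smooth g -> smooth (fun x => f x * g x).
Proof.
by move=> /smoothP sf /smoothP sg; apply/smoothP => n; exact: smooth_uptoM.
Qed.

Lemma smoothV f : (forall x, f x != 0) -> smooth f -> smooth (fun x => (f x)^-1).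
Proof.
by move=> f0 /smoothP sf; apply/smoothP => n; exact: smooth_uptoV.
Qed.

Lemma smooth_comp_affine f (a b : R) : smooth f -> smooth (fun x => f (a * x + b)).
Proof.
by move=> /smoothP sf; apply/smoothP => n; exact: smooth_upto_comp_affine.
Qed.

Lemma shiftE f (x y : R) : f (x - y) = f (-1 * y + x).
Proof. by rewrite mulN1r addrC. Qed.

Lemma smooth_shift f (x : R) : smooth f -> smooth (fun y => f (x - y)).
Proof.
move=> sf; rewrite (funext (shiftE f x)); exact: smooth_comp_affine.
Qed.

Lemma isd_shift f (x y df : R) : is_derive (x - y) 1 f df ->
  is_derive y 1 (fun y => f (x - y)) (- df).
Proof.
rewrite (_ : x - y = -1 * y + x); last by rewrite mulN1r addrC.
rewrite (funext (shiftE f x)) => h; apply: is_derive_eq (isd_comp_affine h) _.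
by rewrite mulrN1.
Qed.

Lemma smooth_affine (a b : R) : smooth (fun x => a * x + b).
Proof.
apply/smoothP => -[|n]; 
  last exact: (@smooth_upto_isd n _ (fun=> a) (isd_affine a b) (smooth_upto_cst n a)).
by split=> // x; have := isd_affine a b x => ?; exact: ex_derive.
Qed.

Lemma smooth_id : smooth (fun x : R => x).
Proof.
rewrite (_ : (fun x => x) = (fun x => 1 * x + 0)); first exact: smooth_affine.
by apply/funext => x; rewrite mul1r addr0.
Qed.

Lemma smooth_derivable f (x : R) : smooth f -> derivable f x 1.
Proof. by move=> /(_ 0%N x). Qed.

Lemma smooth_isd f (x : R) : smooth f -> is_derive x 1 f ((derive1 f) x).
Proof. by move=> sf; exact/derivable_isd/smooth_derivable. Qed.

Lemma smooth_derive1 f : smooth f -> smooth (derive1 f).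
Proof. by move=> sf n x; rewrite -derive1Sn. Qed.

Lemma smooth_continuous f : smooth f -> continuous f.
Proof. by move=> sf; apply: derivable_continuous => x; exact: smooth_derivable. Qed.

Lemma smooth_measurable f : smooth f -> measurable_fun [set: R] f.
Proof. by move=> /smooth_continuous; exact: continuous_measurable_fun. Qed.

(** Each monomial satisfies t^i e^(-t) <= i!, by the exponential series; the constant sums these
    bounds over the coefficients. *)
Lemma poly_expR_bounded (p : {poly R}) :
  exists2 C, 0 <= C & forall t, 0 <= t -> `|p.[t]| * expR (- t) <= C.
Proof.
exists (\sum_(i < size p) `|p`_i| * i`!%:R).
  by apply: sumr_ge0 => i _; rewrite mulr_ge0.
move=> t t0; rewrite horner_coef (le_trans (ler_wpM2r (expR_ge0 _) (ler_norm_sum _ _ _)))//.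
rewrite mulr_suml; apply: ler_sum => i _.
rewrite normrM -mulrA ler_wpM2l// ger0_norm ?exprn_ge0// expRN.
rewrite ler_pdivrMr ?expR_gt0// mulrC.
have [->|] := posnP i.
  by rewrite expr0 fact0 mulr1 (le_trans _ (expR_ge1Dx t))// lerDl.
case: (nat_of_ord i) => // n _.
rewrite -ler_pdivrMr ?ltr0n ?fact_gt0//.
by rewrite (le_trans _ (expR_ge1Dxn n t0))// lerDr.
Qed.

(* This family is stable under derivation, which makes its members smooth. *)
Definition flat_poly (p : {poly R}) (x : R) : R :=
  if 0 < x then p.[x^-1] * expR (- x^-1) else 0.

Lemma flat_poly_bounded p : exists2 C, 0 <= C & forall x, `|flat_poly p x| <= C.
Proof.
have [C C0 pC] := poly_expR_bounded p; exists C => // x.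
rewrite /flat_poly; case: ifPn => x0; last by rewrite normr0.
by rewrite normrM (ger0_norm (expR_ge0 _)) pC// invr_ge0 ltW.
Qed.

Lemma flat_poly_mulX p x : flat_poly p x = x * flat_poly ('X * p) x.
Proof.
rewrite /flat_poly; case: ifPn => x0; last by rewrite mulr0.
by rewrite hornerM hornerX !mulrA mulfV ?mul1r// gt_eqF.
Qed.

(** For x > 0 the derivative of p(1/x) e^(-1/x) is x^(-2) (p - p')(1/x) e^(-1/x), which explains the
    polynomial X^2 (p - p'). The point 0 is the only delicate one. *)
Lemma flat_poly_isd p (x : R) :
  is_derive x 1 (flat_poly p) (flat_poly ('X^2 * (p - p^`())) x).
Proof.
have [x0|x0|->] := ltrgtP x 0.
- rewrite {2}/flat_poly ltNge (ltW x0)/=.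
  apply: (near_eq_is_derive (f := fun=> 0)).
    near=> y; rewrite /flat_poly ltNge (_ : y <= 0)//.
    by near: y; exact: lt_le_nbhsl.
- have xN0 : x != 0 by rewrite gt_eqF.
  have hV : is_derive x 1 (fun y : R => y^-1) (- 1 * x^-1 * x^-1).
    exact: (@isd_inv id _ _ xN0 (is_derive_id x 1)).
  have hp : is_derive x 1 (fun y => p.[y^-1]) (p^`().[x^-1] * (- 1 * x^-1 * x^-1)).
    exact: (@is_derive1_comp _ (horner p) (fun y => y^-1) _ _ _ (is_derive_poly p x^-1) hV).
  have hN : is_derive x 1 (fun y : R => - y^-1) (- (- 1 * x^-1 * x^-1)).
    exact: (is_deriveN hV).
  have he := @is_derive1_comp _ expR _ _ _ _ (is_derive_expR _) hN.
  have near_f : \forall y \near x, p.[y^-1] * expR (- y^-1) = flat_poly p y.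
    near=> y; rewrite /flat_poly (_ : 0 < y)//.
    by near: y; exact: lt_nbhsr.
  apply: is_derive_eq (near_eq_is_derive near_f (isdM hp he)) _.
  by rewrite /flat_poly x0 /= hornerM hornerXn hornerD hornerN; ring.
- rewrite {2}/flat_poly ltxx.
  (* Two factors X are pulled out of [p]: the first cancels the division by [h] in the difference
     quotient, the second leaves [h] times a bounded function, which tends to 0. *)
  have [C C0 hC] := flat_poly_bounded ('X * ('X * p)).
  have cv : h^-1 *: ((flat_poly p \o shift 0) (h *: 1) - flat_poly p 0) @[h --> 0^'] --> 0.
    apply/cvgr0Pnorm_le => e e0; near=> h.
    have -> : h^-1 *: ((flat_poly p \o shift 0) (h *: 1) - flat_poly p 0) =
        h * flat_poly ('X * ('X * p)) h.
      rewrite /= addr0 -[h *: 1]/(h * 1) mulr1 {2}/flat_poly ltxx subr0.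
      rewrite -[_ *: _]/(_ * _) (flat_poly_mulX p) (flat_poly_mulX ('X * p)).
      by rewrite !mulrA mulVf ?mul1r//; near: h; exact: nbhs_dnbhs_neq.
    rewrite normrM (le_trans (ler_wpM2l _ (hC h)))// mulrC.
    rewrite (@le_trans _ _ ((C + 1) * (e / (C + 1))))//; last first.
      by rewrite mulrCA mulfV ?mulr1// gt_eqF// ltr_wpDl.
    rewrite ler_pM// ?lerDl//; near: h; apply: dnbhs0_le.
    by rewrite divr_gt0// ltr_wpDl.
  split; first by apply/cvg_ex; exists 0.
  exact: cvg_lim cv.
Unshelve. all: by end_near. Qed.

Lemma flat_poly_smooth p : smooth (flat_poly p).
Proof.
move=> n x.
suff -> : derive1n n (flat_poly p) =
    flat_poly (iter n (fun q => 'X^2 * (q - q^`())) p).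
  by have := flat_poly_isd (iter n (fun q => 'X^2 * (q - q^`())) p) x => ?; exact: ex_derive.
elim: n => [|n IH] //; rewrite derive1nS IH.
by apply: isd_derive1 => y; exact: flat_poly_isd.
Qed.

(** The function e^(-1/x) for x > 0, extended by 0. It tends to 1 at infinity, so it serves as a
    smooth step. *)
Definition flat : R -> R := flat_poly 1.

Lemma flat_le1 x : 0 <= flat x <= 1.
Proof.
rewrite /flat /flat_poly; case: ifPn => x0; last by rewrite lexx ler01.
by rewrite hornerC mul1r expR_ge0/= expR_le1 lerNl oppr0 invr_ge0 ltW.
Qed.

Lemma flat_le0 x : x <= 0 -> flat x = 0.
Proof. by rewrite /flat /flat_poly ltNge => ->. Qed.

Lemma flat_cvg1 (u : nat -> R) : u @ \oo --> +oo -> flat (u n) @[n --> \oo] --> (1 : R).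
Proof.
move=> uoo.
have h : expR (- (u n)^-1) @[n --> \oo] --> (1 : R).
  rewrite -(expR0 R) -[X in expR X]oppr0.
  apply: continuous_cvg; first exact: continuous_expR.
  have upos : \forall n \near \oo, 0 < u n by move/cvgryPgt : uoo => /(_ 0).
  by apply: cvgN; exact: ((gtr0_cvgV0 upos).2 uoo).
apply: cvg_trans h; apply: near_eq_cvg; near=> n.
rewrite /flat /flat_poly (_ : 0 < u n) ?hornerC ?mul1r//.
by near: n; move/cvgryPgt : uoo => /(_ 0).
Unshelve. all: by end_near. Qed.

Definition dflat : R -> R := flat_poly 'X^2.

Lemma flat_isd (x : R) : is_derive x 1 flat (dflat x).
Proof.
by apply: is_derive_eq (flat_poly_isd 1 x) _; rewrite derivC subr0 mulr1.
Qed.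

Lemma dflat_bounded : exists2 C, 0 <= C & forall x, `|dflat x| <= C.
Proof. exact: flat_poly_bounded. Qed.

Lemma dflat_cvg0 (u : nat -> R) : u @ \oo --> +oo -> dflat (u n) @[n --> \oo] --> (0 : R).
Proof.
move=> uoo.
have upos : \forall n \near \oo, 0 < u n by move/cvgryPgt : uoo => /(_ 0).
have uV : (u n)^-1 @[n --> \oo] --> (0 : R) by exact: ((gtr0_cvgV0 upos).2 uoo).
have h : (u n)^-1 * (u n)^-1 @[n --> \oo] --> (0 : R).
  by rewrite -(mulr0 0); exact: cvgM.
apply/cvgr0Pnorm_le => e e0; near=> n.
have un : 0 < u n by near: n.
rewrite /dflat /flat_poly un normrM (ger0_norm (expR_ge0 _)) hornerXn expr2.
rewrite (@le_trans _ _ `|(u n)^-1 * (u n)^-1|)//.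
  by rewrite ler_piMr// expR_le1 lerNl oppr0 invr_ge0 ltW.
by near: n; move/cvgr0Pnorm_le : h => /(_ e e0).
Unshelve. all: by end_near. Qed.

End smooth_functions.

(** * Test functions and weak derivatives *)

Section weak_derivatives.
Set Implicit Arguments.
Unset Strict Implicit.
Context {R : realType}.
Local Notation mu := (@lebesgue_measure R).
Local Notation intg f := (mu.-integrable [set: R] (EFin \o f)).
Implicit Types f g h phi psi : R -> R.

Lemma cvgn_unique (u : nat -> R) (a b : R) :
  u n @[n --> \oo] --> a -> u n @[n --> \oo] --> b -> a = b.
Proof.
by move=> /(@cvg_lim _ (@Rhausdorff R)) <- /(@cvg_lim _ (@Rhausdorff R)) <-.
Qed.

Lemma cvgn_ext (u v : nat -> R) (l : R) : u =1 v ->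
  u n @[n --> \oo] --> l -> v n @[n --> \oo] --> l.
Proof. by move=> /funext ->. Qed.

Lemma cvgry_natS_affine (a b : R) : 0 < a ->
  (a * n.+1%:R + b) @[n --> \oo] --> +oo.
Proof.
move=> a0; apply/cvgryPge => r; near=> n.
rewrite -lerBlDr -ler_pdivrMl// (@le_trans _ _ n%:R)//.
  by near: n; exact: nbhs_infty_ger.
by rewrite ler_nat.
Unshelve. all: by end_near. Qed.

Lemma smooth_test_function phi (a b : R) : smooth phi ->
  (forall x, x < a \/ b < x -> phi x = 0) -> test_function phi.
Proof.
move=> sphi phi0; split=> //.
apply: (@subclosed_compact _ _ `[a, b]); [exact: closed_closure|exact: segment_compact|].
rewrite (closure_id `[a, b]).1; last exact: interval_closed.
apply: closureS => x /= /eqP p0; apply/negPn/negP.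
by rewrite in_itv/= negb_and -!ltNge => /orP h; exact/p0/phi0.
Qed.

Lemma test_function_smooth phi : test_function phi -> smooth phi.
Proof. by case. Qed.

Lemma test_function_support phi : test_function phi ->
  exists2 N : R, 0 < N & forall x, N < `|x| -> phi x = 0.
Proof.
move=> [_ /compact_bounded[M [_ bM]]]; exists (`|M| + 1); first by rewrite ltr_wpDl.
move=> x xM; apply/eqP/negPn/negP => phix0.
have /bM : M < `|M| + 1 by rewrite (@le_lt_trans _ _ `|M|) ?ler_norm ?ltrDl.
by move=> /(_ x (@subset_closure _ [set x | phi x != 0] x phix0)) /=; rewrite leNgt xM.
Qed.

Lemma test_function_bounded phi : test_function phi ->
  exists2 M : R, 0 <= M & forall x, `|phi x| <= M.
Proof.
move=> tphi; have [N N0 phi0] := test_function_support tphi.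
have cphi : {within `[- N, N], continuous (fun x => `|phi x|)}.
  apply: continuous_subspaceT => x; apply: cvg_norm.
  exact: (smooth_continuous (test_function_smooth tphi)).
have [|c _ cM] := @EVT_max R _ (- N) N _ cphi; first by rewrite ge0_cp// ltW.
exists `|phi c| => // x; have [xN|Nx] := leP `|x| N.
  by apply: cM; rewrite in_itv/= -ler_norml.
by rewrite phi0// normr0.
Qed.

Lemma test_function_derive1 phi : test_function phi -> test_function (derive1 phi).
Proof.
move=> tphi; have [N N0 phi0] := test_function_support tphi.
apply: (@smooth_test_function _ (- N) N).
  exact/smooth_derive1/test_function_smooth.
have z (x : R) : N < `|x| -> derive1 phi x = 0.
  move=> Nx; suff : is_derive x 1 phi 0 by rewrite derive1E => -[].
  have nz : \forall y \near x, (fun=> 0) y = phi y.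
    near=> y; rewrite /= phi0//; near: y.
    have /(_ x) : continuous (fun y : R => `|y|) by exact: norm_continuous.
    by move=> /cvgrPdist_lt/(_ (`|x| - N)); rewrite subr_gt0 => /(_ Nx);
      apply: filterS => y /=; have := ler_norm (`|x| - `|y|); lra.
  exact: (near_eq_is_derive nz (is_derive_cst 0 x 1)).
by move=> x xN; apply: z; rewrite ltr_normr; case: xN => ?; apply/orP; [right|left]; lra.
Unshelve. all: by end_near. Qed.

Lemma test_functionM phi g : test_function phi -> smooth g ->
  test_function (fun x => phi x * g x).
Proof.
move=> tphi sg; have [N N0 phi0] := test_function_support tphi.
apply: (@smooth_test_function _ (- N) N).
  by apply: smoothM => //; exact: test_function_smooth.
move=> x xN; rewrite phi0 ?mul0r// ltr_normr.
by case: xN => ?; apply/orP; [right|left]; lra.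
Qed.

Lemma test_function_measurable phi : test_function phi -> measurable_fun [set: R] phi.
Proof. by move=> /test_function_smooth; exact: smooth_measurable. Qed.

Lemma locally_integrable_itv f (a b : R) : locally_integrable [set: R] f ->
  mu.-integrable `[a, b] (EFin \o f).
Proof.
move=> [mf _ fK]; apply/integrableP; split.
  exact/measurable_EFinP/measurable_funTS.
by apply: fK => //; exact: segment_compact.
Qed.

Lemma intg_indic f (A : set R) : measurable A -> mu.-integrable A (EFin \o f) ->
  intg (fun x => \1_A x * f x).
Proof.
move=> mA fi; have := (iffLR (@integrable_mkcond _ _ R mu A (EFin \o f) mA)) fi.
apply: eq_integrable => // x _; rewrite /patch /= indicE.
by case: (x \in A); rewrite ?mul1r ?mul0r.
Qed.

Lemma Rint_indic f (A : set R) : \int[mu]_(x in A) f x = \int[mu]_x (\1_A x * f x).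
Proof.
rewrite Rintegral_mkcond; apply: eq_Rintegral => x _.
by rewrite /patch indicE; case: (x \in A); rewrite ?mul1r ?mul0r.
Qed.

Lemma indic_itvcc (a b x : R) : \1_`[a, b] x = (a <= x <= b)%R%:R :> R.
Proof. by rewrite indicE mem_setE in_itv. Qed.

Lemma indic_itvoo (a b x : R) : \1_`]a, b[ x = (a < x < b)%R%:R :> R.
Proof. by rewrite indicE mem_setE in_itv. Qed.

Lemma test_function_intg f phi : locally_integrable [set: R] f ->
  test_function phi -> intg (fun x => f x * phi x).
Proof.
move=> lf tphi; have [N N0 phi0] := test_function_support tphi.
have [M M0 phiM] := test_function_bounded tphi.
have [mf _ _] := lf.
apply: (@intg_le _ _ (fun x => M * `|\1_`[- N, N] x * f x|)).
- by apply: measurable_funM => //; exact: test_function_measurable.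
- move=> x; rewrite !normrM indic_itvcc; have [xN|Nx] := leP `|x| N.
    by rewrite -ler_norml xN normr1 mul1r mulrC ler_wpM2r.
  by rewrite phi0// normr0 mulr0 !mulr_ge0.
- by apply/intgZ/intg_norm/intg_indic => //; exact: locally_integrable_itv.
Qed.

Lemma square_integrable_locally f : square_integrable f ->
  locally_integrable [set: R] f.
Proof.
move=> [mf f2]; split => //; first exact: openT.
move=> K _ cK; have mK : measurable K by exact: compact_measurable.
have fK : (mu K < +oo)%E by exact: compact_finite_measure.
have cK1 : mu.-integrable K (EFin \o (fun=> 1 : R)).
  apply: measurable_bounded_integrable => //; exact: bounded_cst.
have f2K : mu.-integrable K (EFin \o (fun x => f x ^+ 2)).
  by apply: integrableS f2.
have : mu.-integrable K (EFin \o f).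
  apply: (@le_integrable _ _ R mu K mK _ _ _ _ (@integrableD _ _ R mu K mK _ _ cK1 f2K)).
    by apply/measurable_EFinP; exact: measurable_funTS.
  move=> x _ /=; rewrite lee_fin [leRHS]ger0_norm; last by rewrite addr_ge0 ?sqr_ge0.
  by rewrite ler_norml; apply/andP; split; nra.
by move/integrableP => [].
Qed.

(** By Lebesgue's differentiation theorem, almost every [f x] is the derivative at x of the
    primitive based at x - 1. That primitive is identically 0; passing between open and closed
    intervals costs nothing, endpoints being null. *)
Lemma Rint_itv_eq0_ae f : locally_integrable [set: R] f ->
  (forall a b : R, \int[mu]_(x in `]a, b[) f x = 0) -> {ae mu, forall x, f x = 0}.
Proof.
move=> lf f0; apply: (ae_imp (lebesgue_differentiation lf)) => x fx.
have xi := locally_integrable_itv (x - 1) (x + 1) lf.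
have [||_] := @FTC1_lebesgue_pt R f (BLeft (x - 1)) x (x + 1) _ xi _ fx.
- by rewrite ltrDl.
- by rewrite /Order.lt/= ltrBlDr ltrDl.
move=> <-; rewrite (_ : (fun y => _) = fun=> 0) ?derive1_cst//.
apply/funext => y; have yi := locally_integrable_itv (x - 1) y lf.
rewrite -Rintegral_itv_obnd_cbnd; last first.
  by apply: integrableS yi => //; apply: subset_itvr; rewrite bnd_simp.
rewrite -Rintegral_itv_bndo_bndc; last first.
  by apply: integrableS yi => //; apply: subset_itv; rewrite bnd_simp.
exact: f0.
Qed.

(** The bump flat(k (x - a)) flat(k (b - x)), with the arguments expanded to the affine form of
    [smooth_comp_affine]. As k grows it tends to the indicator of the open interval from a to b. *)
Lemma flat_bump_test (a b k : R) : 0 < k ->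
  test_function (fun x => flat (k * x + - (k * a)) * flat (- k * x + k * b)).
Proof.
move=> k0; apply: (@smooth_test_function _ a b).
  by apply: smoothM; apply: smooth_comp_affine; exact: flat_poly_smooth.
move=> x [xa|bx].
  by rewrite flat_le0 ?mul0r//; nra.
by rewrite [X in _ * X]flat_le0 ?mulr0//; nra.
Qed.

(** Fundamental lemma of the calculus of variations: the bumps of [flat_bump_test] with k = n + 1
    converge to the indicator of []a, b[], including at the endpoints, where they vanish. Dominated
    convergence then gives zero integrals over all intervals. *)
Lemma test_function_ae0 f : locally_integrable [set: R] f ->
  (forall phi, test_function phi -> \int[mu]_x (f x * phi x) = 0) ->
  {ae mu, forall x, f x = 0}.
Proof.
move=> lf f0; apply: Rint_itv_eq0_ae => // a b.
have [mf _ _] := lf.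
pose k n : R := n.+1%:R.
pose psi n x := flat (k n * x + - (k n * a)) * flat (- k n * x + k n * b).
have tpsi n : test_function (psi n) by apply: flat_bump_test; rewrite ltr0n.
have psi1 n x : `|psi n x| <= \1_`[a, b] x.
  rewrite indic_itvcc; have [/andP[ax xb]|] := boolP (a <= x <= b).
    have [/andP[? ?] /andP[? ?]] := (flat_le1 (k n * x + - (k n * a)), flat_le1 (- k n * x + k n * b)).
    by rewrite ger0_norm ?mulr_ge0// mulr_ile1.
  have k0 : 0 < k n by rewrite ltr0n.
  rewrite negb_and -!ltNge => /orP[xa|bx]; rewrite /psi.
    by rewrite flat_le0 ?mul0r ?normr0//; nra.
  by rewrite [X in _ * X]flat_le0 ?mulr0 ?normr0//; nra.
rewrite Rint_indic.
have [|||||_] := @Rint_dominated _ (fun n x => f x * psi n x)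
  (fun x => \1_`]a, b[ x * f x) (fun x => `|\1_`[a, b] x * f x|) _ _ _ _ _.
- by move=> n; apply: measurable_funM => //; exact: test_function_measurable.
- by apply: measurable_funM => //; exact: measurable_indic.
- apply: aeW => x; rewrite indic_itvoo mulrC; apply: cvgMr.
  have [/andP[ax xb]|nx] := boolP (a < x < b).
    rewrite -[(true%:R : R)](mulr1 1); apply: cvgM; apply: flat_cvg1.
      rewrite (_ : (fun n => _) = (fun n => (x - a) * n.+1%:R + 0)).
        by apply: cvgry_natS_affine; rewrite subr_gt0.
      by apply/funext => n; rewrite /k; ring.
    rewrite (_ : (fun n => _) = (fun n => (b - x) * n.+1%:R + 0)).
      by apply: cvgry_natS_affine; rewrite subr_gt0.
    by apply/funext => n; rewrite /k; ring.
  rewrite (_ : (fun n => _) = cst 0); first exact: cvg_cst.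
  apply/funext => n; have k0 : 0 < k n by rewrite ltr0n.
  move: nx; rewrite /psi negb_and -!leNgt => /orP[xa|bx].
    by rewrite flat_le0 ?mul0r//; nra.
  by rewrite [X in _ * X]flat_le0 ?mulr0//; nra.
- by apply/intg_norm/intg_indic => //; exact: locally_integrable_itv.
- move=> n x; rewrite mulrC normrM [leRHS]normrM ler_wpM2r// (le_trans (psi1 n x))//.
  exact: ler_norm.
move=> /cvg_lim <-//.
under eq_fun do rewrite f0//.
by rewrite lim_cst.
Qed.

Lemma weak_derivative_unique f g h : weak_derivative f g -> weak_derivative f h ->
  {ae mu, forall x, g x = h x}.
Proof.
move=> [_ lg fg] [_ lh fh].
have : {ae mu, forall x, g x - h x = 0}.
  apply: test_function_ae0 => [|phi tphi]; first exact: locally_integrableB.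
  under Rint_ext do rewrite mulrBl.
  rewrite RintB; [|exact: test_function_intg..].
  by apply/eqP; rewrite subr_eq0 -eqr_opp -fg// fh.
by move=> gh; apply: (ae_imp gh) => x /eqP; rewrite subr_eq0 => /eqP.
Qed.

Lemma weak_derivativeM f df phi : weak_derivative f df -> test_function phi ->
  weak_derivative (fun x => phi x * f x)
    (fun x => phi x * df x + derive1 phi x * f x).
Proof.
move=> [lf ldf fdf] tphi; have tdphi := test_function_derive1 tphi.
have i1 : intg (fun x => phi x * f x).
  by under eq_fun do rewrite mulrC; exact: test_function_intg.
have i2 : intg (fun x => phi x * df x + derive1 phi x * f x).
  by apply: intgD; under eq_fun do rewrite mulrC; exact: test_function_intg.
split; [exact: open_integrable_locally openT i1|exact: open_integrable_locally openT i2|].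
move=> psi tpsi; have sphi := test_function_smooth tphi.
have spsi := test_function_smooth tpsi.
have tp := test_functionM tphi spsi.
have dp : derive1 (fun x => phi x * psi x) =
    fun x => derive1 phi x * psi x + phi x * derive1 psi x.
  by apply: isd_derive1 => x; apply: isdM; exact: smooth_isd.
have j0 := test_function_intg lf (test_function_derive1 tp).
have j1 := test_function_intg lf (test_functionM tdphi spsi).
have j2 := test_function_intg ldf tp.
rewrite (@Rint_ext _ _ (fun x => f x * derive1 (fun x => phi x * psi x) x -
    f x * (derive1 phi x * psi x))); last by move=> x; rewrite dp; ring.
rewrite [in RHS](@Rint_ext _ _ (fun x => df x * (phi x * psi x) +
    f x * (derive1 phi x * psi x))); last by move=> x; ring.
by rewrite RintB// RintD// fdf// opprD.
Qed.

(** Here [g] need not have compact support. It is multiplied by cutoffs tending to 1 whose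
    derivatives are uniformly bounded and tend to 0, and dominated convergence removes the
    cutoffs. *)
Lemma weak_derivative_by_parts f df g : weak_derivative f df ->
  square_integrable f -> square_integrable df -> smooth g ->
  square_integrable g -> square_integrable (derive1 g) ->
  \int[mu]_x (f x * derive1 g x) = - \int[mu]_x (df x * g x).
Proof.
move=> [_ _ fdf] f2 df2 sg g2 dg2.
have [C C0 hC] := @dflat_bounded R.
pose k n : R := n.+1%:R.
(* Only the endpoints -k and k move with [n]; the slope of the bump stays 1. Hence the bound C + C
   on the derivative is independent of [n], and at a fixed point the derivative tends to 0 because
   [dflat] vanishes at infinity. *)
pose psi n x := flat (1 * x + k n) * flat (-1 * x + k n).
pose dpsi n x := dflat (1 * x + k n) * 1 * flat (-1 * x + k n) +
  flat (1 * x + k n) * (dflat (-1 * x + k n) * -1).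
have tpsi n : test_function (psi n).
  have := @flat_bump_test (- k n) (k n) 1 ltr01.
  by congr test_function; apply/funext => x; rewrite /psi !mul1r opprK.
have psid n (x : R) : is_derive x 1 (psi n) (dpsi n x).
  by apply: isdM; apply: isd_comp_affine; exact: flat_isd.
have koo (x : R) : x + k n @[n --> \oo] --> +oo.
  rewrite (_ : (fun n => _) = (fun n => 1 * n.+1%:R + x)).
    by apply: cvgry_natS_affine; exact: ltr01.
  by apply/funext => n; rewrite /k; ring.
have psi_le n x : `|psi n x| <= 1.
  have [/andP[? ?] /andP[? ?]] := (flat_le1 (1 * x + k n), flat_le1 (-1 * x + k n)).
  by rewrite ger0_norm ?mulr_ge0// mulr_ile1.
have dpsi_le n x : `|dpsi n x| <= C + C.
  have [/andP[? ?] /andP[? ?]] := (flat_le1 (1 * x + k n), flat_le1 (-1 * x + k n)).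
  rewrite (le_trans (ler_normD _ _))// mulr1 mulrN1; apply: lerD.
    by rewrite normrM -[leRHS]mulr1 ler_pM// ger0_norm.
  by rewrite normrM normrN -[leRHS]mul1r ler_pM// ger0_norm.
have psi_cvg x : psi n x @[n --> \oo] --> (1 : R).
  by rewrite -(mulr1 1); apply: cvgM; exact: flat_cvg1.
have dpsi_cvg x : dpsi n x @[n --> \oo] --> (0 : R).
  rewrite (_ : 0 = 0 * 1 * 1 + 1 * (0 * -1)); last by ring.
  apply: cvgD; apply: cvgM; try exact: flat_cvg1.
    by apply: cvgMl; exact: dflat_cvg0.
  by apply: cvgMl; exact: dflat_cvg0.
have mpsi n : measurable_fun [set: R] (psi n).
  exact: test_function_measurable.
have dE n : derive1 (fun x => psi n x * g x) =
    fun x => dpsi n x * g x + psi n x * derive1 g x.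
  by apply: isd_derive1 => x; exact: isdM (psid n x) (smooth_isd x sg).
have mdpsi n : measurable_fun [set: R] (dpsi n).
  rewrite -(isd_derive1 (psid n)).
  exact: test_function_measurable (test_function_derive1 (tpsi n)).
have [mf mdf] := (f2.1, df2.1).
have [mg mdg] := (g2.1, dg2.1).
have [|||||_ L1] := @Rint_dominated _ (fun n x => f x * derive1 (fun x => psi n x * g x) x)
  (fun x => f x * derive1 g x)
  (fun x => (C + C) * `|f x * g x| + `|f x * derive1 g x|) _ _ _ _ _.
- by move=> n; rewrite dE; apply: measurable_funM => //; apply: measurable_funD;
    exact: measurable_funM.
- exact: measurable_funM.
- apply: aeW => x; under eq_fun do rewrite dE; apply: cvgMr.
  rewrite -[X in _ --> X]add0r -[X in X + _](mul0r (g x)) -[X in _ + X](mul1r (derive1 g x)).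
  by apply: cvgD; apply: cvgMl.
- apply: intgD; last exact/intg_norm/square_integrable_mul.
  exact/intgZ/intg_norm/square_integrable_mul.
- move=> n x; rewrite dE mulrDr (le_trans (ler_normD _ _))//; apply: lerD.
    by rewrite mulrCA normrM ler_wpM2r.
  by rewrite mulrCA normrM -[leRHS]mul1r ler_wpM2r.
have [|||||_ L2] := @Rint_dominated _ (fun n x => df x * (psi n x * g x))
  (fun x => df x * g x) (fun x => `|df x * g x|) _ _ _ _ _.
- by move=> n; apply: measurable_funM => //; exact: measurable_funM.
- exact: measurable_funM.
- apply: aeW => x; apply: cvgMr; rewrite -[X in _ --> X]mul1r.
  exact: cvgMl.
- by apply/intg_norm/square_integrable_mul.
- by move=> n x; rewrite mulrCA normrM -[leRHS]mul1r ler_wpM2r.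
have E : (fun n => \int[mu]_x (f x * derive1 (fun x => psi n x * g x) x)) =
    (fun n => - \int[mu]_x (df x * (psi n x * g x))).
  apply/funext => n; apply: fdf.
  by apply: test_functionM; [exact: tpsi|exact: sg].
rewrite E in L1; apply: (cvgn_unique L1); exact: cvgN L2.
Qed.

End weak_derivatives.

(** * Quadratically decaying kernels and their convolutions on the Fourier side *)

Section decaying_functions.
Set Implicit Arguments.
Unset Strict Implicit.
Context {R : realType}.
Local Notation mu := (@lebesgue_measure R).
Local Notation intg f := (mu.-integrable [set: R] (EFin \o f)).
Implicit Types f g h k w : R -> R.

(** The decay rate of the Poisson kernel and of its derivatives. Such functions are both integrable
    and square integrable, and the class is stable under translation and bounded multipliers. *)
Definition decaying k := measurable_fun [set: R] k /\
  exists2 C, 0 <= C & forall x, `|k x| <= C * (1 + x ^+ 2)^-1.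

Lemma oneDsqrV_gt0 (x : R) : 0 < (1 + x ^+ 2)^-1.
Proof. by rewrite invr_gt0 ltr_pwDl// sqr_ge0. Qed.

Lemma oneDsqrV_le1 (x : R) : (1 + x ^+ 2)^-1 <= 1.
Proof. by rewrite invf_le1 ?lerDl ?sqr_ge0// ltr_pwDl// sqr_ge0. Qed.

Lemma decaying_intg k : decaying k -> intg k.
Proof.
move=> [mk [C C0 kC]]; apply: (@intg_le _ _ (fun x => C * (1 + x ^+ 2)^-1)) => //.
exact/intgZ/intg_oneDsqrV.
Qed.

Lemma decaying_square_integrable k : decaying k -> square_integrable k.
Proof.
move=> [mk [C C0 kC]]; apply: (@square_integrable_decay _ _ (C ^+ 2)) => // x.
rewrite -[leLHS]real_normK ?num_real// (@le_trans _ _ ((C * (1 + x ^+ 2)^-1) ^+ 2))//.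
  by rewrite lerXn2r ?nnegrE// (le_trans _ (kC x)).
rewrite exprMn ler_wpM2l ?sqr_ge0// expr2 ler_piMr ?oneDsqrV_le1//.
exact/ltW/oneDsqrV_gt0.
Qed.

(** Peetre's inequality. It separates the variables of a decaying kernel k(x - y), at the price of a
    growing factor in x. *)
Lemma oneDsqr_shift (x y : R) :
  (1 + (x - y) ^+ 2)^-1 <= 2 * (1 + x ^+ 2) * (1 + y ^+ 2)^-1.
Proof.
rewrite ler_pdivlMr; last by rewrite ltr_pwDl// sqr_ge0.
rewrite mulrC ler_pdivrMr; last by rewrite ltr_pwDl// sqr_ge0.
have := sqr_ge0 (x - y - x); have := sqr_ge0 (x * (x - y)).
have := sqr_ge0 (x - y + x); have := sqr_ge0 (x - y); have := sqr_ge0 x.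
by nra.
Qed.

Lemma decaying_shift_le k C : 0 <= C -> (forall x, `|k x| <= C * (1 + x ^+ 2)^-1) ->
  forall x y, `|k (x - y)| <= (2 * C * (1 + x ^+ 2)) * (1 + y ^+ 2)^-1.
Proof.
move=> C0 kC x y; rewrite (le_trans (kC _))//.
rewrite (le_trans (ler_wpM2l C0 (oneDsqr_shift x y)))//.
by rewrite le_eqVlt; apply/orP; left; apply/eqP; ring.
Qed.

Lemma decaying_shift k x : decaying k -> decaying (fun y => k (x - y)).
Proof.
move=> [mk [C C0 kC]]; split.
  by apply: measurableT_comp => //; exact: measurable_funB.
exists (2 * C * (1 + x ^+ 2)); first by rewrite !mulr_ge0// addr_ge0// sqr_ge0.
exact: decaying_shift_le.
Qed.

Lemma decaying_bounded k g (M : R) : decaying k -> measurable_fun [set: R] g ->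
  (forall x, `|g x| <= M) -> decaying (fun x => k x * g x).
Proof.
move=> [mk [C C0 kC]] mg gM; split; first exact: measurable_funM.
have M0 : 0 <= M by rewrite (le_trans _ (gM 0)).
exists (C * M); first exact: mulr_ge0.
by move=> x; rewrite normrM mulrAC ler_pM.
Qed.

Lemma decayingZ k c : decaying k -> decaying (fun x => c * k x).
Proof.
move=> [mk [C C0 kC]]; split; first exact: measurable_funM.
exists (`|c| * C); first exact: mulr_ge0.
by move=> x; rewrite normrM -mulrA ler_wpM2l.
Qed.

(** By Cauchy-Schwarz (a x + b)^2 <= (a^2 + b^2)(1 + x^2), which uses up one of the two powers of (1
    + x^2)^-1 in k^2; the other one is integrable. *)
Lemma affine_decaying_square_integrable k (a b : R) : decaying k ->
  square_integrable (fun x => (a * x + b) * k x).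
Proof.
move=> [mk [C C0 kC]].
have mX : measurable_fun [set: R] (fun x => a * x + b).
  by apply: measurable_funD => //; exact: measurable_funM.
apply: (@square_integrable_decay _ _ ((a ^+ 2 + b ^+ 2) * C ^+ 2)) => [|x].
  exact: measurable_funM.
rewrite exprMn; set d := (1 + _)^-1.
have d0 : 0 < d := oneDsqrV_gt0 x.
have k2 : k x ^+ 2 <= C ^+ 2 * d ^+ 2.
  rewrite -[leLHS]real_normK ?num_real// -exprMn lerXn2r ?nnegrE//.
  by rewrite mulr_ge0// ltW.
have X2 : (a * x + b) ^+ 2 <= (a ^+ 2 + b ^+ 2) * (1 + x ^+ 2).
  by have := sqr_ge0 (a - b * x); nra.
rewrite (le_trans (ler_pM _ _ X2 k2)) ?sqr_ge0//.
rewrite le_eqVlt; apply/orP; left; apply/eqP; rewrite /d; field.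
by rewrite gt_eqF// ltr_pwDl// sqr_ge0.
Qed.

(** The bound [n.+1] keeps the intervals nondegenerate, as [Rint_itv_FTC] requires. *)
Lemma Rint_itv_cvg g : intg g ->
  \int[mu]_(x in `[- n.+1%:R, n.+1%:R]) g x @[n --> \oo] --> \int[mu]_x g x.
Proof.
move=> gi; have mg := intg_measurable gi.
under eq_fun do rewrite Rint_indic.
have [|||||_] // := @Rint_dominated _ (fun n x => \1_`[- n.+1%:R, n.+1%:R] x * g x)
  g (fun x => `|g x|).
- by move=> n; apply: measurable_funM => //; exact: measurable_indic.
- apply: aeW => x; apply: cvg_near_cst; near=> n.
  rewrite indic_itvcc -ler_norml (_ : `|x| <= n.+1%:R) ?mul1r//.
  rewrite (@le_trans _ _ n%:R) ?ler_nat//.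
  by near: n; exact: nbhs_infty_ger.
- exact: intg_norm.
- move=> n x; rewrite indic_itvcc normrM.
  by case: (_ <= _ <= _); rewrite ?normr1 ?mul1r ?normr0 ?mul0r.
Unshelve. all: by end_near. Qed.

Lemma Rint_itv_FTC f F (a b : R) : a < b -> continuous f ->
  (forall x : R, is_derive x 1 F (f x)) ->
  \int[mu]_(x in `[a, b]) f x = F b - F a.
Proof.
move=> ab cf dF; have cF : continuous F.
  by apply: derivable_continuous => x; exact: ex_derive.
rewrite /Rintegral (@continuous_FTC2 _ f F)//.
- exact: continuous_subspaceT.
- by split; [move=> x _; exact: ex_derive|
    by apply: cvg_at_right_filter; exact: cF|by apply: cvg_at_left_filter; exact: cF].
- by move=> x _; rewrite (isd_derive1 dF).
Qed.

Lemma Rint_FTC f F (l l' : R) : intg f -> continuous f ->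
  (forall x : R, is_derive x 1 F (f x)) ->
  F n.+1%:R @[n --> \oo] --> l -> F (- n.+1%:R) @[n --> \oo] --> l' ->
  \int[mu]_x f x = l - l'.
Proof.
move=> fi cf dF Fl Fl'; apply: cvgn_unique (Rint_itv_cvg fi) _.
rewrite (_ : (fun n => _) = (fun n => F n.+1%:R - F (- n.+1%:R))).
  exact: cvgB.
by apply/funext => n; apply: Rint_itv_FTC => //; rewrite gtrN// ltr0n.
Qed.

(** Intended for integrands in |x|, which have a corner at 0: [f] agrees with [g] on the half-line x
    >= 0 only, and its primitive [F] is smooth across 0. On the other half-line the primitive is
    -F(-x). *)
Lemma Rint_even_FTC g f F (l : R) : intg g -> continuous f ->
  (forall x, g (- x) = g x) -> (forall x, 0 <= x -> g x = f x) ->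
  (forall x : R, is_derive x 1 F (f x)) -> F n.+1%:R @[n --> \oo] --> l ->
  \int[mu]_x g x = 2 * (l - F 0).
Proof.
move=> gi cf gN gf dF Fl; apply: cvgn_unique (Rint_itv_cvg gi) _.
rewrite (_ : (fun n => _) = (fun n => 2 * (F n.+1%:R - F 0))).
  by apply: cvgMr; apply: cvgB => //; exact: cvg_cst.
apply/funext => n; have n0 : 0 < n.+1%:R :> R by rewrite ltr0n.
have gi' (D : set R) : measurable D -> mu.-integrable D (EFin \o g).
  by move=> mD; exact: integrableS gi.
have E1 : \int[mu]_(x in `[0, n.+1%:R]) g x = F n.+1%:R - F 0.
  rewrite -(Rint_itv_FTC n0 cf dF); apply: eq_Rintegral => x.
  by rewrite inE/= in_itv/= => /andP[x0 _]; exact: gf.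
have E2 : \int[mu]_(x in `[- n.+1%:R, 0]) g x = F n.+1%:R - F 0.
  transitivity (\int[mu]_(x in `[- n.+1%:R, 0]) f (- x)).
    apply: eq_Rintegral => x; rewrite inE/= in_itv/= => /andP[_ x0].
    by rewrite -gN gf// lerNr oppr0.
  have dF' (x : R) : is_derive x 1 (fun y => - F (- y)) (f (- x)).
    rewrite -[f _]opprK.
    apply: is_deriveN; rewrite -mulrN1.
    have := @isd_comp_affine _ F (-1) 0 x (f (- x)).
    rewrite mulN1r addr0 => /(_ (dF _)).
    by congr is_derive; apply/funext => y; rewrite mulN1r addr0.
  have cf' : continuous (fun x => f (- x)).
    by move=> x; apply: continuous_comp; [exact: opp_continuous|exact: cf].
  have nn : - n.+1%:R < 0 :> R by rewrite oppr_lt0.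
  by rewrite (Rint_itv_FTC nn cf' dF') oppr0 !opprK addrC.
rewrite -[LHS](subrK (\int[mu]_(x in `[- n.+1%:R, 0]) g x)).
rewrite Rintegral_itvB//; last 3 first.
- exact: gi'.
- by rewrite bnd_simp lerNl oppr0 ltW.
- by rewrite bnd_simp ltW.
rewrite Rintegral_itv_obnd_cbnd; last exact: gi'.
by rewrite E1 E2; ring.
Qed.

(* [k] is the Fourier transform of the even function [w]: the convolution with
   [k] is the multiplication by [w] on the Fourier side. *)
Lemma fourier_L2_conv h A B w k (x : R) : fourier_L2 h A B -> decaying w ->
  decaying k -> (forall z, \int[mu]_xi (w xi * cos (z * xi)) = k z) ->
  \int[mu]_xi (w xi * (A xi * cos (x * xi) - B xi * sin (x * xi))) =
  \int[mu]_y (k (x - y) * h y).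
Proof.
move=> [/L2_square_integrable h2 /L2_square_integrable A2 /L2_square_integrable B2 cA cB] dw dk kE.
have [[mh mA] mB] := (h2.1, A2.1, B2.1).
have mcos : measurable_fun [set: R] (@cos R).
  by apply: continuous_measurable_fun; exact: continuous_cos.
have msin : measurable_fun [set: R] (@sin R).
  by apply: continuous_measurable_fun; exact: continuous_sin.
have mxcos : measurable_fun [set: R] (fun xi => cos (x * xi)).
  by apply: measurableT_comp => //; exact: measurable_funM.
have mxsin : measurable_fun [set: R] (fun xi => sin (x * xi)).
  by apply: measurableT_comp => //; exact: measurable_funM.
have cos1 (z : R) : `|cos z| <= 1 by rewrite ler_norml cos_geN1 cos_le1.
have sin1 (z : R) : `|sin z| <= 1 by rewrite ler_norml sin_geN1 sin_le1.
have dwc : decaying (fun xi => w xi * cos (x * xi)) by exact: (decaying_bounded (M := 1)).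
have dws : decaying (fun xi => w xi * sin (x * xi)) by exact: (decaying_bounded (M := 1)).
pose hn n y := \1_`[- n%:R, n%:R] y * h y.
have hni n : intg (hn n).
  by apply: intg_indic => //; apply: locally_integrable_itv; exact: square_integrable_locally.
have mhn n : measurable_fun [set: R] (hn n) by exact: intg_measurable (hni n).
have mmul : measurable_fun [set: R * R] (fun z : R * R => z.2 * z.1).
  by apply: measurable_funM; [exact: measurable_snd|exact: measurable_fst].
pose re n xi := \int[mu]_y (hn n y * cos (y * xi)).
pose im n xi := - \int[mu]_y (hn n y * sin (y * xi)).
have reE n : truncated_fourier_re n h = re n.
  apply/funext => xi; rewrite /truncated_fourier_re Rint_indic.
  by apply: Rint_ext => y; rewrite mulrA.
have imE n : truncated_fourier_im n h = im n.
  apply/funext => xi; rewrite /truncated_fourier_im Rint_indic.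
  by congr (- _); apply: Rint_ext => y; rewrite mulrA.
have mre n : measurable_fun [set: R] (re n).
  apply: (@measurable_int_param _ (fun z => hn n z.2 * cos (z.2 * z.1))).
  by apply: measurable_funM; [apply: measurableT_comp => //; exact: measurable_snd|
    exact: measurableT_comp].
have mim n : measurable_fun [set: R] (im n).
  apply: measurableT_comp => //.
  apply: (@measurable_int_param _ (fun z => hn n z.2 * sin (z.2 * z.1))).
  by apply: measurable_funM; [apply: measurableT_comp => //; exact: measurable_snd|
    exact: measurableT_comp].
have hc n xi : intg (fun y => hn n y * cos (y * xi)).
  under eq_fun do rewrite mulrC.
  apply: (@intg_bounded _ _ _ 1) => //.
  by apply: measurableT_comp => //; exact: measurable_funM.
have hs n xi : intg (fun y => hn n y * sin (y * xi)).
  under eq_fun do rewrite mulrC.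
  apply: (@intg_bounded _ _ _ 1) => //.
  by apply: measurableT_comp => //; exact: measurable_funM.
have re_le n xi : `|re n xi| <= \int[mu]_y `|hn n y|.
  apply: Rint_abs_le => //; first exact: intg_norm.
  by move=> y; rewrite normrM ler_piMr.
have im_le n xi : `|im n xi| <= \int[mu]_y `|hn n y|.
  rewrite normrN; apply: Rint_abs_le => //; first exact: intg_norm.
  by move=> y; rewrite normrM ler_piMr.
have rei n : intg (fun xi => re n xi * (w xi * cos (x * xi))).
  by apply: intg_bounded (mre n) (re_le n); exact: decaying_intg.
have imi n : intg (fun xi => im n xi * (w xi * sin (x * xi))).
  by apply: intg_bounded (mim n) (im_le n); exact: decaying_intg.
have Ai : intg (fun xi => A xi * (w xi * cos (x * xi))).
  by apply: square_integrable_mul => //; exact: decaying_square_integrable.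
have Bi : intg (fun xi => B xi * (w xi * sin (x * xi))).
  by apply: square_integrable_mul => //; exact: decaying_square_integrable.
pose S n := \int[mu]_xi (re n xi * (w xi * cos (x * xi)))
  - \int[mu]_xi (im n xi * (w xi * sin (x * xi))).
(* For the truncation [hn n], which is integrable, Fubini applies. Since [im] carries a minus sign,
   the two products recombine into cos((x - y) xi) by the addition formula, and the xi-integral is
   k(x - y). *)
have SE n : S n = \int[mu]_y (k (x - y) * hn n y).
  pose K (z : R * R) := hn n z.2 * (w z.1 * cos ((x - z.2) * z.1)).
  have mK : measurable_fun [set: R * R] K.
    apply: measurable_funM.
      by apply: measurableT_comp => //; exact: measurable_snd.
    apply: measurable_funM.
      by apply: measurableT_comp; [exact: dw.1|exact: measurable_fst].
    apply: measurableT_comp => //; apply: measurable_funM; last exact: measurable_fst.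
    by apply: measurable_funB => //; exact: measurable_snd.
  have Ki : (mu \x mu)%E.-integrable [set: R * R] (EFin \o K).
    apply: (@integrable_prod _ _ (fun xi => `|w xi|) (fun y => `|hn n y|)) => //.
    - by apply: intg_norm; exact: decaying_intg.
    - exact: intg_norm.
    - move=> xi y; rewrite /K /= !normrM mulrC -[leRHS]mulr1 mulrAC.
      by rewrite ler_pM// mulr_ge0.
  transitivity (\int[mu]_y (\int[mu]_xi K (xi, y))); last first.
    apply: Rint_ext => y; rewrite -kE mulrC -RintZ//.
    apply: decaying_intg; apply: (decaying_bounded (M := 1)) => //.
    by apply: measurableT_comp => //; exact: measurable_funM.
  rewrite -Rint_fubini// /S -RintB//; apply: Rint_ext => xi.
  rewrite /re /im mulNr opprK -!(mulrC (w xi * _)) -!RintZ//.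
  rewrite -RintD; [|exact: intgZ..]; apply: Rint_ext => y.
  by rewrite /K /= mulrBl cosB; ring.
have Skh : S n @[n --> \oo] --> \int[mu]_y (k (x - y) * h y).
  rewrite (funext SE); have [mk _] := decaying_shift x dk.
  have [|||||_] // := @Rint_dominated _ (fun n y => k (x - y) * hn n y)
     (fun y => k (x - y) * h y) (fun y => `|k (x - y) * h y|).
  - by move=> n; exact: measurable_funM.
  - exact: measurable_funM.
  - apply: aeW => y; apply: cvg_near_cst; near=> n.
    rewrite /hn indic_itvcc -ler_norml (_ : `|y| <= n%:R) ?mul1r//.
    by near: n; exact: nbhs_infty_ger.
  - apply: intg_norm; apply: square_integrable_mul => //.
    by apply: decaying_square_integrable; exact: decaying_shift.
  - move=> n y; rewrite normrM [leRHS]normrM ler_wpM2l// /hn indic_itvcc normrM.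
    by case: (_ <= _ <= _); rewrite ?normr1 ?mul1r ?normr0 ?mul0r.
(* The same sequence [S] has a second limit, on the frequency side: [re n] and [im n] tend to [A]
   and [B] in L^2 and are paired with the square integrable functions w cos and w sin. *)
apply: cvgn_unique Skh.
have LA := @Lnorm2_cvg0_pairing _ (fun n => (re n \- A)%R) (fun xi => w xi * cos (x * xi)).
have LB := @Lnorm2_cvg0_pairing _ (fun n => (im n \- B)%R) (fun xi => w xi * sin (x * xi)).
have {}LA : \int[mu]_xi (re n xi * (w xi * cos (x * xi))) -
    \int[mu]_xi (A xi * (w xi * cos (x * xi))) @[n --> \oo] --> 0.
  under eq_fun => n.
    rewrite -RintB//; under Rint_ext do rewrite -mulrBl.
    over.
  apply: LA.
  - by move=> n; exact: measurable_funB.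
  - exact: decaying_square_integrable.
  - by move=> n; have := intgB (rei n) Ai; under eq_fun do rewrite -mulrBl.
  - by move: cA; under eq_fun do rewrite reE.
have {}LB : \int[mu]_xi (im n xi * (w xi * sin (x * xi))) -
    \int[mu]_xi (B xi * (w xi * sin (x * xi))) @[n --> \oo] --> 0.
  under eq_fun => n.
    rewrite -RintB//; under Rint_ext do rewrite -mulrBl.
    over.
  apply: LB.
  - by move=> n; exact: measurable_funB.
  - exact: decaying_square_integrable.
  - by move=> n; have := intgB (imi n) Bi; under eq_fun do rewrite -mulrBl.
  - by move: cB; under eq_fun do rewrite imE.
rewrite (@Rint_ext _ _ (fun xi => A xi * (w xi * cos (x * xi)) -
  B xi * (w xi * sin (x * xi)))); last by move=> xi; ring.
rewrite RintB//.
set IA := \int[mu]_x _ in LA *; set IB := \int[mu]_x _ in LB *.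
rewrite (_ : (fun n => S n) = (fun n =>
  (\int[mu]_xi (re n xi * (w xi * cos (x * xi))) - IA) -
  (\int[mu]_xi (im n xi * (w xi * sin (x * xi))) - IB) + (IA - IB))).
  rewrite [X in _ --> X](_ : _ = 0 - 0 + (IA - IB)); last by ring.
  by apply: cvgD; [exact: cvgB|exact: cvg_cst].
by apply/funext => n; rewrite /S; ring.
Unshelve. all: by end_near. Qed.

End decaying_functions.

(** * The Poisson kernel, its derivatives and its Fourier transform *)

Section poisson_kernel.
Set Implicit Arguments.
Unset Strict Implicit.
Context {R : realType}.
Local Notation mu := (@lebesgue_measure R).
Local Notation intg f := (mu.-integrable [set: R] (EFin \o f)).
Implicit Types (e x y z : R).

Definition lorentz e z : R := (e ^+ 2 + z ^+ 2)^-1.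

(* pi times the Poisson kernel of the half-plane at height e *)
Definition poisson e z : R := lorentz e z * e.

(* minus the derivative of [poisson e z] with respect to e *)
Definition poisson_height e z : R := lorentz e z * (2 * e ^+ 2 * lorentz e z - 1).

(** This kernel and the next two are z-derivatives: of [poisson], of [dpoisson] and of
    [poisson_height]. Each is written as [lorentz e z] times a bounded factor, the form that
    [decaying_bounded] takes. *)
Definition dpoisson e z : R := lorentz e z * (- 2 * e * (z * lorentz e z)).

Definition d2poisson e z : R :=
  lorentz e z * (6 * e * lorentz e z - 8 * e ^+ 3 * lorentz e z ^+ 2).

Definition dpoisson_height e z : R :=
  lorentz e z * ((2 - 8 * e ^+ 2 * lorentz e z) * (z * lorentz e z)).

Section fixed_height.
Variable e : R.
Hypothesis e0 : 0 < e.

Lemma lorentz_den_gt0 z : 0 < e ^+ 2 + z ^+ 2.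
Proof. by rewrite ltr_wpDr ?sqr_ge0// exprn_gt0. Qed.

Lemma lorentz_den_neq0 z : e ^+ 2 + z ^+ 2 != 0.
Proof. by rewrite gt_eqF// lorentz_den_gt0. Qed.

Lemma lorentz_gt0 z : 0 < lorentz e z.
Proof. by rewrite invr_gt0 lorentz_den_gt0. Qed.

Lemma lorentz_smooth : smooth (lorentz e).
Proof.
apply: smoothV => [z|]; first exact: lorentz_den_neq0.
apply: smoothD; first exact: smooth_cst.
by apply: smoothM; exact: smooth_id.
Qed.

Lemma poisson_smooth : smooth (poisson e).
Proof. by apply: smoothM; [exact: lorentz_smooth|exact: smooth_cst]. Qed.

Lemma poisson_height_smooth : smooth (poisson_height e).
Proof.
apply: smoothM; first exact: lorentz_smooth.
apply: smoothD; last exact: smooth_cst.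
by apply: smoothM; [exact: smooth_cst|exact: lorentz_smooth].
Qed.

Lemma dpoisson_smooth : smooth (dpoisson e).
Proof.
apply: smoothM; first exact: lorentz_smooth.
apply: smoothM; first exact: smooth_cst.
by apply: smoothM; [exact: smooth_id|exact: lorentz_smooth].
Qed.

Lemma lorentz_isd z : is_derive z 1 (lorentz e) (- (2 * z) * lorentz e z ^+ 2).
Proof.
have h : is_derive z 1 (fun z => e ^+ 2 + z * z) (0 + (1 * z + z * 1)).
  by apply: isdD; apply: isdM; exact: is_derive_id.
have := @isd_inv R (fun z => e ^+ 2 + z ^+ 2) z _ (lorentz_den_neq0 z) h; rewrite -/(lorentz e z) => h'.
by apply: is_derive_eq h' _; rewrite /lorentz; ring.
Qed.

Lemma poisson_isd z : is_derive z 1 (poisson e) (dpoisson e z).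
Proof.
apply: is_derive_eq (isdM (lorentz_isd z) (is_derive_cst e z 1)) _.
by rewrite /dpoisson /=; ring.
Qed.

Lemma dpoisson_isd z : is_derive z 1 (dpoisson e) (d2poisson e z).
Proof.
have h := isdM (is_derive_cst (- 2 * e) z 1) (isdM (is_derive_id z 1) (lorentz_isd z)).
apply: is_derive_eq (isdM (lorentz_isd z) h) _.
rewrite /d2poisson /lorentz /=; field.
exact: lorentz_den_neq0.
Qed.

Lemma poisson_height_isd z : is_derive z 1 (poisson_height e) (dpoisson_height e z).
Proof.
have h := isdD (isdM (is_derive_cst (2 * e ^+ 2) z 1) (lorentz_isd z))
  (is_derive_cst (- 1 : R) z 1).
apply: is_derive_eq (isdM (lorentz_isd z) h) _.
rewrite /dpoisson_height /lorentz /=; field.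
exact: lorentz_den_neq0.
Qed.

(* Homogeneity of degree -2 of [poisson_height] in (e, z), together with the
   harmonicity of the Poisson kernel. *)
Lemma poisson_height_homogeneous z :
  2 * poisson_height e z + z * dpoisson_height e z = - (e * d2poisson e z).
Proof.
rewrite /poisson_height /dpoisson_height /d2poisson /lorentz; field.
exact: lorentz_den_neq0.
Qed.

Lemma lorentz_le z : lorentz e z <= e ^- 2.
Proof.
rewrite lef_pV2 ?posrE ?exprn_gt0 ?lorentz_den_gt0//.
by rewrite lerDl sqr_ge0.
Qed.

Lemma mul_lorentz_le z : `|z * lorentz e z| <= e^-1.
Proof.
rewrite -(@ler_pXn2r _ 2%N) ?nnegrE ?invr_ge0 ?(ltW e0)// real_normK ?num_real//.
rewrite exprMn expr2 [X in _ * X]expr2 mulrA exprVn.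
rewrite (@le_trans _ _ (1 * lorentz e z))//; last by rewrite mul1r lorentz_le.
rewrite ler_wpM2r ?(ltW (lorentz_gt0 z))// -expr2 ler_pdivrMr ?lorentz_den_gt0//.
by rewrite mul1r lerDr sqr_ge0.
Qed.

Lemma lorentz_decaying : decaying (lorentz e).
Proof.
split; first exact: smooth_measurable lorentz_smooth.
exists (1 + e ^- 2) => [|z]; first by rewrite addr_ge0// invr_ge0 exprn_ge0// ltW.
rewrite (ger0_norm (ltW (lorentz_gt0 z))).
rewrite ler_pdivlMr; last by rewrite ltr_pwDl// sqr_ge0.
rewrite mulrDr mulr1 addrC; apply: lerD; last exact: lorentz_le.
rewrite mulrC ler_pdivrMr ?lorentz_den_gt0//.
by rewrite mul1r lerDr sqr_ge0.
Qed.

Lemma lorentz_norm_le z : `|lorentz e z| <= e ^- 2.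
Proof. by rewrite (ger0_norm (ltW (lorentz_gt0 z))) lorentz_le. Qed.

Lemma mlorentz : measurable_fun [set: R] (lorentz e).
Proof. exact: smooth_measurable lorentz_smooth. Qed.

Lemma mmul_lorentz : measurable_fun [set: R] (fun z => z * lorentz e z).
Proof. by apply: measurable_funM => //; exact: mlorentz. Qed.

Lemma poisson_decaying : decaying (poisson e).
Proof. exact: (decaying_bounded (M := `|e|) lorentz_decaying). Qed.

Lemma poisson_height_decaying : decaying (poisson_height e).
Proof.
apply: (decaying_bounded (M := `|2 * e ^+ 2| * e ^- 2 + 1) lorentz_decaying).
  by apply: measurable_funB => //; apply: measurable_funM => //; exact: mlorentz.
move=> z; rewrite (le_trans (ler_normB _ _))// normr1 lerD2r normrM.
by rewrite ler_wpM2l// lorentz_norm_le.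
Qed.

Lemma dpoisson_decaying : decaying (dpoisson e).
Proof.
apply: (decaying_bounded (M := `|- 2 * e| * e^-1) lorentz_decaying).
  by apply: measurable_funM => //; exact: mmul_lorentz.
by move=> z; rewrite normrM ler_wpM2l// mul_lorentz_le.
Qed.

Lemma d2poisson_decaying : decaying (d2poisson e).
Proof.
apply: (decaying_bounded
  (M := `|6 * e| * e ^- 2 + `|8 * e ^+ 3| * (e ^- 2) ^+ 2) lorentz_decaying).
  apply: measurable_funB; apply: measurable_funM => //; first exact: mlorentz.
  by apply: measurable_funX; exact: mlorentz.
move=> z; rewrite (le_trans (ler_normB _ _))//; apply: lerD.
  by rewrite normrM ler_wpM2l// lorentz_norm_le.
rewrite normrM ler_wpM2l// normrX lerXn2r ?nnegrE ?lorentz_norm_le//.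
by rewrite invr_ge0 exprn_ge0// ltW.
Qed.

Lemma dpoisson_height_decaying : decaying (dpoisson_height e).
Proof.
apply: (decaying_bounded
  (M := (2 + `|8 * e ^+ 2| * e ^- 2) * e^-1) lorentz_decaying).
  apply: measurable_funM; last exact: mmul_lorentz.
  by apply: measurable_funB => //; apply: measurable_funM => //; exact: mlorentz.
move=> z; rewrite normrM ler_pM// ?mul_lorentz_le//.
rewrite (le_trans (ler_normB _ _))// (ger0_norm (ler0n _ 2)) lerD2l normrM.
by rewrite ler_wpM2l// lorentz_norm_le.
Qed.

Lemma poissonN z : poisson e (- z) = poisson e z.
Proof. by rewrite /poisson /lorentz sqrrN. Qed.

Lemma poisson_heightN z : poisson_height e (- z) = poisson_height e z.
Proof. by rewrite /poisson_height /lorentz sqrrN. Qed.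

Lemma poisson_ge0 z : 0 <= poisson e z.
Proof. by rewrite mulr_ge0 ?ltW// lorentz_gt0. Qed.

(** The primitive is arctan((y - x)/e). The mass does not depend on [e], which makes the Schur bound
    below uniform in [e]. *)
Lemma Rint_poisson x : \int[mu]_y poisson e (x - y) = pi.
Proof.
pose F y := atan (e^-1 * y + (- (x / e))).
have dF (y : R) : is_derive y 1 F (poisson e (x - y)).
  apply: is_derive_eq (isd_comp_affine (is_derive1_atan _)) _.
  by rewrite /poisson /lorentz; field; rewrite lorentz_den_neq0 gt_eqF.
have fi : intg (fun y => poisson e (x - y)).
  by apply: decaying_intg; exact/decaying_shift/poisson_decaying.
have cf : continuous (fun y => poisson e (x - y)).
  exact/smooth_continuous/smooth_shift/poisson_smooth.
have Fy : F n.+1%:R @[n --> \oo] --> pi / 2.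
  have h : e^-1 * n.+1%:R + - (x / e) @[n --> \oo] --> +oo.
    by apply: cvgry_natS_affine; rewrite invr_gt0.
  exact: (cvg_comp _ _ h (@cvgy_atan R)).
have FNy : F (- n.+1%:R) @[n --> \oo] --> - (pi / 2).
  have h : e^-1 * n.+1%:R + x / e @[n --> \oo] --> +oo.
    by apply: cvgry_natS_affine; rewrite invr_gt0.
  apply: cvgn_ext (cvgN (cvg_comp _ _ h (@cvgy_atan R))) => n /=.
  by rewrite /F -atanN; congr atan; ring.
by rewrite (Rint_FTC fi cf dF Fy FNy) opprK -splitr.
Qed.

(** The symbol of the Poisson semigroup at time [e]. *)
Definition expw (xi : R) : R := expR (- (e * `|xi|)).

Lemma mexpw : measurable_fun [set: R] expw.
Proof.
apply: measurableT_comp => //; apply: measurableT_comp => //.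
by apply: measurable_funM => //; exact: measurableT_comp.
Qed.

(** The polynomial (1 + e^-2 t^2)^2 at t = e |xi| is (1 + xi^2)^2. The square leaves room for an
    additional factor |xi|, so the bound serves both [expw] and [|xi| * expw xi]. *)
Lemma expw_le : exists2 C, 0 <= C &
  forall xi, expw xi * (1 + xi ^+ 2) ^+ 2 <= C.
Proof.
have [C C0 hC] := @poly_expR_bounded R ((1%:P + e ^- 2 *: 'X^2) ^+ 2).
exists C => // xi; have := hC (e * `|xi|); rewrite mulr_ge0 ?(ltW e0)// => /(_ isT).
rewrite horner_exp hornerD hornerC hornerZ hornerXn exprMn mulKf; last first.
  by rewrite expf_neq0// gt_eqF.
by rewrite real_normK ?num_real// ger0_norm ?sqr_ge0// mulrC.
Qed.

Lemma expw_decaying : decaying expw.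
Proof.
split; first exact: mexpw.
have [C C0 hC] := expw_le; exists C => // xi.
rewrite ger0_norm ?expR_ge0// ler_pdivlMr; last by rewrite ltr_pwDl// sqr_ge0.
rewrite (le_trans _ (hC xi))// ler_wpM2l ?expR_ge0//.
by have := sqr_ge0 xi; nra.
Qed.

Lemma mul_expw_decaying : decaying (fun xi => `|xi| * expw xi).
Proof.
split; first by apply: measurable_funM; [exact: normr_measurable|exact: mexpw].
have [C C0 hC] := expw_le; exists C => // xi.
rewrite ger0_norm ?mulr_ge0 ?expR_ge0// ler_pdivlMr; last by rewrite ltr_pwDl// sqr_ge0.
rewrite (le_trans _ (hC xi))// mulrAC mulrC ler_wpM2l ?expR_ge0//.
rewrite [leRHS]expr2 ler_wpM2r ?addr_ge0 ?sqr_ge0//.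
by rewrite -(real_normK (num_real xi)); have := sqr_ge0 (`|xi| - 1); nra.
Qed.

Lemma decaying_cvg0 (w : R -> R) : decaying w -> w n.+1%:R @[n --> \oo] --> (0 : R).
Proof.
move=> [_ [C C0 hC]].
have h : C * (n.+1%:R)^-1 @[n --> \oo] --> (0 : R).
  by rewrite -(mulr0 C); apply: cvgMr; exact: cvg_harmonic.
apply/cvgr0Pnorm_le => t t0; move/cvgr0Pnorm_le : h => /(_ t t0).
apply: filterS => n; apply: le_trans; rewrite (le_trans (hC _))//.
rewrite (le_trans _ (ler_norm _))// ler_wpM2l// lef_pV2 ?posrE ?ltr0n//.
  by have := sqr_ge0 (n.+1%:R - 1 : R); have := ler1n R n.+1; nra.
Qed.

Lemma isd_scale (f : R -> R) (a x df : R) : is_derive (a * x) 1 f df ->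
  is_derive x 1 (fun y => f (a * y)) (df * a).
Proof.
move=> h; have := @isd_comp_affine _ f a 0 x df; rewrite addr0 => /(_ h).
by congr is_derive; apply/funext => y; rewrite addr0.
Qed.

Lemma mcos_scale (x : R) : measurable_fun [set: R] (fun xi => cos (x * xi)).
Proof.
apply: measurableT_comp; last exact: measurable_funM.
by apply: continuous_measurable_fun; exact: continuous_cos.
Qed.

Lemma msin_scale (x : R) : measurable_fun [set: R] (fun xi => sin (x * xi)).
Proof.
apply: measurableT_comp; last exact: measurable_funM.
by apply: continuous_measurable_fun; exact: continuous_sin.
Qed.

Section fixed_frequency.
Variable z : R.

Lemma trig_bounded (a b : R) xi : `|a * sin (z * xi) + b * cos (z * xi)| <= `|a| + `|b|.
Proof.
rewrite (le_trans (ler_normD _ _))// !normrM; apply: lerD.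
  by rewrite ler_piMr// ler_norml sin_geN1 sin_le1.
by rewrite ler_piMr// ler_norml cos_geN1 cos_le1.
Qed.

Lemma mtrig (a b : R) : measurable_fun [set: R] (fun xi => a * sin (z * xi) + b * cos (z * xi)).
Proof.
by apply: measurable_funD; apply: measurable_funM => //;
  [exact: msin_scale|exact: mcos_scale].
Qed.

Lemma trig_isd (a b xi : R) :
  is_derive xi 1 (fun y => a * sin (z * y) + b * cos (z * y))
    (a * (cos (z * xi) * z) + b * (- sin (z * xi) * z)).
Proof.
have hs := isdM (is_derive_cst a xi 1) (isd_scale (is_derive_sin (z * xi))).
have hc := isdM (is_derive_cst b xi 1) (isd_scale (is_derive_cos (z * xi))).
by apply: is_derive_eq (isdD hs hc) _; rewrite !mul0r !add0r.
Qed.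

Lemma exp_isd (xi : R) :
  is_derive xi 1 (fun y => expR (- e * y)) (expR (- e * xi) * - e).
Proof. exact: isd_scale (is_derive_expR _). Qed.

(** Derivation acts on the pair (a, b) as a linear map of determinant e^2 + z^2. Primitives are
    therefore found by inverting a 2 by 2 matrix, which is where the powers of [lorentz e z] below
    come from. *)
Lemma exp_trig_isd (a b xi : R) :
  is_derive xi 1 (fun y => expR (- e * y) * (a * sin (z * y) + b * cos (z * y)))
   (expR (- e * xi) * ((- e * a - z * b) * sin (z * xi) + (z * a - e * b) * cos (z * xi))).
Proof.
apply: is_derive_eq (isdM (exp_isd xi) (trig_isd a b xi)) _.
by ring.
Qed.

Lemma exp_trig_continuous (a b : R) :
  continuous (fun y => expR (- e * y) * (a * sin (z * y) + b * cos (z * y))).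
Proof.
apply: derivable_continuous => y; have := exp_trig_isd a b y => ?.
exact: ex_derive.
Qed.

Lemma exp_trig_cvg0 (a b : R) : expR (- e * n.+1%:R) *
  (a * sin (z * n.+1%:R) + b * cos (z * n.+1%:R)) @[n --> \oo] --> (0 : R).
Proof.
apply: cvgn_ext (decaying_cvg0 (decaying_bounded expw_decaying
  (mtrig a b) (trig_bounded a b))) => n.
by rewrite /expw ger0_norm// mulNr.
Qed.

Lemma mul_exp_trig_cvg0 (a b : R) : n.+1%:R * (expR (- e * n.+1%:R) *
  (a * sin (z * n.+1%:R) + b * cos (z * n.+1%:R))) @[n --> \oo] --> (0 : R).
Proof.
apply: cvgn_ext (decaying_cvg0 (decaying_bounded mul_expw_decaying
  (mtrig a b) (trig_bounded a b))) => n.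
by rewrite /expw ger0_norm// mulNr mulrA.
Qed.

Lemma fourier_expw : \int[mu]_xi (expw xi * cos (z * xi)) = 2 * poisson e z.
Proof.
set D := lorentz e z.
have gi : intg (fun xi => expw xi * cos (z * xi)).
  apply: decaying_intg; apply: (decaying_bounded (M := 1) expw_decaying (mcos_scale z)).
  by move=> xi; rewrite ler_norml cos_geN1 cos_le1.
have gN x : expw (- x) * cos (z * - x) = expw x * cos (z * x).
  by rewrite /expw normrN mulrN cosN.
have gf x : 0 <= x -> expw x * cos (z * x) =
    expR (- e * x) * (0 * sin (z * x) + 1 * cos (z * x)).
  by move=> x0; rewrite /expw ger0_norm// mul0r add0r mul1r mulNr.
(* The coefficients z D and -e D are the preimage of (0, 1) under the map of [exp_trig_isd]. *)
have dF (x : R) : is_derive x 1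
    (fun y => expR (- e * y) * (z * D * sin (z * y) + (- e * D) * cos (z * y)))
    (expR (- e * x) * (0 * sin (z * x) + 1 * cos (z * x))).
  apply: is_derive_eq (exp_trig_isd _ _ _) _.
  by congr (_ * (_ * _ + _ * _)); rewrite /D /lorentz; field; exact: lorentz_den_neq0.
rewrite (Rint_even_FTC gi (@exp_trig_continuous 0 1) gN gf dF (@exp_trig_cvg0 _ _)).
by rewrite !mulr0 expR0 sin0 cos0 /poisson -/D; ring.
Qed.

Lemma fourier_mul_expw :
  \int[mu]_xi (`|xi| * expw xi * cos (z * xi)) = 2 * poisson_height e z.
Proof.
set D := lorentz e z.
(* [E1] is a primitive of e^(-e y) cos(z y) and [E2] a primitive of [E1], so y E1 - E2 is a
   primitive of [f]. *)
pose E1 y := expR (- e * y) * (z * D * sin (z * y) + (- e * D) * cos (z * y)).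
pose E2 y := expR (- e * y) * ((- 2 * e * z * D ^+ 2) * sin (z * y) +
  ((e ^+ 2 - z ^+ 2) * D ^+ 2) * cos (z * y)).
pose f y := y * (expR (- e * y) * (0 * sin (z * y) + 1 * cos (z * y))).
have gi : intg (fun xi => `|xi| * expw xi * cos (z * xi)).
  apply: decaying_intg; apply: (decaying_bounded (M := 1) mul_expw_decaying (mcos_scale z)).
  by move=> xi; rewrite ler_norml cos_geN1 cos_le1.
have gN x : `|- x| * expw (- x) * cos (z * - x) = `|x| * expw x * cos (z * x).
  by rewrite /expw normrN mulrN cosN.
have gf x : 0 <= x -> `|x| * expw x * cos (z * x) = f x.
  by move=> x0; rewrite /f /expw ger0_norm// mul0r add0r mul1r mulNr mulrA.
have cf : continuous f.
  by move=> y; apply: cvgM; [exact: cvg_id|exact: exp_trig_continuous].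
have dF (x : R) : is_derive x 1 (fun y => y * E1 y + (- 1) * E2 y) (f x).
  have h1 := isdM (is_derive_id x 1) (exp_trig_isd (z * D) (- e * D) x).
  have h2 := isdM (is_derive_cst (- 1 : R) x 1)
    (exp_trig_isd (- 2 * e * z * D ^+ 2) ((e ^+ 2 - z ^+ 2) * D ^+ 2) x).
  apply: is_derive_eq (isdD h1 h2) _.
  by rewrite /f /= /D /lorentz; field; exact: lorentz_den_neq0.
have Fl : n.+1%:R * E1 n.+1%:R + (- 1) * E2 n.+1%:R @[n --> \oo] --> (0 : R).
  rewrite [X in _ --> X](_ : _ = 0 + (- 1) * 0); last by ring.
  apply: cvgD; first exact: mul_exp_trig_cvg0.
  by apply: cvgMr; exact: exp_trig_cvg0.
rewrite (Rint_even_FTC gi cf gN gf dF Fl).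
rewrite /E1 /E2 !mulr0 expR0 sin0 cos0 /poisson_height -/D.
by rewrite /D /lorentz; field; exact: lorentz_den_neq0.
Qed.

End fixed_frequency.

(* Both sides are e^(-e|D|)|D| f, up to the factor pi. *)
Lemma half_laplacian_poisson f g x : half_laplacian f g ->
  \int[mu]_y (poisson_height e (x - y) * f y) = \int[mu]_y (poisson e (x - y) * g y).
Proof.
move=> [A [B [A' [B' [fA gA AA]]]]].
have h1 := fourier_L2_conv x fA mul_expw_decaying
  (decayingZ 2 poisson_height_decaying) fourier_mul_expw.
have h2 := fourier_L2_conv x gA expw_decaying (decayingZ 2 poisson_decaying) fourier_expw.
have [f2 /L2_square_integrable[mA _] /L2_square_integrable[mB _] _ _] := fA.
have [g2 /L2_square_integrable[mA' _] /L2_square_integrable[mB' _] _ _] := gA.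
apply: (@mulfI _ (2 : R)) => //.
rewrite -!RintZ; last 2 first.
- apply: square_integrable_mul; last exact: L2_square_integrable.
  by apply: decaying_square_integrable; exact/decaying_shift/poisson_decaying.
- apply: square_integrable_mul; last exact: L2_square_integrable.
  by apply: decaying_square_integrable; exact/decaying_shift/poisson_height_decaying.
under Rint_ext do rewrite mulrA; rewrite -h1.
under [RHS]Rint_ext do rewrite mulrA; rewrite -h2.
have [mcos msin] := (mcos_scale x, msin_scale x).
apply: ae_eq_Rint.
- apply: measurable_funM; first exact: mul_expw_decaying.1.
  by apply: measurable_funB; exact: measurable_funM.
- apply: measurable_funM; first exact: mexpw.
  by apply: measurable_funB; exact: measurable_funM.
- by apply: (ae_imp AA) => xi [-> ->]; ring.
Qed.

End fixed_height.

End poisson_kernel.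

(** * Schur's test and weak convergence of Poisson integrals *)

Section poisson_approximation.
Set Implicit Arguments.
Unset Strict Implicit.
Context {R : realType}.
Local Notation mu := (@lebesgue_measure R).
Local Notation intg f := (mu.-integrable [set: R] (EFin \o f)).
Local Notation intg2 k := ((mu \x mu)%E.-integrable [set: R * R] (EFin \o k)).
Implicit Types f g h c d : R -> R.

Lemma Rint_prod (k : R * R -> R) : intg2 k ->
  \int[mu]_x (\int[mu]_y k (x, y)) = Rintegral (mu \x mu)%E [set: R * R] k.
Proof.
move=> ki.
have mk : measurable_fun [set: R * R] k.
  by have /measurable_int/measurable_EFinP := ki.
congr fine; rewrite -[RHS](integral12_prod_meas1 ki).
apply: ae_eq_integral => //.
- by apply/measurable_EFinP; exact: measurable_int_param.
- exact: measurable_fubini_F ki.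
- by apply: (ae_imp (ae_integrable1 ki)) => x hx _; exact: EFin_Rint.
Qed.

Lemma young_le (t a b : R) : 0 < t -> `|a * b| <= t * a ^+ 2 + t^-1 * b ^+ 2.
Proof.
move=> t0; rewrite (_ : t * a ^+ 2 + t^-1 * b ^+ 2 = t^-1 * ((t * a) ^+ 2 + b ^+ 2)).
  rewrite (_ : a * b = t^-1 * (t * a * b)); last by field; rewrite gt_eqF.
  rewrite normrM gtr0_norm ?invr_gt0// ler_wpM2l ?invr_ge0 ?(ltW t0)//.
  move: (t * a) => c; rewrite ler_norml.
  have := sqr_ge0 (c - b); have := sqr_ge0 (c + b).
  by have := sqr_ge0 c; have := sqr_ge0 b => *; apply/andP; split; nra.
by field; rewrite gt_eqF.
Qed.

Section schur.
Variable e : R.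
Hypothesis e0 : 0 < e.

Definition poisson_conv h x := \int[mu]_y (poisson e (x - y) * h y).

Lemma poisson_conv_intg h x : square_integrable h ->
  intg (fun y => poisson e (x - y) * h y).
Proof.
move=> h2; apply: square_integrable_mul => //.
by apply: decaying_square_integrable; exact/decaying_shift/poisson_decaying.
Qed.

Lemma mpoissonB : measurable_fun [set: R * R] (fun z : R * R => poisson e (z.1 - z.2)).
Proof.
apply: (measurableT_comp (poisson_decaying e0).1).
by apply: measurable_funB; [exact: measurable_fst|exact: measurable_snd].
Qed.

Lemma mpoisson_conv h : measurable_fun [set: R] h ->
  measurable_fun [set: R] (poisson_conv h).
Proof.
move=> mh; apply: (@measurable_int_param _ (fun z => poisson e (z.1 - z.2) * h z.2)).
apply: measurable_funM; first exact: mpoissonB.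
by apply: measurableT_comp => //; exact: measurable_snd.
Qed.

Lemma Rint_poissonl y : \int[mu]_x poisson e (x - y) = pi.
Proof.
rewrite -(Rint_poisson e0 y); apply: Rint_ext => x.
by rewrite -poissonN opprB.
Qed.

(** One half of Schur's test: for a weight in x, the y-integral of the kernel is the constant pi. *)
Lemma poisson_weight1 f : measurable_fun [set: R] f -> intg f -> (forall x, 0 <= f x) ->
  intg2 (fun z : R * R => poisson e (z.1 - z.2) * f z.1) /\
  \int[mu]_x (\int[mu]_y (poisson e (x - y) * f x)) = pi * \int[mu]_x f x.
Proof.
move=> mf fi f0.
have pi' x : intg (fun y => poisson e (x - y)).
  by apply: decaying_intg; exact/decaying_shift/poisson_decaying.
have E x : \int[mu]_y (poisson e (x - y) * f x) = pi * f x.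
  under Rint_ext do rewrite mulrC.
  by rewrite RintZ// Rint_poisson// mulrC.
split; last by under Rint_ext do rewrite E; rewrite RintZ.
have mk : measurable_fun [set: R * R] (fun z : R * R => poisson e (z.1 - z.2) * f z.1).
  by apply: measurable_funM; [exact: mpoissonB|
    apply: measurableT_comp => //; exact: measurable_fst].
apply/integrable12ltyP; first exact/measurable_EFinP.
have := integrable_lty measurableT (intgZ pi fi); apply: le_lt_trans.
rewrite le_eqVlt; apply/orP; left; apply/eqP; apply: eq_integral => x _ /=.
rewrite -E EFin_Rint; last first.
  by have := intgZ (f x) (pi' x); under eq_fun do rewrite mulrC.
by apply: eq_integral => y _; rewrite ger0_norm// mulr_ge0// poisson_ge0.
Qed.

(** The other half: for a weight in y the x-integral has to be taken first, so the order is
    exchanged before the mass pi appears. *)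
Lemma poisson_weight2 f : measurable_fun [set: R] f -> intg f -> (forall x, 0 <= f x) ->
  intg2 (fun z : R * R => poisson e (z.1 - z.2) * f z.2) /\
  \int[mu]_x (\int[mu]_y (poisson e (x - y) * f y)) = pi * \int[mu]_x f x.
Proof.
move=> mf fi f0.
have pi' y : intg (fun x => poisson e (x - y)).
  rewrite (_ : (fun x => _) = fun x => poisson e (y - x)).
    by apply: decaying_intg; exact/decaying_shift/poisson_decaying.
  by apply/funext => x; rewrite -poissonN opprB.
have E y : \int[mu]_x (poisson e (x - y) * f y) = pi * f y.
  under Rint_ext do rewrite mulrC.
  by rewrite RintZ// Rint_poissonl// mulrC.
have mk : measurable_fun [set: R * R] (fun z : R * R => poisson e (z.1 - z.2) * f z.2).
  by apply: measurable_funM; [exact: mpoissonB|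
    apply: measurableT_comp => //; exact: measurable_snd].
have ki : intg2 (fun z : R * R => poisson e (z.1 - z.2) * f z.2).
  apply/integrable21ltyP; first exact/measurable_EFinP.
  have := integrable_lty measurableT (intgZ pi fi); apply: le_lt_trans.
  rewrite le_eqVlt; apply/orP; left; apply/eqP; apply: eq_integral => y _ /=.
  rewrite -E EFin_Rint; last first.
    by have := intgZ (f y) (pi' y); under eq_fun do rewrite mulrC.
  by apply: eq_integral => x _; rewrite ger0_norm// mulr_ge0// poisson_ge0.
split => //.
rewrite (Rint_fubini ki) /=.
by under Rint_ext do rewrite E; rewrite RintZ.
Qed.

(* Schur's test, with the weights of Young's inequality. *)
Lemma poisson_schur g h (t : R) : 0 < t -> square_integrable g -> square_integrable h ->
  intg (fun x => g x * poisson_conv h x) /\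
  `|\int[mu]_x (g x * poisson_conv h x)| <=
    pi * (t * \int[mu]_x (g x ^+ 2) + t^-1 * \int[mu]_x (h x ^+ 2)).
Proof.
move=> t0 g2 h2; have [[mg gi] [mh hi]] := (g2, h2).
have [M1 E1] := @poisson_weight1 (fun x => t * g x ^+ 2) (measurable_funM
  (measurable_cst _) (measurable_funX 2 mg)) (intgZ t gi) (fun x => mulr_ge0 (ltW t0) (sqr_ge0 _)).
have tV0 : 0 <= t^-1 by rewrite invr_ge0 ltW.
have [M2 E2] := @poisson_weight2 (fun x => t^-1 * h x ^+ 2) (measurable_funM
  (measurable_cst _) (measurable_funX 2 mh)) (intgZ t^-1 hi) (fun x => mulr_ge0 tV0 (sqr_ge0 _)).
(* Young's inequality bounds |g(x) h(y)| by a sum of a function of x and a function of y, so [M] is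
   a sum of the two weighted kernels just computed. *)
pose K (z : R * R) := g z.1 * (poisson e (z.1 - z.2) * h z.2).
pose M (z : R * R) := poisson e (z.1 - z.2) * (t * g z.1 ^+ 2) +
  poisson e (z.1 - z.2) * (t^-1 * h z.2 ^+ 2).
have mK : measurable_fun [set: R * R] K.
  apply: measurable_funM; first by apply: measurableT_comp => //; exact: measurable_fst.
  apply: measurable_funM; first exact: mpoissonB.
  by apply: measurableT_comp => //; exact: measurable_snd.
have KM z : `|K z| <= M z.
  rewrite /K /M -mulrDr mulrCA normrM (ger0_norm (poisson_ge0 e0 _)).
  by rewrite ler_wpM2l ?poisson_ge0// young_le.
have Mi : intg2 M by have := integrableD measurableT M1 M2.
have Ki : intg2 K.
  apply: (le_integrable measurableT _ _ Mi); first exact/measurable_EFinP.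
  by move=> z _ /=; rewrite lee_fin (le_trans (KM z))// ler_norm.
have KE x : \int[mu]_y K (x, y) = g x * poisson_conv h x.
  by rewrite /K /= RintZ//; exact: poisson_conv_intg.
split; first by have := intg_fubini Ki; under eq_fun do rewrite KE.
under Rint_ext do rewrite -KE.
rewrite (Rint_prod Ki) (le_trans (le_normr_Rintegral measurableT Ki))//.
rewrite (@le_trans _ _ (Rintegral (mu \x mu)%E [set: R * R] M))//.
  apply: le_Rintegral => //; exact: integrable_norm.
rewrite /M RintegralD//.
have -> := esym (Rint_prod M1).
have -> := esym (Rint_prod M2).
by rewrite /= E1 E2 !RintZ// mulrDr.
Qed.

End schur.

(** In Schur's bound [t] is first taken so large that the part of [h] costs at most eta/2; then
    [kappa] makes the part of [f] cost at most eta/2. Neither choice involves [e], as the density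
    argument needs. With [f] and [h] exchanged, the parameter is t^-1. *)
Lemma small_pairing h (eta : R) : square_integrable h -> 0 < eta ->
  exists2 kappa : R, 0 < kappa & forall f, square_integrable f ->
    \int[mu]_x (f x ^+ 2) <= kappa ->
    `|pi * \int[mu]_x (f x * h x)| <= eta /\
    forall e, 0 < e -> `|\int[mu]_x (f x * poisson_conv e h x)| <= eta /\
       `|\int[mu]_x (h x * poisson_conv e f x)| <= eta.
Proof.
move=> h2 eta0; have pi0 := pi_gt0 R.
set H := \int[mu]_x (h x ^+ 2).
have H0 : 0 <= H by apply: Rintegral_ge0 => x _; exact: sqr_ge0.
pose t := (2 * pi * H / eta) + 1.
have t1 : 1 <= t by rewrite lerDr !mulr_ge0// ?invr_ge0 ltW.
have t0 : 0 < t by rewrite (lt_le_trans _ t1).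
have tH : pi * (t^-1 * H) <= eta / 2.
  rewrite mulrCA mulrC ler_pdivrMr// /t mulrDr mulr1.
  rewrite (_ : eta / 2 * _ = pi * H); last by field; rewrite gt_eqF.
  by rewrite lerDl divr_ge0// ltW.
clearbody t.
exists (eta / (2 * pi * t)).
  by rewrite divr_gt0// !mulr_gt0.
move=> f f2 fk.
have tf : pi * (t * \int[mu]_x (f x ^+ 2)) <= eta / 2.
  have fE (p q : R) : 0 < p -> 0 < q -> eta / 2 = p * q * (eta / (2 * p * q)).
    by move=> p0 q0; field; rewrite !gt_eqF.
  by rewrite (fE pi t)// mulrA ler_wpM2l// mulr_ge0 ?ltW.
have B : pi * (t * \int[mu]_x (f x ^+ 2) + t^-1 * H) <= eta.
  by rewrite mulrDr [leRHS]splitr lerD.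
split.
  have [mf fi] := f2; have [mh hi] := h2.
  rewrite normrM (ger0_norm (ltW pi0)) (le_trans _ B)// ler_wpM2l ?(ltW pi0)//.
  rewrite -!RintZ// -RintD; [|exact: intgZ..].
  apply: Rint_abs_le; [exact: square_integrable_mul|by apply: intgD; exact: intgZ|].
  by move=> x; exact: young_le.
move=> e e0; split.
  by have [_] := poisson_schur e0 t0 f2 h2; move/le_trans; exact.
have tV0 : 0 < t^-1 by rewrite invr_gt0.
have [_] := poisson_schur e0 tV0 h2 f2; rewrite invrK => /le_trans; apply.
by rewrite addrC.
Qed.

(** Approximate identity at a point of continuity: near x the oscillation of [c] is small, and away
    from x the kernel is. *)
Lemma poisson_conv_cvg c (M x : R) : measurable_fun [set: R] c ->
  (forall y, `|c y| <= M) -> {for x, continuous c} ->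
  poisson_conv n.+1%:R^-1 c x @[n --> \oo] --> pi * c x.
Proof.
move=> mc cM cx; have pi0 := pi_gt0 R.
have M0 : 0 <= M by rewrite (le_trans _ (cM 0)).
apply/cvgrPdist_le => eta eta0.
have eta1 : 0 < eta / (2 * pi) by rewrite divr_gt0// mulr_gt0.
have := cx; move=> /cvgrPdist_le/(_ _ eta1)[delta /= delta0 hd].
(* For |z| >= delta the kernel at height e is at most (1 + delta^-2) e times the kernel at height 1,
   while |c x - c y| <= 2 M. The far part thus contributes at most C e pi. *)
pose C := 2 * M * (1 + delta ^- 2).
have C0 : 0 <= C by rewrite !mulr_ge0// addr_ge0// invr_ge0 exprn_ge0// ltW.
have h : C * pi * n.+1%:R^-1 @[n --> \oo] --> (0 : R).
  by rewrite -(mulr0 (C * pi)); apply: cvgMr; exact: cvg_harmonic.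
have eta2 : 0 < eta / 2 by rewrite divr_gt0.
move/cvgr0Pnorm_le : h => /(_ _ eta2); apply: filterS => n hn.
set e := n.+1%:R^-1 in hn *.
have e0 : 0 < e by rewrite invr_gt0 ltr0n.
have pii (a : R) : 0 < a -> intg (fun y => poisson a (x - y)).
  by move=> a0; apply: decaying_intg; exact/decaying_shift/poisson_decaying.
have bi (u : R -> R) (N : R) : measurable_fun [set: R] u -> (forall y, `|u y| <= N) ->
    intg (fun y => poisson e (x - y) * u y).
  move=> mu' uN; under eq_fun do rewrite mulrC.
  exact: intg_bounded (pii _ e0) mu' uN.
have E : pi * c x = \int[mu]_y (poisson e (x - y) * c x).
  under Rint_ext do rewrite mulrC.
  by rewrite RintZ ?Rint_poisson//; [rewrite mulrC|exact: pii].
rewrite E /poisson_conv -RintB; [|exact: (bi (fun=> c x) M)|exact: bi mc cM].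
rewrite (@le_trans _ _ (\int[mu]_y (eta / (2 * pi) * poisson e (x - y) +
    C * e * poisson 1 (x - y))))//.
  apply: Rint_abs_le.
  - by apply: intgB; [exact: (bi (fun=> c x) M)|exact: bi mc cM].
  - by apply: intgD; apply: intgZ; exact: pii.
  - move=> y; rewrite -mulrBr normrM (ger0_norm (poisson_ge0 e0 _)).
    have p1 := poisson_ge0 (@ltr01 R) (x - y); have p0 := poisson_ge0 e0 (x - y).
    have [xy|xy] := ltP `|x - y| delta.
      rewrite -[leLHS]addr0 lerD//; last exact: mulr_ge0 (mulr_ge0 C0 (ltW e0)) p1.
      by rewrite mulrC ler_wpM2r//; exact: hd.
    rewrite -[leLHS]add0r lerD//; first exact: mulr_ge0 (ltW eta1) p0.
    have cc : `|c x - c y| <= 2 * M.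
      by rewrite (le_trans (ler_normB _ _))//; have := cM x; have := cM y; lra.
    rewrite (le_trans (ler_wpM2l p0 cc))// /C /poisson mulr1.
    rewrite [leRHS](_ : _ = (lorentz 1 (x - y) * (1 + delta ^- 2) * e) * (2 * M)); last by ring.
    rewrite ler_wpM2r ?mulr_ge0// ler_wpM2r ?(ltW e0)//.
    have z0 : 0 < (x - y) ^+ 2.
      by rewrite -(real_normK (num_real _)) exprn_gt0// (lt_le_trans delta0).
    have zd : delta ^+ 2 <= (x - y) ^+ 2.
      by rewrite -(real_normK (num_real (x - y))) lerXn2r ?nnegrE// ltW.
    rewrite /lorentz expr1n mulrC ler_pdivlMr; last by rewrite ltr_pwDl// sqr_ge0.
    rewrite mulrC ler_pdivrMr ?lorentz_den_gt0//.
    have d0 : 0 < delta ^+ 2 by rewrite exprn_gt0.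
    have ez : 0 <= e ^+ 2 by exact: sqr_ge0.
    have : 1 <= delta ^- 2 * (x - y) ^+ 2 by rewrite mulrC ler_pdivlMr// mul1r.
    have : 0 <= delta ^- 2 by rewrite invr_ge0 ltW.
    by move: (delta ^- 2) => q q0 qz; nra.
rewrite RintD; [|by apply: intgZ; exact: pii..].
rewrite !RintZ; [|exact: pii..]; rewrite !Rint_poisson// [leRHS]splitr lerD//.
  have gE (p : R) : 0 < p -> eta / (2 * p) * p = eta / 2.
    by move=> p0; field; rewrite gt_eqF.
  by rewrite gE.
by rewrite (le_trans _ hn)// mulrAC ler_norm.
Qed.

(** Approximants in L^2, with a single [M] bounding both the values and the support. Continuity is
    asked only almost everywhere, because the approximants built below are cut off sharply at -M and
    M. *)
Definition nice c := exists M : R, [/\ measurable_fun [set: R] c,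
  forall x, `|c x| <= M, forall x, M < `|x| -> c x = 0 &
  {ae mu, forall x, {for x, continuous c}}].

Lemma nice_square_integrable c : nice c -> square_integrable c.
Proof.
move=> [M [mc cM c0 _]].
have M0 : 0 <= M by rewrite (le_trans _ (cM 0)).
apply: (@square_integrable_decay _ _ (M ^+ 2 * (1 + M ^+ 2))) => // x.
rewrite ler_pdivlMr; last by rewrite ltr_pwDl// sqr_ge0.
have [Mx|xM] := ltP M `|x|.
  by rewrite c0// expr0n mul0r mulr_ge0 ?sqr_ge0// addr_ge0// sqr_ge0.
apply: ler_pM; [exact: sqr_ge0|by rewrite addr_ge0// sqr_ge0|..].
  by rewrite -(real_normK (num_real (c x))) lerXn2r ?nnegrE.
by rewrite lerD2l -(real_normK (num_real x)) lerXn2r ?nnegrE.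
Qed.

Lemma nice_intg c : nice c -> intg c.
Proof.
move=> nc; have c2 := nice_square_integrable nc; have [M [mc cM c0 _]] := nc.
have li := locally_integrable_itv (- M) M (square_integrable_locally c2).
have := intg_indic (measurable_itv _) li; congr (mu.-integrable _ (EFin \o _)).
apply/funext => x; rewrite indic_itvcc -ler_norml.
by have [_|Mx] := leP; rewrite ?mul1r// mul0r c0.
Qed.

Lemma nice_poisson_cvg c d : nice c -> nice d ->
  \int[mu]_x (d x * poisson_conv n.+1%:R^-1 c x) @[n --> \oo] -->
  pi * \int[mu]_x (d x * c x).
Proof.
move=> nc nd; have [M [mc cM _ cc]] := nc; have [md di] := (nice_square_integrable nd).
have M0 : 0 <= M by rewrite (le_trans _ (cM 0)).
have c2 := nice_square_integrable nc.
rewrite -RintZ; last exact: square_integrable_mul.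
have e0 n : 0 < n.+1%:R^-1 :> R by rewrite invr_gt0 ltr0n.
have [|||||_] // := @Rint_dominated _ (fun n x => d x * poisson_conv n.+1%:R^-1 c x)
  (fun x => pi * (d x * c x)) (fun x => (M * pi) * `|d x|).
- by move=> n; apply: measurable_funM => //; exact: mpoisson_conv.
- by apply: measurable_funM => //; exact: measurable_funM.
- apply: (ae_imp cc) => x cx; rewrite mulrCA; apply: cvgMr.
  exact: poisson_conv_cvg cx.
- by apply/intgZ/intg_norm; exact: nice_intg.
- move=> n x; rewrite normrM mulrC ler_wpM2r// -(Rint_poisson (e0 n) x) -RintZ; last first.
    by apply: decaying_intg; exact/decaying_shift/poisson_decaying.
  apply: Rint_abs_le; first exact: poisson_conv_intg.
    by apply/intgZ/decaying_intg; exact/decaying_shift/poisson_decaying.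
  move=> y; rewrite normrM (ger0_norm (poisson_ge0 _ _))// mulrC ler_wpM2r//.
  exact: poisson_ge0.
Qed.

(** Projection onto [-M, M] for M >= 0, in a form whose continuity is that of the absolute value. *)
Definition clamp (M y : R) : R := (`|y + M| - `|y - M|) / 2.

Lemma clamp_le (M y : R) : 0 <= M -> `|clamp M y| <= M.
Proof.
rewrite /clamp => M0; rewrite ler_norml.
have [a|a] := lerP 0 (y + M); have [b|b] := lerP 0 (y - M);
  by rewrite ?(ger0_norm a) ?(ltr0_norm a) ?(ger0_norm b) ?(ltr0_norm b); lra.
Qed.

(** Projection onto an interval does not increase the distance to a point of that interval. *)
Lemma clamp_dist_le (M v y : R) : `|v| <= M -> `|v - clamp M y| <= `|v - y|.
Proof.
rewrite ler_norml /clamp => /andP[v1 v2].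
have [a|a] := lerP 0 (y + M); have [b|b] := lerP 0 (y - M);
have [c|c] := lerP 0 (v - y);
  rewrite ?(ger0_norm a) ?(ltr0_norm a) ?(ger0_norm b) ?(ltr0_norm b)
  ?(ger0_norm c) ?(ltr0_norm c) ler_norml; lra.
Qed.

Lemma clamp_continuous (M : R) : continuous (clamp M).
Proof.
move=> y; apply: cvgMl; apply: cvgB; apply: cvg_norm.
  by apply: cvgD; [exact: cvg_id|exact: cvg_cst].
by apply: cvgB; [exact: cvg_id|exact: cvg_cst].
Qed.

Lemma cut_continuous (g : R -> R) (M x : R) : continuous g -> x != M -> x != - M ->
  {for x, continuous (fun y => \1_`[- M, M] y * g y)}.
Proof.
move=> cg xM xNM; have [Mx|] := ltP M `|x|.
  have nz : \forall y \near x, (fun=> 0) y = \1_`[- M, M] y * g y.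
    have : \forall y \near x, M < `|y|.
      have /(_ x) : continuous (fun y : R => `|y|) by exact: norm_continuous.
      by move=> /cvgrPdist_lt/(_ (`|x| - M)); rewrite subr_gt0 => /(_ Mx);
        apply: filterS => y /=; have := ler_norm (`|x| - `|y|); lra.
    apply: filterS => y My; rewrite indic_itvcc -ler_norml leNgt My.
    by rewrite mul0r.
  rewrite /prop_for /continuous_at -(nbhs_singleton nz).
  by apply: cvg_trans (near_eq_cvg nz) _; exact: cvg_cst.
rewrite ler_norml => /andP[x1 x2].
have nz : \forall y \near x, g y = \1_`[- M, M] y * g y.
  near=> y; rewrite indic_itvcc (_ : - M <= y <= M) ?mul1r//.
  apply/andP; split; near: y.
    by apply: lt_le_nbhsr; rewrite lt_neqAle eq_sym xNM.
  by apply: lt_le_nbhsl; rewrite lt_neqAle xM.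
rewrite /prop_for /continuous_at -(nbhs_singleton nz).
by apply: cvg_trans (near_eq_cvg nz) _; exact: cg.
Unshelve. all: by end_near. Qed.

(** Continuous functions approximate the truncation [hn n] in L^1. Clamping turns this into L^2
    approximation: both functions are then bounded by M, so the square of their difference is at
    most 2 M times the L^1 integrand. *)
Lemma nice_dense h (eta : R) : square_integrable h -> 0 < eta ->
  exists2 c, nice c & \int[mu]_x ((h x - c x) ^+ 2) <= eta.
Proof.
move=> [mh hi] eta0.
(* Truncation in position and in size at once, so that [hn n] is bounded with bounded support. The
   bound [n.+1] keeps M positive for the division by M below. *)
pose A n : set R := `[- n.+1%:R, n.+1%:R] `&` (h @^-1` `[- n.+1%:R, n.+1%:R]).
have mA n : measurable (A n).
  by apply: measurableI => //; rewrite -[X in measurable X]setTI; exact: mh.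
have AE n x : \1_(A n) x = ((`|x| <= n.+1%:R) && (`|h x| <= n.+1%:R))%R%:R :> R.
  rewrite indicE.
  suff -> : (x \in A n) = (`|x| <= n.+1%:R) && (`|h x| <= n.+1%:R) by [].
  apply/idP/idP.
    by rewrite inE => -[/=]; rewrite !in_itv/= -!ler_norml => -> ->.
  by move=> /andP[xn hxn]; rewrite inE; split; rewrite /= in_itv/= -ler_norml.
pose hn n x := \1_(A n) x * h x.
have mhn n : measurable_fun [set: R] (hn n).
  by apply: measurable_funM => //; exact: measurable_indic.
have hn_le n x : `|hn n x| <= n.+1%:R.
  rewrite /hn AE; have [/andP[_ ?]|_] := boolP ((`|x| <= n.+1%:R) && (`|h x| <= n.+1%:R));
    rewrite ?mul1r// mul0r normr0.
  exact: ler0n.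
have hnh n x : (h x - hn n x) ^+ 2 <= h x ^+ 2.
  rewrite /hn AE; case: (_ && _); rewrite ?mul1r ?subrr ?expr0n ?sqr_ge0//.
  by rewrite mul0r subr0.
have mhhn n : measurable_fun [set: R] (fun x => (h x - hn n x) ^+ 2).
  by apply: measurable_funX; exact: measurable_funB.
have [|||||_] // := @Rint_dominated _ (fun n x => (h x - hn n x) ^+ 2)
  (fun=> 0) (fun x => h x ^+ 2).
- apply: aeW => x; apply: cvg_near_cst; near=> n.
  have xn : `|x| <= n.+1%:R.
    by rewrite (@le_trans _ _ n%:R) ?ler_nat//; near: n; exact: nbhs_infty_ger.
  have hxn : `|h x| <= n.+1%:R.
    by rewrite (@le_trans _ _ n%:R) ?ler_nat//; near: n; exact: nbhs_infty_ger.
  by rewrite /hn AE xn hxn mul1r subrr expr0n.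
- by move=> n x; rewrite ger0_norm ?sqr_ge0.
rewrite Rint0 => /cvgr0Pnorm_le/(_ (eta / 4)) [|n _ /(_ n (leqnn n))].
  by rewrite divr_gt0.
rewrite ger0_norm; last by apply: Rintegral_ge0 => x _; exact: sqr_ge0.
set M : R := n.+1%:R => hhn.
have M0 : 0 < M by rewrite ltr0n.
pose E := `[- M, M]%classic.
have muE : (mu E < +oo)%E.
  by rewrite /E lebesgue_measure_itv; case: ifP => _; rewrite -?EFinD ltry.
have hE : mu.-integrable E (EFin \o hn n).
  apply: measurable_bounded_integrable => //.
  - exact: measurable_itv.
  - by apply: measurable_funTS; exact: mhn.
  - by exists M; split; rewrite ?num_real// => N MN x _ /=;
    exact: le_trans (hn_le n x) (ltW MN).
have [||g_ [cg gi gh]] := @approximation_continuous_integrable R E (hn n) _ _ hE.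
- exact: measurable_itv.
- exact: muE.
have {gh} : \int[mu]_(z in E) `|hn n z - g_ k z| @[k --> \oo] --> (0 : R).
  by move: gh => /fine_cvg.
move=> /cvgr0Pnorm_le/(_ (eta / (8 * M))) [|k _ /(_ k (leqnn k))].
  by rewrite divr_gt0// mulr_gt0.
rewrite ger0_norm; last exact: Rintegral_ge0.
move: (g_ k) (cg k) (gi k) => g {}cg {}gi hg.
pose c x := \1_E x * clamp M (g x).
have ccg : continuous (fun x => clamp M (g x)).
  by move=> x; apply: continuous_comp; [exact: cg|exact: (@clamp_continuous M)].
have mc : measurable_fun [set: R] c.
  apply: measurable_funM; first by apply: measurable_indic; exact: measurable_itv.
  exact: continuous_measurable_fun.
have E01 x : \1_E x = (`|x| <= M)%R%:R :> R by rewrite indic_itvcc ler_norml.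
have nc : nice c.
  exists M; split => //.
  - move=> x; rewrite /c E01; have [_|_] := leP `|x| M.
      by rewrite mul1r clamp_le// ltW.
    by rewrite mul0r normr0 ltW.
  - by move=> x Mx; rewrite /c E01 leNgt Mx mul0r.
  - exists [set M; - M]; split.
    + by apply: measurableU; exact: measurable_set1.
    + rewrite measureU0//; try exact: measurable_set1; exact: lebesgue_measure_set1.
    + move=> x /=; apply: contra_notP => /not_orP[/eqP xM /eqP xNM].
      exact: cut_continuous.
exists c => //.
have c2 := nice_square_integrable nc.
have hg_i : intg (fun x => \1_E x * `|hn n x - g x|).
  apply: intg_indic; first exact: measurable_itv.
  by apply: integrable_norm; have := @integrableB _ _ _ mu E (measurable_itv _) _ _ hE gi.
(* From (p + q)^2 <= 2 p^2 + 2 q^2 and [k1]. The tolerances eta/4 and eta/(8 M) chosen above are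
   multiplied by 2 and by 4 M, and so give eta/2 each. *)
rewrite (@le_trans _ _ (\int[mu]_x (2 * (h x - hn n x) ^+ 2 +
   (4 * M) * (\1_E x * `|hn n x - g x|))))//.
  apply: Rint_le.
  - by have [] := square_integrableB (conj mh hi) c2.
  - apply: intgD; apply: intgZ => //; apply: (@intg_le _ _ (fun x => h x ^+ 2)) => //.
    by move=> x; rewrite ger0_norm ?sqr_ge0.
  - move=> x.
    have k1 : (hn n x - c x) ^+ 2 <= 2 * M * (\1_E x * `|hn n x - g x|).
      rewrite /c E01; case: (boolP (`|x| <= M)) => [xM|/negbTE xM]; last first.
        by rewrite !mul0r mulr0 subr0 /hn AE -/M xM mul0r expr0n.
      rewrite !mul1r -(real_normK (num_real _)) expr2 ler_pM//.
        rewrite (le_trans (ler_normB _ _))// mulr_natl mulr2n lerD//.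
        by apply: clamp_le; exact: ltW.
      exact: clamp_dist_le.
    have := sqr_ge0 ((h x - hn n x) - (hn n x - c x)).
    by move: k1; set p := \1_E x * _; set q := hn n x; set r := c x; set s := h x; nra.
have hhn_i : intg (fun x => (h x - hn n x) ^+ 2).
  apply: (@intg_le _ _ (fun x => h x ^+ 2)) => //.
  by move=> x; rewrite ger0_norm ?sqr_ge0.
rewrite RintD; [|exact: intgZ..]; rewrite !RintZ//.
rewrite -Rint_indic.
have h1 : 2 * \int[mu]_x ((h x - hn n x) ^+ 2) <= eta / 2 by lra.
have h2 : 4 * M * \int[mu]_(x in E) `|hn n x - g x| <= eta / 2.
  have -> : eta / 2 = 4 * M * (eta / (8 * M)) by field; rewrite gt_eqF.
  by rewrite ler_wpM2l// mulr_ge0// ltW.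
lra.
Unshelve. all: by end_near. Qed.

Lemma dist_chain (eta a b c d a' b' : R) : `|a - b| <= eta / 5 ->
  `|a' - b'| <= eta / 5 -> `|b - c| <= eta / 5 -> `|b' - d| <= eta / 5 ->
  `|c - d| <= eta / 5 -> `|a - a'| <= eta.
Proof.
have -> : a - a' = (a - b) - (a' - b') + (b - c) - (b' - d) + (c - d) by ring.
move: (a - b) (a' - b') (b - c) (b' - d) (c - d) => x1 x2 x3 x4 x5 h1 h2 h3 h4 h5.
rewrite [eta](_ : _ = eta / 5 + eta / 5 + eta / 5 + eta / 5 + eta / 5); last by field.
rewrite (le_trans (ler_normD _ _))// lerD// (le_trans (ler_normB _ _))// lerD//.
by rewrite (le_trans (ler_normD _ _))// lerD// (le_trans (ler_normB _ _))// lerD.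
Qed.

(** Density argument in five steps of eta/5: [g] is replaced by [d], then [h] by [c], both in the
    Poisson pairing and in its limit, and the nice pair converges. The tolerance for [c] is chosen
    after [d], since it is measured against [d]. *)
Lemma poisson_weak_cvg g h : square_integrable g -> square_integrable h ->
  \int[mu]_x (g x * poisson_conv n.+1%:R^-1 h x) @[n --> \oo] -->
  pi * \int[mu]_x (g x * h x).
Proof.
move=> g2 h2; apply/cvgrPdist_le => eta eta0.
have eta5 : 0 < eta / 5 by rewrite divr_gt0.
have [k1 k10 hk1] := small_pairing h2 eta5.
have [d nd dg] := nice_dense g2 k10.
have d2 := nice_square_integrable nd.
have [k2 k20 hk2] := small_pairing d2 eta5.
have [c nc ch] := nice_dense h2 k20.
have c2 := nice_square_integrable nc.
have [s1 s2] := hk1 _ (square_integrableB g2 d2) dg.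
have [r1 r2] := hk2 _ (square_integrableB h2 c2) ch.
have /cvgrPdist_le/(_ _ eta5) := nice_poisson_cvg nc nd.
apply: filterS => n dc.
set e := n.+1%:R^-1 in dc *; have e0 : 0 < e by rewrite invr_gt0 ltr0n.
have [{}s2 _] := s2 e e0; have [_ {}r2] := r2 e e0.
have [dh_i _] := poisson_schur e0 ltr01 d2 h2.
have [gh_i _] := poisson_schur e0 ltr01 g2 h2.
have [dc_i _] := poisson_schur e0 ltr01 d2 c2.
have E1 : \int[mu]_x ((g x - d x) * poisson_conv e h x) =
   \int[mu]_x (g x * poisson_conv e h x) - \int[mu]_x (d x * poisson_conv e h x).
  by rewrite -RintB//; apply: Rint_ext => x; rewrite mulrBl.
have E2 : \int[mu]_x (d x * poisson_conv e (fun x => h x - c x) x) =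
   \int[mu]_x (d x * poisson_conv e h x) - \int[mu]_x (d x * poisson_conv e c x).
  rewrite -RintB//; apply: Rint_ext => x; rewrite -mulrBr; congr (_ * _).
  rewrite /poisson_conv -RintB; [|exact: poisson_conv_intg..].
  by apply: Rint_ext => y; rewrite mulrBr.
have E3 : \int[mu]_x ((g x - d x) * h x) =
   \int[mu]_x (g x * h x) - \int[mu]_x (d x * h x).
  rewrite -RintB; [|exact: square_integrable_mul..].
  by apply: Rint_ext => x; rewrite mulrBl.
have E4 : \int[mu]_x ((h x - c x) * d x) =
   \int[mu]_x (d x * h x) - \int[mu]_x (d x * c x).
  rewrite -RintB; [|exact: square_integrable_mul..].
  by apply: Rint_ext => x; rewrite mulrBl ![d x * _]mulrC.
rewrite E1 in s2; rewrite E2 in r2; rewrite E3 in s1; rewrite E4 in r1.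
rewrite mulrBr in s1; rewrite mulrBr in r1.
exact: dist_chain s1 s2 r1 r2 dc.
Qed.

End poisson_approximation.

(** * The commutator of the kernel Q_e with an affine field *)

Section poisson_commutator.
Set Implicit Arguments.
Unset Strict Implicit.
Context {R : realType}.
Local Notation mu := (@lebesgue_measure R).
Local Notation intg f := (mu.-integrable [set: R] (EFin \o f)).
Local Notation intg2 k := ((mu \x mu)%E.-integrable [set: R * R] (EFin \o k)).
Implicit Types f g h a b k : R -> R.

Definition vanishes_beyond (N : R) f := forall x, N < `|x| -> f x = 0.

Lemma maffine (al be : R) : measurable_fun [set: R] (fun x => al * x + be).
Proof. by apply: measurable_funD => //; exact: measurable_funM. Qed.

Lemma affine_square_integrable a (N al be : R) : square_integrable a ->
  vanishes_beyond N a -> square_integrable (fun x => (al * x + be) * a x).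
Proof.
move=> a2 aN; have [ma _] := a2.
have m0 : measurable_fun [set: R] (fun=> `|al| * N + `|be| : R) by [].
apply: (@square_integrable_le _ _ (fun x => (`|al| * N + `|be|) * a x)).
- by apply: measurable_funM => //; exact: maffine.
- move=> x; have [xN|Nx] := leP `|x| N; last by rewrite aN// !mulr0.
  rewrite !normrM ler_wpM2r// (le_trans (ler_normD _ _))// normrM.
  by rewrite (le_trans _ (ler_norm _))// lerD2r ler_wpM2l.
- exact: (square_integrable_bounded (M := `| `|al| * N + `|be| |) a2 m0).
Qed.

Lemma affine_vanishes a (N al be : R) : vanishes_beyond N a ->
  vanishes_beyond N (fun x => (al * x + be) * a x).
Proof. by move=> aN x Nx; rewrite aN// mulr0. Qed.

(** The weight 1 + x^2 is the price of Peetre's inequality; bounded support pays for it. *)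
Lemma vanishing_intg a N : square_integrable a -> vanishes_beyond N a ->
  intg (fun x => (1 + x ^+ 2) * `|a x|).
Proof.
move=> a2 aN; have [ma _] := a2.
have li := locally_integrable_itv (- N) N (square_integrable_locally a2).
apply: (@intg_le _ _ (fun x => (1 + N ^+ 2) * `|\1_`[- N, N] x * a x|)).
- apply: measurable_funM; last exact: measurableT_comp.
  by apply: measurable_funD => //; exact: measurable_funX.
- move=> x; rewrite normrM normr_id; have [xN|Nx] := leP `|x| N; last first.
    by rewrite aN// mulr0 normr0 !mulr0.
  rewrite indic_itvcc -ler_norml xN mul1r ler_wpM2r//.
  rewrite ger0_norm ?addr_ge0 ?sqr_ge0// lerD2l -(real_normK (num_real x)).
  by rewrite lerXn2r ?nnegrE// (le_trans _ xN).
- by apply/intgZ/intg_norm/intg_indic => //; exact: measurable_itv.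
Qed.

Lemma intg_of_vanishing a N : square_integrable a -> vanishes_beyond N a -> intg a.
Proof.
move=> a2 aN; apply: intg_le (vanishing_intg a2 aN); first exact: a2.1.
by move=> x; rewrite ler_peMl// lerDl sqr_ge0.
Qed.

(** Fubini in spite of the growth of the field: by Peetre's inequality the decay of k(x - y) becomes
    (1 + y^2)^-1, which makes the affine factor square integrable, while the loss 1 + x^2 falls on
    [a]. The integrability claims let the integrals be combined linearly later. *)
Lemma conv_swap k a b (N al be : R) : decaying k -> square_integrable a ->
  vanishes_beyond N a -> square_integrable b ->
  [/\ forall x, intg (fun y => (al * y + be) * (k (x - y) * b y)),
   intg (fun x => a x * \int[mu]_y ((al * y + be) * (k (x - y) * b y))),
   intg (fun y => ((al * y + be) * b y) * \int[mu]_x (k (x - y) * a x)) &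
   \int[mu]_x (a x * \int[mu]_y ((al * y + be) * (k (x - y) * b y))) =
   \int[mu]_y (((al * y + be) * b y) * \int[mu]_x (k (x - y) * a x))].
Proof.
move=> dk a2 aN b2; have [mk [C C0 kC]] := dk.
have [[ma _] [mb _]] := (a2, b2).
pose K (z : R * R) := a z.1 * ((al * z.2 + be) * (k (z.1 - z.2) * b z.2)).
have mk2 : measurable_fun [set: R * R] (fun z : R * R => k (z.1 - z.2)).
  apply: measurableT_comp => //.
  by apply: measurable_funB; [exact: measurable_fst|exact: measurable_snd].
have mK : measurable_fun [set: R * R] K.
  apply: measurable_funM; first by apply: measurableT_comp => //; exact: measurable_fst.
  apply: measurable_funM.
    by apply: measurable_funD => //; apply: measurable_funM.
  by apply: measurable_funM => //; apply: measurableT_comp => //; exact: measurable_snd.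
have dD : decaying (fun y : R => (1 + y ^+ 2)^-1).
  split; first exact: intg_measurable (@intg_oneDsqrV R).
  by exists 1 => // x; rewrite mul1r ger0_norm// ltW// oneDsqrV_gt0.
have i1 : intg (fun x => 2 * C * ((1 + x ^+ 2) * `|a x|)).
  by apply: intgZ; exact: vanishing_intg aN.
have i2 : intg (fun y => `|(al * y + be) * (1 + y ^+ 2)^-1 * b y|).
  apply: intg_norm; apply: square_integrable_mul => //.
  exact: affine_decaying_square_integrable.
have Ki : intg2 K.
  apply: integrable_prod mK i1 i2 _ => x y; rewrite /K /= !normrM.
  rewrite [leRHS](_ : _ = `|a x| * (`|al * y + be| *
     (2 * C * (1 + x ^+ 2) * (1 + y ^+ 2)^-1 * `|b y|))); last first.
    by rewrite (ger0_norm (ltW (oneDsqrV_gt0 y))); ring.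
  do 2 rewrite ler_wpM2l//; rewrite ler_wpM2r//.
  exact: decaying_shift_le.
have i0 x : intg (fun y => (al * y + be) * (k (x - y) * b y)).
  have h : square_integrable (fun y => (al * y + be) * k (x - y)).
    exact/affine_decaying_square_integrable/decaying_shift.
  by have := square_integrable_mul h b2; under eq_fun do rewrite -mulrA.
have KE x : \int[mu]_y K (x, y) =
    a x * \int[mu]_y ((al * y + be) * (k (x - y) * b y)).
  by rewrite /K /= RintZ.
have ai := intg_of_vanishing a2 aN.
have j0 y : intg (fun x => k (x - y) * a x).
  apply: (@intg_bounded _ _ _ C ai).
    by apply: measurableT_comp => //; exact: measurable_funB.
  by move=> x; rewrite (le_trans (kC _))// -[leRHS]mulr1 ler_wpM2l// oneDsqrV_le1.
have KE' y : \int[mu]_x K (x, y) =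
    ((al * y + be) * b y) * \int[mu]_x (k (x - y) * a x).
  by rewrite -RintZ//; apply: Rint_ext => x; rewrite /K /=; ring.
split.
- exact: i0.
- by have := intg_fubini Ki; under eq_fun do rewrite KE.
- have mK' : measurable_fun [set: R * R] (fun z : R * R => K (z.2, z.1)).
    by apply: measurableT_comp => //; exact: measurable_swap.
  have Ki' : intg2 (fun z : R * R => K (z.2, z.1)).
    apply/(@integrable21ltyP _ _ _ _ R mu mu).
      exact/measurable_EFinP.
    by have /(@integrable12ltyP _ _ _ _ R mu mu) := Ki; apply; exact/measurable_EFinP.
  by have := intg_fubini Ki'; under eq_fun do rewrite KE'.
- under Rint_ext do rewrite -KE; rewrite (Rint_fubini Ki).
  by under Rint_ext do rewrite KE'.
Qed.

Lemma conv_swap1 k a b (N : R) : decaying k -> square_integrable a ->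
  vanishes_beyond N a -> square_integrable b ->
  [/\ forall x, intg (fun y => k (x - y) * b y),
   intg (fun x => a x * \int[mu]_y (k (x - y) * b y)),
   intg (fun y => b y * \int[mu]_x (k (x - y) * a x)) &
   \int[mu]_x (a x * \int[mu]_y (k (x - y) * b y)) =
   \int[mu]_y (b y * \int[mu]_x (k (x - y) * a x))].
Proof.
move=> dk a2 aN b2; have [h1 h2 h3 h4] := conv_swap 0 1 dk a2 aN b2.
have E x : \int[mu]_y ((0 * y + 1) * (k (x - y) * b y)) = \int[mu]_y (k (x - y) * b y).
  by apply: Rint_ext => y; rewrite mul0r add0r mul1r.
split.
- by move=> x; have := h1 x; under eq_fun do rewrite mul0r add0r mul1r.
- by move: h2; under eq_fun do rewrite E.
- by move: h3; under eq_fun do rewrite mul0r add0r mul1r.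
- under Rint_ext do rewrite -E; rewrite h4; apply: Rint_ext => y.
  by rewrite mul0r add0r mul1r.
Qed.

Lemma decaying_shiftl k y : decaying k -> decaying (fun x => k (x - y)).
Proof.
move=> [mk [C C0 kC]].
have dk : decaying (fun x => k (- x)).
  split; first by apply: measurableT_comp => //; exact: oppr_measurable.
  by exists C => // x; rewrite -(sqrrN x).
have := decaying_shift y dk; congr decaying.
by apply/funext => x; rewrite opprB.
Qed.

Lemma smooth_shiftl k y : smooth k -> smooth (fun x => k (x - y)).
Proof.
move=> sk; rewrite (_ : (fun x => _) = (fun x => k (1 * x + - y))).
  exact: smooth_comp_affine.
by apply/funext => x; rewrite mul1r.
Qed.

Lemma isd_shiftl k (x y dk : R) : is_derive (x - y) 1 k dk ->
  is_derive x 1 (fun x => k (x - y)) dk.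
Proof.
rewrite (_ : (fun x => _) = (fun x => k (1 * x + - y))); last first.
  by apply/funext => z; rewrite mul1r.
rewrite -[x in is_derive (x - y)]mul1r => h.
by apply: is_derive_eq (isd_comp_affine h) _; rewrite mulr1.
Qed.

(** [weak_derivative_by_parts] for the function (al x + be) k(x): the quadratic decay of [k] and
    [dk] absorbs the linear growth, so this function and its derivative are square integrable. *)
Lemma by_parts_affine f df k dk (al be : R) : weak_derivative f df ->
  square_integrable f -> square_integrable df ->
  smooth k -> (forall x : R, is_derive x 1 k (dk x)) -> decaying k -> decaying dk ->
  \int[mu]_x ((al * x + be) * (k x * df x)) =
  - \int[mu]_x (al * (k x * f x) + (al * x + be) * (dk x * f x)).
Proof.
move=> fdf f2 df2 sk kd dk0 ddk.
pose g x := (al * x + be) * k x.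
have gd (x : R) : is_derive x 1 g (al * k x + (al * x + be) * dk x).
  by apply: isdM; exact: isd_affine.
have dg := isd_derive1 gd.
have k2 : square_integrable (fun x => al * k x).
  exact/decaying_square_integrable/decayingZ.
have h : \int[mu]_x (f x * derive1 g x) = - \int[mu]_x (df x * g x).
  apply: weak_derivative_by_parts => //.
  - by apply: smoothM => //; exact: smooth_affine.
  - exact: affine_decaying_square_integrable.
  - rewrite dg; apply: square_integrableD => //.
    exact: affine_decaying_square_integrable.
transitivity (\int[mu]_x (df x * g x)); first by apply: Rint_ext => x; rewrite /g; ring.
rewrite -[LHS]opprK -h; congr (- _); apply: Rint_ext => x.
by rewrite dg; ring.
Qed.

Lemma by_parts_decaying f df k dk : weak_derivative f df ->
  square_integrable f -> square_integrable df ->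
  smooth k -> (forall x : R, is_derive x 1 k (dk x)) -> decaying k -> decaying dk ->
  \int[mu]_x (k x * df x) = - \int[mu]_x (dk x * f x).
Proof.
move=> fdf f2 df2 sk kd dk0 ddk.
have := by_parts_affine 0 1 fdf f2 df2 sk kd dk0 ddk.
under Rint_ext do rewrite mul0r add0r mul1r.
by under [in RHS]Rint_ext do rewrite !mul0r !add0r mul1r.
Qed.

Lemma commutator_algebra (a c A B D J X : R) :
  J = - X -> 2 * a * A + (B - D) = - (c * J) ->
  - (a * A + B) + - (a * A - D) = - (c * X).
Proof. by move=> -> E; lra. Qed.

Section height.
Variables (e al be N : R) (u du w dw : R -> R).
Hypotheses (e0 : 0 < e) (u2 : square_integrable u) (du2 : square_integrable du)
  (w2 : square_integrable w) (dw2 : square_integrable dw)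
  (udu : weak_derivative u du) (wdw : weak_derivative w dw)
  (wN : vanishes_beyond N w) (dwN : vanishes_beyond N dw).

Local Notation Q := (poisson_height e).
Local Notation dQ := (dpoisson_height e).
Local Notation dP := (dpoisson e).
Local Notation d2P := (d2poisson e).

Let Qd := poisson_height_decaying e0.
Let dQd := dpoisson_height_decaying e0.
Let Pd := poisson_decaying e0.
Let dPd := dpoisson_decaying e0.
Let d2Pd := d2poisson_decaying e0.

(** After exchanging the integrals, the x-integral is the inner one and the derivative of [w] moves
    onto X(x) Q(x - y). *)
Lemma commutator_term1 :
  \int[mu]_x ((al * x + be) * dw x * \int[mu]_y (Q (x - y) * u y)) =
  - (al * \int[mu]_x (w x * \int[mu]_y (Q (x - y) * u y)) +
    \int[mu]_x ((al * x + be) * w x * \int[mu]_y (dQ (x - y) * u y))).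
Proof.
have Xdw2 := affine_square_integrable al be dw2 dwN.
have XdwN := affine_vanishes al be dwN.
have Xw2 := affine_square_integrable al be w2 wN.
have XwN := affine_vanishes al be wN.
have [_ _ _ ->] := conv_swap1 Qd Xdw2 XdwN u2.
have [_ _ i1 ->] := conv_swap1 Qd w2 wN u2.
have [_ _ i2 ->] := conv_swap1 dQd Xw2 XwN u2.
rewrite -RintZ// -RintD//; last exact: intgZ.
rewrite -RintN; last by apply: intgD => //; exact: intgZ.
apply: Rint_ext => y.
have Qs := @smooth_shiftl _ y (poisson_height_smooth e0).
have Qi (x : R) : is_derive x 1 (fun x => Q (x - y)) (dQ (x - y)).
  exact/isd_shiftl/poisson_height_isd.
have Qy := decaying_shiftl y Qd; have dQy := decaying_shiftl y dQd.
have h := by_parts_affine al be wdw w2 dw2 Qs Qi Qy dQy.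
have j1 : intg (fun x => Q (x - y) * w x).
  exact: square_integrable_mul (decaying_square_integrable Qy) w2.
have j2 : intg (fun x => dQ (x - y) * ((al * x + be) * w x)).
  exact: square_integrable_mul (decaying_square_integrable dQy) Xw2.
rewrite (@Rint_ext _ _ (fun x => (al * x + be) * (Q (x - y) * dw x))); last first.
  by move=> x; ring.
rewrite h mulrN; congr (- _); rewrite [X in _ = X + _]mulrCA -mulrDr; congr (_ * _).
rewrite -RintZ// -RintD//; last exact: intgZ.
by apply: Rint_ext => x; ring.
Qed.

(** The evenness of Q gives both terms the kernel Q(x - y). Here the integration by parts is in y,
    where differentiating Q(x - y) produces -dQ: this is the sign that makes X(x) - X(y) appear in
    the sum. *)
Lemma commutator_term2 :
  \int[mu]_y ((al * y + be) * du y * \int[mu]_x (Q (y - x) * w x)) =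
  - (al * \int[mu]_x (w x * \int[mu]_y (Q (x - y) * u y)) -
    \int[mu]_x (w x * \int[mu]_y ((al * y + be) * (dQ (x - y) * u y)))).
Proof.
transitivity (\int[mu]_y ((al * y + be) * du y * \int[mu]_x (Q (x - y) * w x))).
  apply: Rint_ext => y; congr (_ * _); apply: Rint_ext => x.
  by rewrite -poisson_heightN opprB.
have [_ _ _ <-] := conv_swap al be Qd w2 wN du2.
have [k1 i1 _ _] := conv_swap1 Qd w2 wN u2.
have [k2 i2 _ _] := conv_swap al be dQd w2 wN u2.
rewrite -RintZ// -RintB//; last exact: intgZ.
rewrite -RintN; last by apply: intgB => //; exact: intgZ.
apply: Rint_ext => x.
have Qs := @smooth_shift _ _ x (poisson_height_smooth e0).
have Qi (y : R) : is_derive y 1 (fun y => Q (x - y)) (- 1 * dQ (x - y)).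
  by rewrite mulN1r; exact/isd_shift/poisson_height_isd.
have Qx := decaying_shift x Qd.
have dQx := decayingZ (- 1) (decaying_shift x dQd).
rewrite (by_parts_affine al be udu u2 du2 Qs Qi Qx dQx) mulrN; congr (- _).
rewrite [X in _ = X - _]mulrCA -mulrBr; congr (_ * _).
rewrite -RintZ// -RintB//; last exact: intgZ.
by apply: Rint_ext => y; ring.
Qed.

(** One derivative of P'' goes to [u] through the variable y, the other to [w] through x. What
    remains is the kernel P itself, of mass pi, so the factor [e] in front is not spent on a
    singular kernel. *)
Lemma d2poisson_pairing :
  \int[mu]_x (w x * \int[mu]_y (d2P (x - y) * u y)) =
  - \int[mu]_x (dw x * poisson_conv e du x).
Proof.
transitivity (\int[mu]_x (w x * \int[mu]_y (dP (x - y) * du y))).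
  apply: Rint_ext => x; congr (_ * _).
  have Ps := @smooth_shift _ _ x (dpoisson_smooth e0).
  have Pi (y : R) : is_derive y 1 (fun y => dP (x - y)) (- 1 * d2P (x - y)).
    by rewrite mulN1r; exact/isd_shift/dpoisson_isd.
  have dPx := decayingZ (- 1) (decaying_shift x d2Pd).
  rewrite (by_parts_decaying udu u2 du2 Ps Pi (decaying_shift x dPd) dPx).
  have k2 : intg (fun y => d2P (x - y) * u y).
    exact: square_integrable_mul (decaying_square_integrable (decaying_shift x d2Pd)) u2.
  rewrite -RintN; last by have := intgZ (- 1) k2; under eq_fun do rewrite mulrA.
  by apply: Rint_ext => y; ring.
have [_ _ _ ->] := conv_swap1 dPd w2 wN du2.
have [_ _ i1 E] := conv_swap1 Pd dw2 dwN du2.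
rewrite /poisson_conv E -RintN//; apply: Rint_ext => y; rewrite -mulrN.
congr (_ * _).
have Ps := @smooth_shiftl _ y (poisson_smooth e0).
have Pi (x : R) : is_derive x 1 (fun x => poisson e (x - y)) (dP (x - y)).
  exact/isd_shiftl/poisson_isd.
rewrite (by_parts_decaying wdw w2 dw2 Ps Pi (decaying_shiftl y Pd) (decaying_shiftl y dPd)).
by rewrite opprK.
Qed.

(* Integrating by parts moves both derivatives onto the kernel, where only the
   dilation part of the affine field survives, in the form 2 Q + z Q' = - e P''. *)
Lemma poisson_height_commutator :
  \int[mu]_x ((al * x + be) * dw x * \int[mu]_y (Q (x - y) * u y)) +
  \int[mu]_y ((al * y + be) * du y * \int[mu]_x (Q (y - x) * w x)) =
  - (al * e * \int[mu]_x (dw x * poisson_conv e du x)).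
Proof.
rewrite commutator_term1 commutator_term2.
have Xw2 := affine_square_integrable al be w2 wN.
have XwN := affine_vanishes al be wN.
have [k1 i1 _ _] := conv_swap1 Qd w2 wN u2.
have [k2 i2 _ _] := conv_swap al be dQd w2 wN u2.
have [k3 i3 _ _] := conv_swap1 dQd Xw2 XwN u2.
have [k4 i4 _ _] := conv_swap1 d2Pd w2 wN u2.
(* Under the integrals the two terms in dQ combine with the factor X(x) - X(y) = al (x - y), in
   which [be] cancels, and [poisson_height_homogeneous] applies at z = x - y. *)
have E : 2 * al * \int[mu]_x (w x * \int[mu]_y (Q (x - y) * u y)) +
  (\int[mu]_x ((al * x + be) * w x * \int[mu]_y (dQ (x - y) * u y)) -
   \int[mu]_x (w x * \int[mu]_y ((al * y + be) * (dQ (x - y) * u y)))) =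
  - (al * e * \int[mu]_x (w x * \int[mu]_y (d2P (x - y) * u y))).
  rewrite -mulNr -!RintZ// -RintB// -RintD//; [|exact: intgZ|exact: intgB].
  apply: Rint_ext => x.
  rewrite [LHS](_ : _ = w x * (2 * al * \int[mu]_y (Q (x - y) * u y) +
    ((al * x + be) * \int[mu]_y (dQ (x - y) * u y) -
     \int[mu]_y ((al * y + be) * (dQ (x - y) * u y))))); last by ring.
  rewrite [RHS]mulrCA; congr (_ * _).
  rewrite -!RintZ// -RintB//; last exact: intgZ.
  rewrite -RintD//; [|exact: intgZ|by apply: intgB => //; exact: intgZ].
  apply: Rint_ext => y.
  have := poisson_height_homogeneous e0 (x - y).
  move: (Q _) (dQ _) (d2P _) => q dq p; move/(congr1 (fun t => al * u y * t)) => E.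
  by transitivity (al * u y * (2 * q + (x - y) * dq)); [ring|rewrite E; ring].
exact: commutator_algebra d2poisson_pairing E.
Qed.

End height.
End poisson_commutator.

(** * The half-Laplacian far from the support *)

Section far_field.
Set Implicit Arguments.
Unset Strict Implicit.
Context {R : realType}.
Local Notation mu := (@lebesgue_measure R).
Local Notation intg f := (mu.-integrable [set: R] (EFin \o f)).
Variables (N : R) (w Lw : R -> R).
Hypotheses (N0 : 0 < N) (w2 : square_integrable w) (wN : vanishes_beyond N w)
  (Lw2 : square_integrable Lw) (hLw : half_laplacian w Lw).

Let M := 2 * N.
Let M0 : 0 < M. Proof. by rewrite mulr_gt0. Qed.
Let eps (n : nat) : R := n.+1%:R^-1.
Let eps0 n : 0 < eps n. Proof. by rewrite invr_gt0 ltr0n. Qed.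
Let W := \int[mu]_y `|w y|.
Let W0 : 0 <= W. Proof. exact: Rintegral_ge0. Qed.
Let C := 4 * (1 + M ^- 2).
Let C0 : 0 <= C. Proof. by rewrite mulr_ge0// addr_ge0// invr_ge0 sqr_ge0. Qed.
Let wi : intg w. Proof. exact: intg_of_vanishing wN. Qed.

(** Written as a difference so that splitting a function into its inner and outer parts is a ring
    identity. *)
Definition outside (x : R) : R := 1 - \1_`[- M, M] x.

Lemma outsideE x : outside x = (M < `|x|)%R%:R.
Proof.
rewrite /outside indic_itvcc -ler_norml ltNge.
by case: (`|x| <= M); rewrite ?subrr ?subr0.
Qed.

Lemma moutside : measurable_fun [set: R] outside.
Proof. by apply: measurable_funB => //; exact: measurable_indic. Qed.

Lemma outside_le1 x : `|outside x| <= 1.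
Proof. by rewrite outsideE; case: (_ < _); rewrite ?normr1// normr0. Qed.

(** As M = 2 N, the points satisfy |x - y| >= |x|/2, whence the factor 4 in [C]; the factor 1 + M^-2
    compares x^2 with 1 + x^2 for |x| > M. *)
Lemma far_le (x y : R) : M < `|x| -> `|y| <= N -> ((x - y) ^+ 2)^-1 <= C * (1 + x ^+ 2)^-1.
Proof.
move=> Mx yN.
have x0 : 0 < `|x| by rewrite (lt_trans M0).
have xy : `|x| / 2 <= `|x - y|.
  have := ler_normD (x - y) y; rewrite subrK.
  by move: Mx; rewrite /M; lra.
have xy2 : x ^+ 2 / 4 <= (x - y) ^+ 2.
  rewrite -(real_normK (num_real x)) -(real_normK (num_real (x - y))).
  rewrite (_ : `|x| ^+ 2 / 4 = (`|x| / 2) ^+ 2); last by field.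
  by rewrite lerXn2r ?nnegrE// divr_ge0.
have x2 : 0 < x ^+ 2 by rewrite -(real_normK (num_real x)) exprn_gt0.
have xyp : 0 < (x - y) ^+ 2 by rewrite (lt_le_trans _ xy2)// divr_gt0.
rewrite ler_pdivlMr; last by rewrite ltr_pwDl// ltW.
rewrite mulrC ler_pdivrMr// (le_trans _ (ler_wpM2l C0 xy2))//.
rewrite /C (_ : _ * _ * _ = (1 + M ^- 2) * x ^+ 2); last by field; rewrite gt_eqF.
rewrite mulrDl mul1r addrC lerD2l mulrC ler_pdivlMr ?exprn_gt0// mul1r.
by rewrite -(real_normK (num_real x)) lerXn2r ?nnegrE ?(ltW M0) ?(ltW Mx).
Qed.

Lemma far_conv_le (q : R -> R) x : M < `|x| -> measurable_fun [set: R] (fun y => q y * w y) ->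
  (forall y, `|y| <= N -> `|q y| <= ((x - y) ^+ 2)^-1) ->
  [/\ forall y, `|q y * w y| <= C * (1 + x ^+ 2)^-1 * `|w y|,
   intg (fun y => q y * w y) &
   `|\int[mu]_y (q y * w y)| <= C * W * (1 + x ^+ 2)^-1].
Proof.
move=> Mx mq qle.
have h y : `|q y * w y| <= C * (1 + x ^+ 2)^-1 * `|w y|.
  have [yN|Ny] := leP `|y| N; last by rewrite wN// mulr0 normr0 mulr0.
  by rewrite normrM ler_wpM2r// (le_trans (qle _ yN))// far_le.
have i : intg (fun y => C * (1 + x ^+ 2)^-1 * `|w y|) by exact/intgZ/intg_norm.
have qi : intg (fun y => q y * w y) by exact: intg_le i.
split => //; rewrite (le_trans (Rint_abs_le qi i h))//.
by rewrite RintZ; [rewrite mulrAC|exact: intg_norm].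
Qed.

Lemma poisson_height_far_le (e z : R) : 0 < e -> z != 0 -> `|poisson_height e z| <= (z ^+ 2)^-1.
Proof.
move=> e0 z0; have z2 : 0 < z ^+ 2 by rewrite exprn_even_gt0.
have D0 := lorentz_gt0 e0 z.
have Dz : lorentz e z <= (z ^+ 2)^-1.
  by rewrite lef_pV2 ?posrE// ?lorentz_den_gt0// lerDr sqr_ge0.
have eD : 0 <= e ^+ 2 * lorentz e z <= 1.
  rewrite mulr_ge0 ?sqr_ge0 ?(ltW D0)//= ler_pdivrMr ?lorentz_den_gt0//.
  by rewrite mul1r lerDl sqr_ge0.
rewrite /poisson_height normrM (gtr0_norm D0) -[leRHS]mulr1 ler_pM//; first exact: ltW.
by rewrite -mulrA ler_norml; case/andP: eD => ? ?; apply/andP; split; lra.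
Qed.

(** The limit -1/z^2 is, up to the factor pi, the off-diagonal kernel of the half-Laplacian. *)
Lemma poisson_height_cvg (z : R) : z != 0 ->
  poisson_height (eps n) z @[n --> \oo] --> - (z ^+ 2)^-1.
Proof.
move=> z0; have h : eps n @[n --> \oo] --> (0 : R) by exact: cvg_harmonic.
have h2 : eps n * eps n + z ^+ 2 @[n --> \oo] --> 0 * 0 + z ^+ 2.
  by apply: cvgD; [exact: cvgM|exact: cvg_cst].
have hD : lorentz (eps n) z @[n --> \oo] --> (z ^+ 2)^-1.
  by apply: cvgV; [rewrite expf_neq0|rewrite mul0r add0r in h2].
have h3 : 2 * (eps n * eps n) * lorentz (eps n) z - 1 @[n --> \oo] -->
    2 * (0 * 0) * (z ^+ 2)^-1 - 1.
  apply: cvgB; last exact: cvg_cst.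
  by apply: cvgM => //; apply: cvgM; [exact: cvg_cst|exact: cvgM].
rewrite (_ : - (z ^+ 2)^-1 = (z ^+ 2)^-1 * (2 * (0 * 0) * (z ^+ 2)^-1 - 1)); last by ring.
by apply: cvgM.
Qed.

Definition height_conv e x := \int[mu]_y (poisson_height e (x - y) * w y).

(** The singular integral formula for pi Lw outside the support of [w]. Where [outside] is nonzero,
    x - y does not vanish on that support. *)
Definition far_field x := outside x * \int[mu]_y (- ((x - y) ^+ 2)^-1 * w y).

Lemma mheight_conv n : measurable_fun [set: R] (height_conv (eps n)).
Proof.
have [mQ _] := poisson_height_decaying (eps0 n).
apply: (@measurable_int_param _ (fun z => poisson_height (eps n) (z.1 - z.2) * w z.2)).
apply: measurable_funM.
  apply: measurableT_comp => //.
  by apply: measurable_funB; [exact: measurable_fst|exact: measurable_snd].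
by apply: measurableT_comp; [exact: w2.1|exact: measurable_snd].
Qed.

Lemma height_convE n x : height_conv (eps n) x = poisson_conv (eps n) Lw x.
Proof. exact: half_laplacian_poisson. Qed.

Lemma mheight_kernel n x :
  measurable_fun [set: R] (fun y => poisson_height (eps n) (x - y) * w y).
Proof.
apply: measurable_funM; last exact: w2.1.
exact: (decaying_shift x (poisson_height_decaying (eps0 n))).1.
Qed.

Lemma far_neq (x y : R) : M < `|x| -> `|y| <= N -> x - y != 0.
Proof.
move=> Mx yN; rewrite subr_eq0; apply/eqP => xy.
move: Mx; rewrite ltNge xy (le_trans yN)// /M; have := N0; lra.
Qed.

Lemma outside_height_conv_le n x :
  `|outside x * height_conv (eps n) x| <= C * W * (1 + x ^+ 2)^-1.
Proof.
rewrite outsideE; have [Mx|_] := ltP M `|x|; last first.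
  by rewrite mul0r normr0 (mulr_ge0 (mulr_ge0 C0 W0) (ltW (oneDsqrV_gt0 x))).
have [|_ _] // := far_conv_le Mx (mheight_kernel n x).
  by move=> y yN; apply: poisson_height_far_le => //; exact: far_neq.
by rewrite mul1r.
Qed.

Lemma far_kernel_cvg (x y : R) : M < `|x| ->
  poisson_height (eps n) (x - y) * w y @[n --> \oo] --> - ((x - y) ^+ 2)^-1 * w y.
Proof.
move=> Mx; have [yN|Ny] := leP `|y| N.
  by apply: cvgMl; apply: poisson_height_cvg; exact: far_neq.
rewrite wN// mulr0; apply: cvgn_ext (cvg_cst 0) => n.
by rewrite mulr0.
Qed.

Lemma far_field_cvg x :
  outside x * height_conv (eps n) x @[n --> \oo] --> far_field x.
Proof.
rewrite /far_field outsideE; have [Mx|_] := ltP M `|x|; last first.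
  by rewrite mul0r; apply: cvgn_ext (cvg_cst 0) => n; rewrite mul0r.
apply: cvgMr.
have [|||||_] // := @Rint_dominated _ (fun n y => poisson_height (eps n) (x - y) * w y)
  (fun y => - ((x - y) ^+ 2)^-1 * w y) (fun y => C * (1 + x ^+ 2)^-1 * `|w y|).
- by move=> n; exact: mheight_kernel.
- apply: (measurable_fun_cvg (mheight_kernel ^~ x)) => y _; exact: far_kernel_cvg.
- by apply: aeW => y; exact: far_kernel_cvg.
- exact/intgZ/intg_norm.
- move=> n y; have [|h _ _] // := far_conv_le Mx (mheight_kernel n x).
  by move=> y' yN; apply: poisson_height_far_le => //; exact: far_neq.
Qed.

(** Measurability and the bound both pass to the limit from Q_e * w, whose bound there does not
    depend on [e]. *)
Lemma far_field_decaying : decaying far_field.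
Proof.
split.
  apply: (@measurable_fun_cvg _ _ _ _ (fun n x => outside x * height_conv (eps n) x)).
    by move=> n; apply: measurable_funM; [exact: moutside|exact: mheight_conv].
  by move=> x _; exact: far_field_cvg.
exists (C * W) => [|x]; first exact: mulr_ge0.
have h : `|outside x * height_conv (eps n) x| @[n --> \oo] --> `|far_field x|.
  by apply: cvg_norm; exact: far_field_cvg.
rewrite -(cvg_lim (@Rhausdorff R) h); apply: limr_le; first exact: cvgP h.
by apply: nearW => n; exact: outside_height_conv_le.
Qed.

Lemma square_integrable_itv (a b : R) : square_integrable \1_`]a, b[.
Proof.
split; first exact: measurable_indic.
have := integrable_indic_itv a b false true; apply: eq_integrable => // x _ /=.
by rewrite indic_itvoo; case: (_ < _ < _); rewrite ?expr1n ?expr0n.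
Qed.

(** Over the part of any interval lying outside [-M, M], the integrals of Q_e * w = P_e * Lw have
    two limits: the weak one gives pi Lw, dominated convergence gives [far_field]. Agreement on all
    intervals forces equality almost everywhere. *)
Lemma far_field_ae : {ae mu, forall x, pi * (outside x * Lw x) = far_field x}.
Proof.
have T2 := decaying_square_integrable far_field_decaying.
have O2 := square_integrable_bounded Lw2 moutside outside_le1.
have O2' : square_integrable (fun x => pi * (outside x * Lw x)).
  exact: (square_integrable_bounded (M := `|pi|) O2).
suff : {ae mu, forall x, pi * (outside x * Lw x) - far_field x = 0}.
  by move=> h; apply: (ae_imp h) => x /eqP; rewrite subr_eq0 => /eqP.
apply: Rint_itv_eq0_ae => [|a b].
  exact/square_integrable_locally/square_integrableB.
have I2 := square_integrable_itv a b.
rewrite Rint_indic (@Rint_ext _ _ (fun x => pi * (\1_`]a, b[ x * (outside x * Lw x)) -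
  \1_`]a, b[ x * far_field x)); last by move=> x; ring.
have i1 := square_integrable_mul I2 O2; have i2 := square_integrable_mul I2 T2.
rewrite RintB//; last exact: intgZ.
rewrite RintZ//; apply/eqP; rewrite subr_eq0; apply/eqP.
pose g x := outside x * \1_`]a, b[ x.
have g2 : square_integrable g := square_integrable_bounded I2 moutside outside_le1.
have := poisson_weak_cvg g2 Lw2.
rewrite (@Rint_ext _ _ (fun x => \1_`]a, b[ x * (outside x * Lw x))); last first.
  by move=> x; rewrite /g; ring.
move/cvgn_unique; apply.
have [|||||_] // := @Rint_dominated _
  (fun n x => \1_`]a, b[ x * (outside x * height_conv (eps n) x))
  (fun x => \1_`]a, b[ x * far_field x) (fun x => C * W * (1 + x ^+ 2)^-1).
- move=> n; apply: measurable_funM; first exact: measurable_indic.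
  by apply: measurable_funM; [exact: moutside|exact: mheight_conv].
- by apply: measurable_funM; [exact: measurable_indic|exact: far_field_decaying.1].
- by apply: aeW => x; apply: cvgMr; exact: far_field_cvg.
- exact/intgZ/intg_oneDsqrV.
- move=> n x; rewrite (le_trans _ (outside_height_conv_le n x))//.
  rewrite normrM ler_piMl// indic_itvoo.
  by case: (_ < _ < _); rewrite ?normr1// normr0.
apply: cvgn_ext => n; apply: Rint_ext => x.
by rewrite height_convE /g; ring.
Qed.

Variables (al be : R) (f : R -> R).
Hypothesis f2 : square_integrable f.

(** The inner part of X f is square integrable, so weak convergence applies to it. The outer part of
    X f need not be; there Q_e * w converges pointwise with a uniform bound of order x^-2, and the
    growth of X is charged to this bound instead of to [f]. *)
Lemma affine_pairing_far :
  intg (fun x => (al * x + be) * (f x * Lw x)) /\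
  \int[mu]_x ((al * x + be) * f x * height_conv (eps n) x) @[n --> \oo] -->
  pi * \int[mu]_x ((al * x + be) * (f x * Lw x)).
Proof.
have [[mf _] [mL _]] := (f2, Lw2).
have mX := @maffine R al be.
pose fi x := \1_`[- M, M] x * f x.
have fi2 : square_integrable fi.
  apply: (square_integrable_bounded (M := 1)) => //.
  by move=> x; rewrite indic_itvcc; case: (_ <= _ <= _); rewrite ?normr1// normr0.
have fiM : vanishes_beyond M fi.
  by move=> x Mx; rewrite /fi indic_itvcc -ler_norml leNgt Mx mul0r.
have Xfi2 := affine_square_integrable al be fi2 fiM.
have split_f x : f x = fi x + outside x * f x by rewrite /fi /outside; ring.
have i1 := square_integrable_mul Xfi2 Lw2.
have X_far2 := affine_decaying_square_integrable al be far_field_decaying.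
have i2 := square_integrable_mul X_far2 f2.
have aeE : {ae mu, forall x, (al * x + be) * far_field x * f x =
    pi * ((al * x + be) * (outside x * f x * Lw x))}.
  by apply: (ae_imp far_field_ae) => x <-; ring.
have mO : measurable_fun [set: R] (fun x => (al * x + be) * (outside x * f x * Lw x)).
  apply: measurable_funM => //; apply: measurable_funM => //.
  by apply: measurable_funM => //; exact: moutside.
have i3' : intg (fun x => pi * ((al * x + be) * (outside x * f x * Lw x))).
  by apply: ae_eq_intg i2 => //; exact: measurable_funM.
have pi0 : pi != 0 :> R by rewrite gt_eqF// pi_gt0.
have i3 : intg (fun x => (al * x + be) * (outside x * f x * Lw x)).
  have := intgZ pi^-1 i3'; under eq_fun do rewrite mulrA mulVf// mul1r.
  by [].
have E : (fun x => (al * x + be) * (f x * Lw x)) =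
    (fun x => (al * x + be) * fi x * Lw x + (al * x + be) * (outside x * f x * Lw x)).
  by apply/funext => x; rewrite [f x]split_f /fi /outside; ring.
split; first by rewrite E; exact: intgD.
have E2 : pi * \int[mu]_x ((al * x + be) * (outside x * f x * Lw x)) =
    \int[mu]_x ((al * x + be) * far_field x * f x).
  rewrite -RintZ//; apply/esym/ae_eq_Rint => //; last exact: measurable_funM.
  by apply: measurable_funM => //; apply: measurable_funM => //; exact: far_field_decaying.1.
rewrite E RintD// mulrDr E2.
have c1 := poisson_weak_cvg Xfi2 Lw2.
have [|||||_ c2] // := @Rint_dominated _
  (fun n x => (al * x + be) * f x * (outside x * height_conv (eps n) x))
  (fun x => (al * x + be) * far_field x * f x)
  (fun x => C * W * `|(al * x + be) * (1 + x ^+ 2)^-1 * f x|).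
- move=> n; apply: measurable_funM; first exact: measurable_funM.
  by apply: measurable_funM; [exact: moutside|exact: mheight_conv].
- by apply: measurable_funM => //; apply: measurable_funM => //; exact: far_field_decaying.1.
- apply: aeW => x; rewrite mulrAC; apply: cvgMr; exact: far_field_cvg.
- apply/intgZ/intg_norm/square_integrable_mul => //.
  apply: affine_decaying_square_integrable; split.
    exact: intg_measurable (@intg_oneDsqrV R).
  by exists 1 => // x; rewrite mul1r ger0_norm// ltW// oneDsqrV_gt0.
- move=> n x; rewrite !normrM (ger0_norm (ltW (oneDsqrV_gt0 x))).
  rewrite (_ : C * W * _ = `|al * x + be| * `|f x| * (C * W * (1 + x ^+ 2)^-1)); last by ring.
  by rewrite ler_wpM2l// -normrM; exact: outside_height_conv_le.
apply: cvgn_ext (cvgD c1 c2) => n /=.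
rewrite -RintD.
- by apply: Rint_ext => x; rewrite -/(eps n) -height_convE [f x]split_f /fi /outside; ring.
- have [+ _] := poisson_schur (eps0 n) ltr01 Xfi2 Lw2; exact.
- apply: (@intg_le _ _ (fun x => C * W * `|(al * x + be) * (1 + x ^+ 2)^-1 * f x|)).
  + apply: measurable_funM; first exact: measurable_funM.
    by apply: measurable_funM; [exact: moutside|exact: mheight_conv].
  + move=> x; rewrite !normrM (ger0_norm (ltW (oneDsqrV_gt0 x))).
    rewrite (_ : C * W * _ = `|al * x + be| * `|f x| * (C * W * (1 + x ^+ 2)^-1)); last by ring.
    by rewrite ler_wpM2l// -normrM; exact: outside_height_conv_le.
  + apply/intgZ/intg_norm/square_integrable_mul => //.
    apply: affine_decaying_square_integrable; split.
      exact: intg_measurable (@intg_oneDsqrV R).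
    by exists 1 => // x; rewrite mul1r ger0_norm// ltW// oneDsqrV_gt0.
Qed.

End far_field.

(** * The scalar identity, and affine fields from affine flows *)

Section scalar_commutator.
Set Implicit Arguments.
Unset Strict Implicit.
Context {R : realType}.
Local Notation mu := (@lebesgue_measure R).
Local Notation intg f := (mu.-integrable [set: R] (EFin \o f)).

Lemma half_laplacian_L2 (f g : R -> R) : half_laplacian f g ->
  square_integrable f /\ square_integrable g.
Proof.
move=> [A [B [A' [B' [[f2 _ _ _ _] [g2 _ _ _ _] _]]]]].
by split; exact: L2_square_integrable.
Qed.

(** The regularized pairings tend to pi I1 and pi I2, while their sum is bounded by a constant times
    1/(n + 1); hence I1 + I2 = 0. *)
Lemma half_laplacian_commutator (u du Lu w dw Lw : R -> R) (N al be : R) : 0 < N ->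
  weak_derivative u du -> square_integrable du ->
  weak_derivative w dw -> square_integrable dw ->
  vanishes_beyond N w -> vanishes_beyond N dw ->
  half_laplacian u Lu -> half_laplacian w Lw ->
  [/\ intg (fun x => (al * x + be) * (Lu x * dw x)),
    intg (fun x => (al * x + be) * (du x * Lw x)) &
    - (\int[mu]_x ((al * x + be) * (Lu x * dw x))) =
    \int[mu]_x ((al * x + be) * (du x * Lw x))].
Proof.
move=> N0 udu du2 wdw dw2 wN dwN hu hw.
have [u2 Lu2] := half_laplacian_L2 hu; have [w2 Lw2] := half_laplacian_L2 hw.
have Xdw2 := affine_square_integrable al be dw2 dwN.
have E1 : (fun x => (al * x + be) * (Lu x * dw x)) =
    (fun x => (al * x + be) * dw x * Lu x) by apply/funext => x; ring.
have [i2 T2] := affine_pairing_far N0 w2 wN Lw2 hw al be du2.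
have T1 := poisson_weak_cvg Xdw2 Lu2.
have pi0 : pi != 0 :> R by rewrite gt_eqF// pi_gt0.
split => //; rewrite E1; first exact: square_integrable_mul.
set I1 := \int[mu]_x ((al * x + be) * dw x * Lu x) in T1 *.
set I2 := \int[mu]_x ((al * x + be) * (du x * Lw x)) in T2 *.
suff /eqP : pi * I1 + pi * I2 = 0.
  by rewrite -mulrDr mulf_eq0 (negbTE pi0)/= addr_eq0 => /eqP I12; rewrite -[RHS]opprK -I12.
(* Schur's bound with t = 1 for the pairing of [dw] with the Poisson integral of [du]; it is the
   same for all heights. *)
pose B : R := pi * (1 * \int[mu]_x (dw x ^+ 2) + 1^-1 * \int[mu]_x (du x ^+ 2)).
have h : `|al| * B * n.+1%:R^-1 @[n --> \oo] --> (0 : R).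
  by rewrite -(mulr0 (`|al| * B)); apply: cvgMr; exact: cvg_harmonic.
apply: cvgn_unique (cvgD T1 T2) _.
apply/cvgr0Pnorm_le => t t0; move/cvgr0Pnorm_le : h => /(_ t t0).
apply: filterS => n; apply: le_trans; rewrite (le_trans _ (ler_norm _))//.
set e := n.+1%:R^-1; have e0 : 0 < e by rewrite invr_gt0 ltr0n.
have := poisson_height_commutator al be e0 u2 du2 w2 dw2 udu wdw wN dwN.
rewrite (_ : \int[mu]_x _ = \int[mu]_x ((al * x + be) * dw x * poisson_conv e Lu x)); last first.
  by apply: Rint_ext => x; rewrite (half_laplacian_poisson e0 x hu).
rewrite /= => ->.
rewrite normrN normrM normrM (gtr0_norm e0) [leRHS]mulrAC.
rewrite ler_wpM2l ?mulr_ge0 ?(ltW e0)//.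
by have [_] := poisson_schur e0 ltr01 dw2 du2.
Qed.

(** An affine map is determined by its values at 0 and 1, so Phi t x = Phi t 1 x + Phi t 0 (1 - x).
    In this form the coefficients are integral curves, hence differentiable in t, and the derivative
    at t = 0 is X. *)
Lemma affine_flow_field (X : R -> R) (Phi : R -> R -> R) : flow X Phi ->
  (forall t, affine_map (Phi t)) -> exists al be, forall x, X x = al * x + be.
Proof.
move=> [Phi0 dPhi] aPhi; exists (X 1 - X 0), (X 0) => x.
have d0 (y : R) : is_derive (0 : R) 1 (Phi^~ y) (X y).
  by have := dPhi 0 y; rewrite Phi0.
have PhiE : Phi^~ x = fun t => Phi t 1 * x + Phi t 0 * (1 - x).
  by apply/funext => t; have [a [b E]] := aPhi t; rewrite !E; ring.
have h := isdD (isdM (d0 1) (is_derive_cst x (0 : R) 1))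
  (isdM (d0 0) (is_derive_cst (1 - x) (0 : R) 1)).
have [_ E] := d0 x; have [_ E'] := h.
by rewrite -E PhiE E' /=; ring.
Qed.

End scalar_commutator.

(** * Products with test functions and sums over components *)

Section H1_products.
Set Implicit Arguments.
Unset Strict Implicit.
Context {R : realType}.
Local Notation mu := (@lebesgue_measure R).
Local Notation intg f := (mu.-integrable [set: R] (EFin \o f)).

(** The given [du] and [dw] are arbitrary representatives: [du] is square integrable by comparison
    with [v], and [dw] is exchanged for a representative to which the commutator identity
    applies. *)
Lemma half_laplacian_product (u v du Lu phi dw Lw : R -> R) (al be : R) :
  weak_derivative u v -> square_integrable v -> weak_derivative u du ->
  test_function phi -> weak_derivative (fun x => phi x * u x) dw ->
  half_laplacian u Lu -> half_laplacian (fun x => phi x * u x) Lw ->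
  [/\ intg (fun x => (al * x + be) * (Lu x * dw x)),
    intg (fun x => (al * x + be) * (du x * Lw x)) &
    - (\int[mu]_x ((al * x + be) * (Lu x * dw x))) =
    \int[mu]_x ((al * x + be) * (du x * Lw x))].
Proof.
move=> uv v2 udu tphi wdw hu hw.
have [_ [mdu _ _] _] := udu; have [_ [mdw _ _] _] := wdw.
have du2 : square_integrable du.
  by apply: ae_eq_square_integrable v2 => //; exact: weak_derivative_unique udu.
have [u2 [mLu _]] := half_laplacian_L2 hu; have [w2 Lw2] := half_laplacian_L2 hw.
have tdphi := test_function_derive1 tphi.
have [N N0 phiN] := test_function_support tphi.
have [N' N'0 dphiN] := test_function_support tdphi.
have [M _ phiM] := test_function_bounded tphi.
have [M' _ dphiM] := test_function_bounded tdphi.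
(* The Leibniz representative of the derivative of phi u vanishes at every point beyond N + N', a
   radius covering the bounds for [phi] and for its derivative, whereas [dw] agrees with it only
   almost everywhere. *)
pose dw' x := phi x * du x + derive1 phi x * u x.
have wdw' : weak_derivative (fun x => phi x * u x) dw' := weak_derivativeM udu tphi.
have dw2 : square_integrable dw'.
  apply: square_integrableD.
    exact: square_integrable_bounded du2 (test_function_measurable tphi) phiM.
  exact: square_integrable_bounded u2 (test_function_measurable tdphi) dphiM.
have wN : vanishes_beyond (N + N') (fun x => phi x * u x).
  by move=> x Nx; rewrite phiN ?mul0r// (lt_trans _ Nx)// ltrDl.
have dwN : vanishes_beyond (N + N') dw'.
  move=> x Nx; rewrite /dw' phiN ?dphiN ?mul0r ?addr0//.
    by rewrite (lt_trans _ Nx)// ltrDr.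
  by rewrite (lt_trans _ Nx)// ltrDl.
have NN : 0 < N + N' by exact: addr_gt0.
have [i1 i2 E] := half_laplacian_commutator al be NN udu du2 wdw' dw2 wN dwN hu hw.
have mX := @maffine R al be; have [mdw' _] := dw2.
have ae_dw : {ae mu, forall x, (al * x + be) * (Lu x * dw' x) =
    (al * x + be) * (Lu x * dw x)}.
  by apply: (ae_imp (weak_derivative_unique wdw' wdw)) => x ->.
have mLdw : measurable_fun [set: R] (fun x => (al * x + be) * (Lu x * dw x)).
  by apply: measurable_funM => //; exact: measurable_funM.
have mLdw' : measurable_fun [set: R] (fun x => (al * x + be) * (Lu x * dw' x)).
  by apply: measurable_funM => //; exact: measurable_funM.
split => //; first exact: ae_eq_intg ae_dw i1.
by rewrite -E (ae_eq_Rint mLdw' mLdw ae_dw).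
Qed.

Lemma Rint_sum (I : finType) (f : I -> R -> R) : (forall i, intg (f i)) ->
  intg (fun x => \sum_i f i x) /\
  \int[mu]_x (\sum_i f i x) = \sum_i \int[mu]_x f i x.
Proof.
move=> fi; have [si sE] : intg (fun x => \sum_(i <- index_enum I) f i x) /\
    \int[mu]_x (\sum_(i <- index_enum I) f i x) =
    \sum_(i <- index_enum I) \int[mu]_x f i x.
  elim: (index_enum I) => [|i s [IHi IH]].
    rewrite (_ : (fun x => _) = fun=> 0); last by apply/funext => x; rewrite big_nil.
    by rewrite big_nil Rint0; split => //; exact: integrable0.
  rewrite (_ : (fun x => _) = (fun x => f i x + \sum_(j <- s) f j x)).
    by rewrite big_cons RintD// IH; split => //; exact: intgD.
  by apply/funext => x; rewrite big_cons.
by split.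
Qed.

End H1_products.

Theorem proposition4p14 (R : realType) (m : nat) (hm : (1 <= m)%N)
  (* u in H^1, u' = du, (-Delta)^{1/2} u = Lu *)
  (u du Lu : R -> 'rV[R]_m)
  (hu : H1 u) (hdu : vweak_derivative u du) (hLu : vhalf_laplacian u Lu)
  (X : R -> R) (Phi : R -> R -> R)
  (hX : flow X Phi) (hPhi : forall t : R, affine_map (Phi t)) :
  forall phi : R -> R, test_function phi ->
  (* (u phi)' = dv, (-Delta)^{1/2} (u phi) = Lv *)
  forall dv Lv : R -> 'rV[R]_m,
    vweak_derivative (fun x => phi x *: u x) dv ->
    vhalf_laplacian (fun x => phi x *: u x) Lv ->
  [/\ (@lebesgue_measure R).-integrable [set: R]
        (fun x => (X x * dot (Lu x) (dv x))%:E),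
      (@lebesgue_measure R).-integrable [set: R]
        (fun x => (X x * dot (du x) (Lv x))%:E) &
      - (\int[@lebesgue_measure R]_x (X x * dot (Lu x) (dv x)))
      = \int[@lebesgue_measure R]_x (X x * dot (du x) (Lv x))].
Proof.
move=> phi tphi dv Lv hdv hLv.
have [al [be XE]] := affine_flow_field hX hPhi.
have [_ [v uv v2]] := hu.
have wE i : component (fun x => phi x *: u x) i = fun x => phi x * component u i x.
  by apply/funext => x; rewrite /component mxE.
(* The scalar identity holds in each component with the same field, and both scalar products are
   finite sums over the components. *)
have key i := @half_laplacian_product R (component u i) (component v i) (component du i)
  (component Lu i) phi (component dv i) (component Lv i) al be (uv i)
  (L2_square_integrable (v2 i)) (hdu i) tphi.
have {}key i : _ := key i (eq_ind _ (fun f => weak_derivative f _) (hdv i) _ (wE i))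
  (hLu i) (eq_ind _ (fun f => half_laplacian f _) (hLv i) _ (wE i)).
have dotE (a b : R -> 'rV[R]_m) : (fun x => X x * dot (a x) (b x)) =
    (fun x => \sum_i (al * x + be) * (component a i x * component b i x)).
  by apply/funext => x; rewrite XE /dot mulr_sumr.
have [|i1 E1] := @Rint_sum R 'I_m (fun i x =>
    (al * x + be) * (component Lu i x * component dv i x)).
  by move=> i; case: (key i).
have [|i2 E2] := @Rint_sum R 'I_m (fun i x =>
    (al * x + be) * (component du i x * component Lv i x)).
  by move=> i; case: (key i).
split.
- by have := i1; rewrite -dotE.
- by have := i2; rewrite -dotE.
- rewrite (dotE Lu dv) (dotE du Lv) E1 E2 -sumrN.
  by apply: eq_bigr => i _; have [_ _] := key i.
Qed.
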